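(* Let $\boldsymbol\mu_b\in H^1(\Omega,\mathcal P(D))$. Then $$\sup_\varphi\left\{\mathrm{BT}_{\boldsymbol\mu_b}(\varphi):\ \varphi\in C^1(\Omega\times D,\mathbb R^p)\ \text{and}\ \nabla_\Omega\cdot\varphi+\frac{|\nabla_D\varphi|^2}{2}\le0\ \text{on}\ \Omega\times D\right\}=\min_{\boldsymbol\mu}\left\{\mathrm{Dir}(\boldsymbol\mu):\ \boldsymbol\mu\in H^1(\Omega,\mathcal P(D))\ \text{and}\ \boldsymbol\mu|_{\partial\Omega}=\boldsymbol\mu_b|_{\partial\Omega}\right\}.$$
   Context: Setting. $p,q\ge1$ are integers. $\Omega\subset\mathbb R^p$ is compact and connected, has non-empty interior $\mathring\Omega$, Lipschitz boundary (around any boundary point, up to a rotation, $\Omega$ is the epigraph of a Lipschitz function) and Lebesgue measure $1$. $D\subset\mathbb R^q$ is compact and convex with non-empty interior. $\mathcal P(D)$ is the set of Borel probability measures on $D$ with the quadratic Wasserstein distance $W_2$. $L^2(\Omega,\mathcal P(D))$ is the set of measurable maps $\boldsymbol\mu:\Omega\to\mathcal P(D)$ modulo a.e. equality; such a $\boldsymbol\mu$ is identified with the probability measure $\boldsymbol\mu(\mathrm d\xi,\mathrm dx)=\boldsymbol\mu(\xi,\mathrm dx)\,\mathrm d\xi$ on $\Omega\times D$. Dirichlet energy. $\nabla_\Omega\cdot$ is the divergence in $\xi\in\Omega$, $\nabla_D$ the gradient in $x\in D$; for $\varphi$ valued in $\mathbb R^p$, $(\nabla_D\varphi)^{\alpha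 i}=\partial_{x_i}\varphi^\alpha$, and $|\cdot|$ is the Euclidean norm on $\mathbb R^{pq}$. For $\mathbf E\in\mathcal M(\Omega\times D,\mathbb R^{pq})$ (finite vector measures), $(\boldsymbol\mu,\mathbf E)$ satisfies the continuity equation if $\iint\nabla_\Omega\cdot\varphi\,\mathrm d\boldsymbol\mu+\iint\nabla_D\varphi\cdot\mathrm d\mathbf E=0$ for all $\varphi\in C^1(\Omega\times D,\mathbb R^p)$ whose support is contained in $X\times D$ for some compact $X\subset\mathring\Omega$ (no support condition in $D$). In that case $$\mathrm{Dir}(\boldsymbol\mu,\mathbf E):=\sup\Big\{\iint a\,\mathrm d\boldsymbol\mu+\iint b\cdot\mathrm d\mathbf E:\ (a,b)\in C(\Omega\times D,\mathbb R\times\mathbb R^{pq}),\ a+\tfrac12|b|^2\le0\Big\}$$ (which, when finite, equals $\iint\frac12|\mathbf v|^2\mathrm d\boldsymbol\mu$ with $\mathbf E=\mathbf v\boldsymbol\mu$). $\mathrm{Dir}(\boldsymbol\mu)$ is the infimum of $\mathrm{Dir}(\boldsymbol\mu,\mathbf E)$ over all $\mathbf E$ such that $(\boldsymbol\mu,\mathbf E)$ satisfies the continuity equation ($+\infty$ if there is none), and $H^1(\Omega,\mathcal P(D))=\{\boldsymbol\mu\in L^2(\Omega,\mathcal P(D)):\mathrm{Dir}(\boldsymbol\mu)<+\infty\}$. Boundary values. For $\boldsymbol\mu\in H^1(\Omega,\mathcal P(D))$ and $\varphi\in C^1(\Omega\times D,\mathbb R^p)$ (no support condition), $\mathrm{BT}_{\boldsymbol\mu}(\varphi):=\iint\nabla_\Omega\cdot\varphi\,\mathrm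 d\boldsymbol\mu+\iint\nabla_D\varphi\cdot\mathrm d\mathbf E$, where $\mathbf E$ is any measure such that $(\boldsymbol\mu,\mathbf E)$ satisfies the continuity equation and $\mathrm{Dir}(\boldsymbol\mu,\mathbf E)<+\infty$ (the value does not depend on $\mathbf E$). $\boldsymbol\mu|_{\partial\Omega}=\boldsymbol\nu|_{\partial\Omega}$ means $\mathrm{BT}_{\boldsymbol\mu}=\mathrm{BT}_{\boldsymbol\nu}$. *)

(* Defs.v *)
From HB Require Import structures.
From mathcomp Require Import all_boot all_order all_algebra.
From mathcomp Require Import all_classical all_reals all_analysis.
From mathcomp Require Import measurable_realfun.
Set Implicit Arguments.
Unset Strict Implicit.
Unset Printing Implicit Defensive.
Import Order.TTheory GRing.Theory Num.Theory.
Import numFieldNormedType.Exports.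
Local Open Scope classical_set_scope.
Local Open Scope ring_scope.

Definition borel_mx_display : measure_display. Proof. by constructor. Qed.

(* Matrices, hence row vectors, carry their Borel sigma-algebra. *)
Section borel_matrix.
Context {R : realType} (m n : nat).

Let open_mx := [set U : set 'M[R]_(m, n) | open U].

HB.instance Definition _ := @isMeasurable.Build borel_mx_display
  'M[R]_(m, n) <<s open_mx >>
  (@sigma_algebra0 _ setT open_mx) (@sigma_algebraC _ open_mx)
  (@sigma_algebra_bigcup _ setT open_mx).

End borel_matrix.

Section lebesgue_rV.
Context {R : realType}.

Lemma measurable_open_mx m n (U : set 'M[R]_(m, n)) : open U -> measurable U.
Proof. by move=> oU; apply: sub_sigma_algebra. Qed.

Lemma measurable_coord_rV n (i : 'I_n) :
  measurable_fun setT (fun x : 'rV[R]_n => x 0 i).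
Proof.
apply: (measurability _ (RGenOpens.measurableE R)).
move=> _ [_ [a [b ->] <-]]; rewrite setTI; apply: measurable_open_mx.
by apply: open_comp => [x _|]; [exact: coord_continuous|exact: interval_open].
Qed.

Lemma measurable_fun_rV d (T : measurableType d) n (f : T -> 'rV[R]_n) :
  (forall i, measurable_fun setT (fun t => f t 0 i)) -> measurable_fun setT f.
Proof.
move=> mf; apply: (@measurability _ _ _ _ _ _ [set U : set 'rV[R]_n | open U]).
  by [].
move=> _ [U oU <-]; rewrite setTI.
pose B (z : 'rV[rat]_n * nat) : set 'rV[R]_n :=
  ball (map_mx (ratr : rat -> R) z.1) (z.2.+1%:R^-1 : R).
pose B' z := if `[< B z `<=` U >] then B z else set0.
have UE : U = \bigcup_z B' z.
  apply/seteqP; split => [x Ux|x [z _]]; last first.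
    by rewrite /B'; case: asboolP => // zU /zU.
  have /nbhs_ballP[e /= e0 xeU] : nbhs x U by exact: open_nbhs_nbhs.
  have e20 : 0 < e / 2 by rewrite divr_gt0.
  have [k _ /(_ _ (leqnn _)) /= ke] := near_infty_natSinv_lt (PosNum e20).
  have k0 : 0 < (k.+1%:R^-1 : R) by rewrite invr_gt0.
  have /choice[q qx] : forall i : 'I_n, exists q : rat,
      ball (x 0 i) (k.+1%:R^-1 : R) (ratr q).
    move=> i; have := @dense_rat R (ball (x 0 i) (k.+1%:R^-1 : R)).
    case; [|exact: ball_open|by move=> _ [] /[swap] -[q _ <-]; exists q].
    by exists (x 0 i); exact: ballxx.
  have xB : B (\row_i q i, k) x.
    apply: ball_sym; split => // i j; rewrite !mxE (ord1 i); exact: qx.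
  exists (\row_i q i, k) => //; rewrite /B'; case: asboolP => // -[].
  move=> y By; apply: xeU; rewrite (splitr e).
  apply: ball_triangle; last first.
    by apply: le_ball By; exact: ltW.
  by apply: ball_sym; apply: le_ball xB; exact: ltW.
rewrite UE preimage_bigcup; apply: countable_bigcupT_measurable => [|z]; first exact: countableP.
rewrite /B'; case: ifP => _; last by rewrite preimage_set0.
rewrite (_ : _ @^-1` _ = \bigcap_(i in [set: 'I_n])
   ((fun t => f t 0 i) @^-1` ball (ratr (z.1 0 i) : R) (z.2.+1%:R^-1 : R))).
  apply: fin_bigcap_measurable => // i _.
  rewrite -[X in measurable X]setTI; apply: mf => //.
  by apply: open_measurable; exact: ball_open.
apply/seteqP; split => [t [_ /= Bt] i _ /=|t /= Bt].
  by have := Bt 0 i; rewrite mxE.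
by split; rewrite // => i j; rewrite mxE (ord1 i); exact: Bt.
Qed.

Definition rV_cons n (z : measurableTypeR R * 'rV[R]_n) : 'rV[R]_n.+1 :=
  \row_i oapp (z.2 0) z.1 (unlift ord0 i).

Definition rV_uncons n (x : 'rV[R]_n.+1) : measurableTypeR R * 'rV[R]_n :=
  (x 0 ord0, \row_i x 0 (lift ord0 i)).

Lemma rV_consK n : cancel (@rV_cons n) (@rV_uncons n).
Proof.
move=> [a v]; congr pair; first by rewrite mxE unlift_none.
by apply/rowP => i; rewrite !mxE liftK.
Qed.

Lemma measurable_rV_cons n : measurable_fun setT (@rV_cons n).
Proof.
apply: measurable_fun_rV => i.
rewrite [X in measurable_fun _ X](_ : _ = fun z : measurableTypeR R * 'rV[R]_n =>
    oapp (z.2 0) (z.1 : R) (unlift ord0 i)); last first.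
  by apply/funext => z; rewrite mxE.
case: (unliftP ord0 i) => [j|] _ /=; last exact: measurable_fst.
exact: (measurableT_comp (measurable_coord_rV j) measurable_snd).
Qed.

Lemma measurable_rV_uncons n : measurable_fun setT (@rV_uncons n).
Proof.
apply: measurable_fun_pair; first exact: measurable_coord_rV.
apply: measurable_fun_rV => i.
rewrite [X in measurable_fun _ X](_ : _ = fun x : 'rV[R]_n.+1 =>
    x 0 (lift ord0 i)); last first.
  by apply/funext => x; rewrite mxE.
exact: measurable_coord_rV.
Qed.

Section step.
Context (n : nat) (mu : {sigma_finite_measure set 'rV[R]_n -> \bar R}).

Definition lebesgue_step : set 'rV[R]_n.+1 -> \bar R :=
  pushforward (@lebesgue_measure R \x mu)%E (@rV_cons n).

HB.instance Definition _ := Measure.copy lebesgue_step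
  (measure_function_pushforward__canonical__measure_function_Measure
    (@lebesgue_measure R \x mu)%E (@measurable_rV_cons n)).

Let lebesgue_step_sigma_finite : sigma_finite setT lebesgue_step.
Proof.
have /sigma_finiteP[F [TF ndF Foo]] := sigma_finiteT (@lebesgue_measure R).
have /sigma_finiteP[G [TG ndG Goo]] := sigma_finiteT mu.
exists (fun k => @rV_uncons n @^-1` (F k `*` G k)).
  rewrite -preimage_bigcup; apply/seteqP; split => // x _ /=.
  have [i _ Fi] : (\bigcup_i F i) (rV_uncons x).1 by rewrite -TF.
  have [j _ Gj] : (\bigcup_i G i) (rV_uncons x).2 by rewrite -TG.
  exists (maxn i j) => //; split.
  - by move: Fi; exact/subsetPset/ndF/leq_maxl.
  - by move: Gj; exact/subsetPset/ndG/leq_maxr.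
move=> k; have [mF Fk] := Foo k; have [mG Gk] := Goo k; split.
  rewrite -[X in measurable X]setTI; apply: measurable_rV_uncons => //.
  exact: measurableX.
rewrite /lebesgue_step /pushforward -comp_preimage.
rewrite (_ : _ \o _ = id) ?preimage_id; last first.
  by apply/funext => z; exact: rV_consK.
by rewrite product_measure1E// lte_mul_pinfty// ge0_fin_numE.
Qed.

HB.instance Definition _ := Measure_isSigmaFinite.Build _ _ _ lebesgue_step
  lebesgue_step_sigma_finite.

End step.

Fixpoint lebesgue_rV n : {sigma_finite_measure set 'rV[R]_n -> \bar R} :=
  match n with
  | 0 => dirac (0 : 'rV[R]_0)
  | n'.+1 => lebesgue_step (lebesgue_rV n')
  end.

Lemma lebesgue_rV_box n (a b : 'rV[R]_n) : (forall i, a 0 i <= b 0 i) ->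
  lebesgue_rV n [set x | forall i, a 0 i <= x 0 i <= b 0 i] =
  (\prod_i (b 0 i - a 0 i))%:E.
Proof.
elim: n a b => [|n IH] a b ab.
  by rewrite big_ord0 /= diracE mem_set// => -[].
pose a' := (rV_uncons a).2; pose b' := (rV_uncons b).2.
have mbox : measurable [set x : 'rV[R]_n | forall i, a' 0 i <= x 0 i <= b' 0 i].
  rewrite (_ : [set _ | _] = \bigcap_(i in [set: 'I_n])
     ((fun x : 'rV[R]_n => x 0 i) @^-1` `[a' 0 i, b' 0 i])).
    apply: fin_bigcap_measurable => // i _.
    by rewrite -[X in measurable X]setTI; exact: measurable_coord_rV.
  by apply/seteqP; split=> x /= h i; [move=> _|]; have := h i;
    rewrite /= ?in_itv//=; apply.
transitivity ((@lebesgue_measure R \x lebesgue_rV n)%E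
    ((`[a 0 ord0, b 0 ord0]%classic : set (measurableTypeR R)) `*`
     [set x : 'rV[R]_n | forall i, a' 0 i <= x 0 i <= b' 0 i])).
  congr ((@lebesgue_measure R \x lebesgue_rV n)%E _).
  apply/seteqP; split=> -[x y] /= => [h|[h1 h2] i].
    split; first by have := h ord0; rewrite mxE unlift_none in_itv.
    by move=> i; have := h (lift ord0 i); rewrite !mxE liftK.
  rewrite mxE; case: (unliftP ord0 i) => [j|] ->; last by rewrite in_itv in h1.
  by have := h2 j; rewrite !mxE.
rewrite product_measure1E// IH; last by move=> i; rewrite !mxE.
rewrite big_ord_recl EFinM; congr (_ * _)%E; last first.
  by congr (_%:E); apply: eq_bigr => i _; rewrite !mxE.
rewrite [LHS](lebesgue_measure_itv `[a 0 ord0, b 0 ord0]) /= lte_fin; case: ltP => [//|ba].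
by rewrite (@le_anti _ _ (a 0 ord0) (b 0 ord0)) ?ba ?ab// subrr.
Qed.

End lebesgue_rV.

Section wasserstein.
Context {R : realType} {q : nat}.
Implicit Types (D : set 'rV[R]_q) (P Q : probability 'rV[R]_q R).

Definition prob_on D : set (probability 'rV[R]_q R) := [set P | P D = 1%E].

Definition coupling P Q : set (probability ('rV[R]_q * 'rV[R]_q)%type R) :=
  [set g | forall A, measurable A ->
     g (A `*` setT) = P A /\ g (setT `*` A) = Q A].

(* The matrix norm of the library is the sup norm, so Euclidean norms are
   written out. *)
Definition sqdist (x y : 'rV[R]_q) : R := \sum_i (x 0 i - y 0 i) ^+ 2.

Definition W2 P Q : R := Num.sqrt (fine (ereal_inf
  [set (\int[g]_z (sqdist z.1 z.2)%:E)%E | g in coupling P Q])).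

Definition W2_open D : set (set (probability 'rV[R]_q R)) :=
  [set U | U `<=` prob_on D /\ forall P, U P ->
     exists2 r : R, 0 < r & forall Q, prob_on D Q -> W2 P Q < r -> U Q].

(* The Borel sigma-algebra of (prob_on D, W2). *)
Definition W2_borel D : set (set (probability 'rV[R]_q R)) :=
  <<s prob_on D, W2_open D>>.

End wasserstein.

(* Integral against a signed measure; the value does not depend on the chosen
   Hahn decomposition, which is unique up to null sets. *)
Definition charge_integral d (T : measurableType d) (R : realType)
    (nu : {charge set T -> \bar R}) (A : set T) (f : T -> R) : R :=
  let nuPN := projT2 (cid (projT2 (cid (Hahn_decomposition nu)))) in
  \int[jordan_pos nuPN]_(z in A) f z - \int[jordan_neg nuPN]_(z in A) f z.

(* An arbitrary orthogonal matrix is allowed (for p = 1 there is no nontrivial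
   rotation), and the height is any coordinate of the rotated frame. *)
Definition lipschitz_boundary (R : realType) (p : nat)
    (Omega : set 'rV[R]_p) :=
  forall xi, (closure Omega `\` Omega°) xi ->
  exists (A : 'M[R]_p) (i : 'I_p) (f : 'rV[R]_p.-1 -> R),
    [/\ A *m A^T = 1%:M,
        exists k : R, k.-lipschitz f &
        \forall eta \near xi,
          Omega eta <-> f (col' i (eta *m A)) <= (eta *m A) 0 i].

Section dirichlet.
Context {R : realType} {p q : nat}.
Variables (Omega : set 'rV[R]_p) (D : set 'rV[R]_q).

Local Notation T := ('rV[R]_p * 'rV[R]_q)%type.
Local Notation OD := (Omega `*` D).
Implicit Types (mu nu : 'rV[R]_p -> probability 'rV[R]_q R)
  (E : 'I_p -> 'I_q -> {charge set T -> \bar R}).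

Definition sqnorm (b : 'M[R]_(p, q)) : R := \sum_a \sum_i b a i ^+ 2.

(* C^1 up to the boundary: the differential, defined in the interior, extends
   continuously to Omega `*` D; c1_diff is that extension. *)
Record C1 := MkC1 {
  c1_val :> T -> 'rV[R]_p ;
  c1_diff : T -> T -> 'rV[R]_p ;
  _ : {within OD, continuous c1_val} ;
  _ : forall v, {within OD, continuous (c1_diff ^~ v)} ;
  _ : forall z, OD° z -> is_diff z c1_val (c1_diff z) }.

Definition divO (phi : C1) (z : T) : R :=
  \sum_a c1_diff phi z (delta_mx 0 a, 0) 0 a.

Definition gradD (phi : C1) (z : T) : 'M[R]_(p, q) :=
  \matrix_(a, i) c1_diff phi z (0, delta_mx 0 i) 0 a.

Definition interior_support (phi : C1) :=
  exists X : set 'rV[R]_p, [/\ compact X, X `<=` Omega° &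
    forall z, OD z -> phi z != 0 -> X z.1].

(* A map is given by a representative defined on the whole space; its values
   outside Omega are irrelevant. *)
Definition L2map mu :=
  (forall xi, Omega xi -> prob_on D (mu xi)) /\
  (forall B, W2_borel D B -> measurable (Omega `&` mu @^-1` B)).

(* Integral of f against the measure mu(xi, dx) dxi on Omega `*` D. *)
Definition map_integral mu (f : T -> R) : R :=
  \int[lebesgue_rV p]_(xi in Omega) \int[mu xi]_(x in D) f (xi, x).

Definition vmeasure_on E := forall a i A,
  measurable A -> A `&` OD = set0 -> E a i A = 0%E.

Definition vmeasure_integral E (b : T -> 'M[R]_(p, q)) : R :=
  \sum_a \sum_i charge_integral (E a i) OD (fun z => b z a i).

Definition pairing mu E (phi : C1) : R :=
  map_integral mu (divO phi) + vmeasure_integral E (gradD phi).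

Definition continuity_eq mu E :=
  vmeasure_on E /\ forall phi, interior_support phi -> pairing mu E phi = 0.

Definition Dir2 mu E : \bar R := ereal_sup
  [set r | exists (a : T -> R) (b : T -> 'M[R]_(p, q)),
    [/\ {within OD, continuous a}, {within OD, continuous b},
        forall z, OD z -> a z + sqnorm (b z) / 2 <= 0 &
        r = (map_integral mu a + vmeasure_integral E b)%:E]].

Definition Dir mu : \bar R :=
  ereal_inf [set Dir2 mu E | E in continuity_eq mu].

Definition H1 mu := L2map mu /\ (Dir mu < +oo)%E.

(* The set below is a singleton when mu is in H1. *)
Definition BT mu (phi : C1) : R := xget 0
  [set v | exists E, [/\ continuity_eq mu E, (Dir2 mu E < +oo)%E &
                         v = pairing mu E phi]].

Definition same_boundary mu nu := forall phi, BT mu phi = BT nu phi.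

End dirichlet.

(* Main.v *)
(* Weak duality is the boundary-trace formula together with the definition of
   the energy. For the converse, let S be the supremum. On pairs (a, b) of
   bounded functions consider the linear form given by integration against
   (mub, Eb), restricted to the pairs (div phi, grad phi). It is dominated by
   S + 1 times a sublinear gauge whose unit ball is { a + |b|^2/2 <= 1 },
   because phi = - xi_0 e_0 produces the constant pair (-1, 0), with value -1.
   A Hahn-Banach extension L then satisfies L(a, b) <= S whenever
   a + |b|^2/2 <= 0; its a-component is positive and by Riesz it is given by a
   measure M and charges E. Test functions phi depending on xi only force the
   first marginal of M to be Lebesgue measure on Omega, so M disintegrates into
   a map mu with Dir(mu, E) <= S and the boundary values of mub.

   Riesz and the disintegration are both obtained by coding a compact metric
   space into the Cantor space nat -> bool, where a consistent assignment of
   weights to finite binary words is a measure. The boundary trace does not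
   depend on E because the boundary of Omega is Lebesgue null (its Lipschitz
   graphs have infinitely many disjoint translates of equal measure) and
   because finiteness of the energy controls E near the boundary. *)
From HB Require Import structures.
Require Import Defs.
From mathcomp Require Import all_boot all_order all_algebra finmap.
From mathcomp Require Import all_classical all_reals all_analysis.
From mathcomp Require Import measurable_realfun.
From mathcomp Require Import ring lra.
Set Implicit Arguments.
Unset Strict Implicit.
Unset Printing Implicit Defensive.
Import Order.TTheory GRing.Theory Num.Theory.
Import numFieldNormedType.Exports.
Local Open Scope classical_set_scope.
Local Open Scope ring_scope.

(** Extending to bounded, possibly discontinuous, data is what makes the representation elementary:
    the extension [L] can be evaluated at indicators of code cells, so Riesz reduces to additive
    weights on binary words, and continuity of a function only serves to approximate it uniformly by
    step functions of its code. The [1] in [S + 1] is the value lost on the constant pair (-1, 0).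
    Adding that pair to [u / t] turns any [u] satisfying [a + |b|^2 / (2 t) <= t] into an admissible
    pair, which gives the bound [t (S + 1)]. Conversely, subtracting it from an admissible (a, b)
    gives a pair of gauge at most 1, and [L] of the difference is [L(a, b) + 1], so the bound [S]
    comes back without loss. The minimiser is read off [L], so attainment comes together with
    equality. A second obstacle is measurability: maps are Borel for [W2], whereas integration and
    disintegration deal with kernels. The two notions are shown to agree, one way by Markov's
    inequality for couplings, the other by an explicit coupling of two measures that are comparable
    cell by cell. *)

Section hahn_banach.
Context {R : realType} {V : lmodType R}.
Implicit Types (B W : set V) (p l : V -> R).

Definition linear_subspace B := B 0 /\ forall a u v, B u -> B v -> B (a *: u + v).

Definition linear_on B l := forall a u v, B u -> B v ->
  l (a *: u + v) = a * l u + l v.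

Definition sublinear_on B p :=
  (forall u v, B u -> B v -> p (u + v) <= p u + p v) /\
  (forall t u, 0 < t -> B u -> p (t *: u) = t * p u).

(** Zorn's lemma is applied to subsets of [V * R] that are linear, lie below [p] and contain the
    graph of [l]; single values are not demanded. They follow from domination: two values at one
    point would put some [(0, d)] with [d != 0] into the graph, and every multiple of [d] would be
    at most [p 0 = 0]. *)
Lemma hahn_banach B W p l : linear_subspace B -> sublinear_on B p ->
  linear_subspace W -> W `<=` B -> linear_on W l -> (forall u, W u -> l u <= p u) ->
  exists L, [/\ linear_on B L, forall u, W u -> L u = l u &
                forall u, B u -> L u <= p u].
Proof.
move=> [B0 Blin] [psub phom] [W0 Wlin] WB llin lp.
have BN u : B u -> B (- u).
  by move=> Bu; have := Blin (-1) u 0 Bu B0; rewrite scaleN1r addr0.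
have BD u v : B u -> B v -> B (u + v).
  by move=> Bu Bv; have := Blin 1 u v Bu Bv; rewrite scale1r.
have BZ a u : B u -> B (a *: u).
  by move=> Bu; have := Blin a u 0 Bu B0; rewrite addr0.
have p0 : p 0 = 0.
  have := phom 2 0 (ltr0Sn _ _) B0; rewrite scaler0 => p0.
  lra.
pose ok (G : set (V * R)) :=
  [/\ forall z, G z -> B z.1 /\ z.2 <= p z.1,
      forall a z w, G z -> G w -> G (a *: z.1 + w.1, a * z.2 + w.2) &
      forall u, W u -> G (u, l u)].
have l0 : l 0 = 0.
  by have := llin 1 0 0 W0 W0; rewrite scale1r addr0 mul1r; lra.
pose P : set (set (V * R)) := [set G | G = set0 \/ ok G].
have [G [PG Gmax]] : exists A, P A /\ forall A' : set (V * R), A `<` A' -> ~ P A'.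
  apply: Zorn_bigcup => F FP Ftot.
  have [[G [FG okG]]|Fno] := pselect (exists G, F G /\ ok G); last first.
    left; rewrite -subset0 => z [G FG Gz].
    have [G0|okG] := FP _ FG; first by rewrite G0 in Gz.
    by apply: Fno; exists G.
  right; have okF X z : F X -> X z -> ok X.
    by move=> /FP[->|].
  split.
  - by move=> z [X FX Xz]; have [+ _ _] := okF _ _ FX Xz; exact.
  - move=> a z w [X FX Xz] [Y FY Yw].
    have [XY|YX] := Ftot _ _ FX FY.
      exists Y => //; have [_ + _] := okF _ _ FY Yw; apply => //; exact: XY.
    exists X => //; have [_ + _] := okF _ _ FX Xz; apply => //; exact: YX.
  - by move=> u Wu; exists G => //; have [_ _] := okG; exact.
have okG : ok G.
  have [G0|//] := PG; exfalso.
  pose G' := [set z : V * R | W z.1 /\ z.2 = l z.1].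
  apply: (Gmax G'); last first.
    right; split => //.
    - by move=> [u r] [/= Wu ->]; split; [exact: WB|exact: lp].
    - move=> a [u r] [v s] [/= Wu ->] [/= Wv ->]; split => /=; first exact: Wlin.
      by rewrite llin.
  rewrite G0; split => // /(_ (0, l 0)); exact.
have [Gp Glin GW] := okG.
have G00 : G (0, 0) by have := GW 0 W0; rewrite l0.
have Gdom v : B v -> exists r, G (v, r).
  move=> Bv; apply: contrapT => /forallNP Gv.
  (* A value at [v] has to lie above all of [E] and below all [p (w.1 + v) - w.2]. Subadditivity
     puts the first family below the second, so [sup E] is a legitimate choice. *)
  pose E := [set z.2 - p (z.1 - v) | z in G].
  have Eub z w : G z -> G w -> z.2 - p (z.1 - v) <= p (w.1 + v) - w.2.
    move=> Gz Gw; rewrite lerBlDr addrAC lerBrDr.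
    have [Bz _] := Gp _ Gz; have [Bw _] := Gp _ Gw.
    have := Glin 1 z w Gz Gw; rewrite scale1r mul1r => /Gp[/= _].
    move=> /le_trans; apply.
    rewrite [X in p X <= _](_ : _ = (w.1 + v) + (z.1 - v)); last first.
      by rewrite addrACA subrr addr0 addrC.
    by apply: psub; [exact: BD|apply: BD => //; exact: BN].
  have E0 : E !=set0 by exists (0 - p (0 - v)), (0, 0).
  pose r := sup E.
  have rle w : G w -> r <= p (w.1 + v) - w.2.
    by move=> Gw; apply: ge_sup => // _ [z Gz <-]; exact: Eub.
  have ler z : G z -> z.2 - p (z.1 - v) <= r.
    move=> Gz; apply: ub_le_sup; last by exists z.
    by exists (p (0 + v) - 0) => _ [w Gw <-]; exact: (Eub w (0, 0)).
  have GZ a z : G z -> G (a *: z.1, a * z.2).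
    by move=> Gz; have := Glin a z (0, 0) Gz G00; rewrite /= !addr0.
  pose G' := [set z | exists w a, G w /\ z = (w.1 + a *: v, w.2 + a * r)].
  apply: (Gmax G').
    split; first by move=> z Gz; exists z, 0; split=> //; rewrite scale0r mul0r !addr0 -surjective_pairing.
    move=> /(_ (v, r)) G'v; apply: (Gv r); apply: G'v; exists (0, 0), 1; split => //=.
    by rewrite scale1r mul1r !add0r.
  right; split.
  - move=> _ [w [a [Gw ->]]]; have [Bw wp] := Gp _ Gw; split; first by apply: BD => //; exact: BZ.
    (* Dividing by the absolute value of the coefficient of [v] reduces domination to the
       coefficients -1 and 1, where it is the lower and the upper bound on [r]. *)
    move=> /=; have [a0|a0|->] := ltgtP a 0; last by rewrite scale0r mul0r !addr0.
      have a'0 : 0 < - a by rewrite oppr_gt0.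
      have := ler _ (GZ (- a)^-1 _ Gw) => /=.
      rewrite -(ler_pM2l a'0) mulrBr mulrA divff ?gt_eqF// mul1r -phom//; last first.
        by apply: BD; [exact: BZ|exact: BN].
      rewrite scalerBr scalerA divff ?gt_eqF// scale1r scaleNr opprK mulNr.
      by rewrite lerBlDr addrC -lerBlDr opprK.
    have := rle _ (GZ a^-1 _ Gw) => /=.
    rewrite -(ler_pM2l a0) mulrBr mulrA divff ?gt_eqF// mul1r -phom//; last first.
      by apply: BD => //; exact: BZ.
    by rewrite scalerDr scalerA divff ?gt_eqF// scale1r lerBrDr addrC.
  - move=> c _ _ [w [a [Gw ->]]] [w' [a' [Gw' ->]]] /=.
    exists (c *: w.1 + w'.1, c * w.2 + w'.2), (c * a + a'); split; first exact: Glin.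
    congr pair => /=; last by ring.
    by rewrite scalerDr scalerA scalerDl addrACA.
  - by move=> u Wu; exists (u, l u), 0; split; [exact: GW|rewrite /= scale0r mul0r !addr0].
have Gfun u r s : G (u, r) -> G (u, s) -> r = s.
  move=> Gr Gs; have := Glin (-1) _ _ Gr Gs; rewrite /= scaleN1r addNr mulN1r => G0.
  have h a : a * (- r + s) <= 0.
    by have := Glin a _ _ G0 G00; rewrite /= scaler0 !addr0 => /Gp[_ /=]; rewrite p0.
  apply/eqP; rewrite eq_sym -subr_eq0 addrC; apply/eqP/le_anti.
  by have := h 1; have := h (-1); rewrite mulN1r mul1r oppr_le0 => -> ->.
pose L u := xget 0 [set r | G (u, r)].
have LG u : B u -> G (u, L u).
  by move=> /Gdom[r Gr]; rewrite /L; apply: (@xgetPex _ 0 [set r | G (u, r)]); exists r.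
exists L; split.
- move=> a u v Bu Bv; apply: (@Gfun (a *: u + v)); first by apply: LG; exact: Blin.
  by apply: (Glin a (u, _) (v, _)); exact: LG.
- by move=> u Wu; apply: (@Gfun u); [apply: LG; exact: WB|exact: GW].
- by move=> u Bu; have [] := Gp _ (LG _ Bu).
Qed.

End hahn_banach.

(** * Measures on the Cantor space *)

Definition cantor := nat -> bool.
Definition cantor_display : measure_display. Proof. by constructor. Qed.

Section cantor_algebra.
Implicit Types (x y : cantor) (s : seq bool).

Definition agree n x y := forall k, (k < n)%N -> x k = y k.

Definition cylinder n (A : set cantor) := forall x y, agree n x y -> A x -> A y.

Lemma agree_sym n x y : agree n x y -> agree n y x.
Proof. by move=> h k /h. Qed.

Lemma agree_trans n x y z : agree n x y -> agree n y z -> agree n x z.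
Proof. by move=> h h' k kn; rewrite h// h'. Qed.

Lemma agree_le m n x y : (m <= n)%N -> agree n x y -> agree m x y.
Proof. by move=> mn h k km; apply: h; exact: leq_trans km mn. Qed.

Lemma cylinder_le m n A : (m <= n)%N -> cylinder m A -> cylinder n A.
Proof. by move=> mn h x y /(agree_le mn); exact: h. Qed.

Let cyl : set (set cantor) := [set A | exists n, cylinder n A].

Let cyl0 : cyl set0. Proof. by exists 0%N => x y. Qed.

Let cylU : setU_closed cyl.
Proof.
move=> A B [m mA] [n nB]; exists (maxn m n) => x y xy [Ax|Bx].
  by left; move: Ax; apply: mA; apply: agree_le xy; exact: leq_maxl.
by right; move: Bx; apply: nB; apply: agree_le xy; exact: leq_maxr.
Qed.

Let cylC : setC_closed cyl.
Proof.
by move=> A [n nA]; exists n => x y /agree_sym xy nAx Ay; apply: nAx; exact: nA Ay.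
Qed.

HB.instance Definition _ := gen_eqMixin cantor.
HB.instance Definition _ := gen_choiceMixin cantor.
HB.instance Definition _ := isPointed.Build cantor (fun _ => false).
HB.instance Definition _ := @isAlgebraOfSets.Build cantor_display cantor cyl
  cyl0 cylU cylC.

Definition cone s : set cantor := [set x | mkseq x (size s) = s].

Lemma mkseq_agree n x y : (mkseq x n = mkseq y n) <-> agree n x y.
Proof.
split=> [xy k kn|xy].
  by rewrite -(nth_mkseq false x kn) xy nth_mkseq.
apply: (@eq_from_nth _ false); rewrite !size_mkseq// => k kn.
by rewrite !nth_mkseq// xy.
Qed.

Lemma cone_cylinder s : cylinder (size s) (cone s).
Proof. by move=> x y /mkseq_agree xy; rewrite /cone/= xy. Qed.

Lemma cone0 : cone [::] = setT.
Proof. by rewrite -subTset. Qed.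

Lemma cone_rcons s : cone s = cone (rcons s false) `|` cone (rcons s true).
Proof.
apply/seteqP; split=> x; rewrite /cone/= !size_rcons mkseqS.
  by move=> ->; case: (x (size s)); [right|left].
by move=> [|] /rcons_inj[].
Qed.

Lemma cone_rcons_disj s : cone (rcons s false) `&` cone (rcons s true) = set0.
Proof.
by rewrite -subset0 => x; rewrite /cone/= !size_rcons mkseqS => -[-> /rcons_inj[]].
Qed.

Definition cantor_ext s : cantor := nth false s.

Lemma cone_ext s : cone s (cantor_ext s).
Proof. exact: mkseq_nth. Qed.

Lemma measurable_cone s : measurable (cone s).
Proof. by exists (size s); exact: cone_cylinder. Qed.

(** König's lemma. If no finite subfamily covers, one can descend through words whose cones are not
    finitely covered; the limit point lies in some [F i], which depends on finitely many letters and
    hence contains a whole cone of the branch. *)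
Lemma cantor_compact (A : set cantor) (F : (set cantor)^nat) : measurable A ->
  (forall i, measurable (F i)) -> A `<=` \bigcup_i F i ->
  exists N, A `<=` \bigcup_(i < N) F i.
Proof.
move=> [n nA] mF AF; apply: contrapT => /forallNP AN.
pose bad s := forall N, ~ (A `&` cone s `<=` \bigcup_(i < N) F i).
have bad0 : bad [::] by move=> N; rewrite cone0 setIT; exact: AN.
have badS s : bad s -> ~ bad (rcons s true) -> bad (rcons s false).
  move=> bs /existsNP[N /contrapT hN] M hM; apply: (bs (maxn N M)).
  rewrite cone_rcons setIUr => x [/hM|/hN] [i /= iN Fx]; exists i => //=.
    by rewrite (leq_trans iN)// leq_maxr.
  by rewrite (leq_trans iN)// leq_maxl.
(* The letter [true] is taken whenever it keeps the word bad; otherwise [badS] guarantees that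
   [false] does. *)
pose fix sq k := if k is k'.+1 then
  rcons (sq k') `[< bad (rcons (sq k') true) >] else [::].
pose x : cantor := fun k => `[< bad (rcons (sq k) true) >].
have sqE k : sq k = mkseq x k by elim: k => // k IH; rewrite mkseqS -IH.
have bsq k : bad (mkseq x k).
  elim: k => // k; rewrite mkseqS -sqE => bk; rewrite /x.
  by case: asboolP => // /(badS _ bk).
have coneE k y : cone (mkseq x k) y -> agree k x y.
  by rewrite /cone/= size_mkseq => /esym/mkseq_agree.
have [Ax|nAx] := pselect (A x); last first.
  apply: (bsq n 0%N) => y [Ay /coneE/agree_sym yx]; exfalso; apply: nAx.
  exact: nA Ay.
have [i _ Fx] := AF _ Ax; have [m mFi] := mF i.
apply: (bsq m i.+1) => y [_ /coneE xy]; exists i => //=; exact: mFi Fx.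
Qed.

End cantor_algebra.

Definition cantorM := g_sigma_algebraType (@measurable _ cantor).
HB.instance Definition _ := Measurable.on cantorM.

Section tree_sum.
Context {R : realType}.
Implicit Types (w : seq bool -> R) (G : cantor -> R).

(** Integral over [cone s] of the step function that samples [G] on each cone of depth [size s + n],
    at the word continued by [false]. *)
Fixpoint tree_sum w n s G : R := match n with
  | 0 => w s * G (cantor_ext s)
  | n'.+1 => tree_sum w n' (rcons s false) G + tree_sum w n' (rcons s true) G
  end.

Definition tree_weight w :=
  (forall s, 0 <= w s) /\ forall s, w s = w (rcons s false) + w (rcons s true).

Lemma tree_sumD w n s G H :
  tree_sum w n s (G \+ H) = tree_sum w n s G + tree_sum w n s H.
Proof. by elim: n s => [|n IH] s /=; [rewrite mulrDr|rewrite !IH addrACA]. Qed.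

Lemma tree_sum_ge0 w n s G : tree_weight w -> (forall x, 0 <= G x) -> 0 <= tree_sum w n s G.
Proof.
by move=> [w0 _] G0; elim: n s => [|n IH] s /=; [exact: mulr_ge0|exact: addr_ge0].
Qed.

Definition depends n G := forall x y, agree n x y -> G x = G y.

Lemma tree_sum_const w n s G : tree_weight w -> depends (size s) G ->
  tree_sum w n s G = w s * G (cantor_ext s).
Proof.
move=> [_ wD]; elim: n s => [//|n IH] s dG /=.
have dG' b : depends (size (rcons s b)) G.
  by move=> x y; rewrite size_rcons => /(agree_le (leqnSn _)); exact: dG.
rewrite !IH// (wD s) mulrDl; congr (_ * _ + _ * _); apply: dG => k ks;
  by rewrite /cantor_ext nth_rcons ks.
Qed.

Lemma tree_sum_level w n m s G : tree_weight w -> depends (size s + n)%N G ->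
  tree_sum w (n + m) s G = tree_sum w n s G.
Proof.
move=> tw; elim: n s => [|n IH] s dG.
  by rewrite add0n tree_sum_const// -(addn0 (size s)).
by rewrite addSn /= !IH// size_rcons addSnnS.
Qed.

End tree_sum.

Section tree_measure.
Context {R : realType} (w : seq bool -> R) (tw : tree_weight w).

Let level (A : set cantor) : nat := xget 0%N [set n | cylinder n A].

Let depends_indic n A : cylinder n A -> depends n (\1_A : cantor -> R).
Proof.
move=> nA x y xy; rewrite !indicE; congr (nat_of_bool _)%:R.
by apply/idP/idP; rewrite !inE; apply: nA => //; exact: agree_sym.
Qed.

Let mass (A : set cantor) : R := tree_sum w (level A) [::] (\1_A).

Let massE n A : cylinder n A -> mass A = tree_sum w n [::] (\1_A).
Proof.
move=> nA; have lA : cylinder (level A) A by apply: (@xgetPex _ 0%N [set n | cylinder n A]); exists n.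
have [ln|/ltnW nl] := leqP (level A) n.
  by rewrite -(subnKC ln) tree_sum_level//; exact: depends_indic.
by rewrite /mass -(subnKC nl) tree_sum_level//; exact: depends_indic.
Qed.

Let massU A B : measurable A -> measurable B -> A `&` B = set0 ->
  mass (A `|` B) = mass A + mass B.
Proof.
move=> [n nA] [m mB] AB; set k := maxn n m.
have kA : cylinder k A by apply: cylinder_le nA; exact: leq_maxl.
have kB : cylinder k B by apply: cylinder_le mB; exact: leq_maxr.
have kAB : cylinder k (A `|` B).
  by move=> x y xy [Ax|Bx]; [left; exact: kA Ax|right; exact: kB Bx].
rewrite (massE kA) (massE kB) (massE kAB) -tree_sumD; congr tree_sum.
apply/funext => x /=; rewrite !indicE in_setU.
have [xA|] := boolP (x \in A); have [xB|] := boolP (x \in B); rewrite ?addr0 ?add0r//.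
by move: xA xB; rewrite !inE => xA xB; have : (A `&` B) x by []; rewrite AB.
Qed.

Let mass0 : mass set0 = 0.
Proof.
have := massU measurable0 measurable0 (setI0 _); rewrite setU0.
by move/eqP; rewrite -subr_eq subrr eq_sym => /eqP.
Qed.

Definition tree_content (A : set cantor) : \bar R := (mass A)%:E.

Let mu0 : tree_content set0 = 0%E. Proof. by rewrite /tree_content mass0. Qed.

Let mu_ge0 A : (0 <= tree_content A)%E.
Proof. by rewrite lee_fin; apply: tree_sum_ge0 => // x; rewrite indicE. Qed.

Let mu_sigma_additive : semi_sigma_additive tree_content.
Proof.
move=> F mF tF mUF.
(* The union is itself a cylinder set, so compactness turns countable additivity into finite
   additivity: the terms beyond [N] contribute nothing. *)
have [N UN] := cantor_compact mUF mF (@subset_refl _ _).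
have UE n : (N <= n)%N -> \bigcup_i F i = \big[setU/set0]_(i < n) F i.
  move=> Nn; rewrite -bigcup_mkord; apply/seteqP; split.
    by apply: (subset_trans UN) => x [i /= iN Fx]; exists i => //=; exact: leq_trans iN Nn.
  by apply: bigcup_sub => i _; exact: bigcup_sup.
apply: cvg_near_cst; exists N => // n /= Nn; rewrite (UE _ Nn) big_mkord.
elim: {Nn} n => [|n IH]; first by rewrite !big_ord0.
rewrite !big_ord_recr/= IH /tree_content massU//.
- exact: bigsetU_measurable.
- move: tF => /trivIsetP tF; rewrite -bigcup_mkord -subset0 => x [[i /= ik Fi] Fn].
  by have := tF i n I I; rewrite ltn_eqF// => /(_ isT); move=> /seteqP[/(_ x) + _]; apply; split.
Qed.

HB.instance Definition _ := isMeasure.Build _ _ _ tree_content mu0 mu_ge0 mu_sigma_additive.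

(** Carathéodory extension of the content [mass], whose sigma-additivity comes from compactness. *)
Lemma tree_measure : exists m : {measure set cantorM -> \bar R},
  forall s, m (cone s) = (w s)%:E.
Proof.
exists (measure_extension tree_content) => s.
transitivity (tree_content (cone s)).
  by have := measurable_mu_extE tree_content (measurable_cone s).
rewrite /= /tree_content (massE (@cone_cylinder s)); congr (_%:E).
(* Induction on the number [n] of letters missing from [t]: only the words [t] that are prefixes of
   [s] see the cone. *)
suff h n t : (size t + n = size s)%N -> tree_sum w n t (\1_(cone s)) =
    w s * (t == take (size t) s)%:R.
  by rewrite h ?add0n// take0 eqxx mulr1.
elim: n t => [|n IH] t; rewrite ?addn0 => ts /=.
  rewrite ts take_size indicE; case: eqVneq => [->|nts].
    by rewrite mem_set//; exact: cone_ext.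
  rewrite memNset ?mulr0// /cone/= -ts => tE; have : cone t (cantor_ext t) by exact: cone_ext.
  by rewrite /cone/= ts => /esym tE'; rewrite tE' -ts tE eqxx in nts.
rewrite !IH ?size_rcons ?addSnnS// -mulrDr; congr (_ * _).
have ls : (size t < size s)%N by rewrite -ts addnS ltnS leq_addr.
rewrite (take_nth false ls) !eqseq_rcons.
by case: (t == _); case: nth => /=; rewrite ?addr0 ?add0r.
Qed.

End tree_measure.

(** * Bounded functions, finite measures and compact sets *)

Definition bounded_on {R : realType} {T : Type} (X : set T) (f : T -> R) :=
  exists M : R, forall z, X z -> `|f z| <= M.

Lemma normr_indic_le1 {R : realType} {T : Type} (A : set T) z : `|\1_A z| <= 1 :> R.
Proof. by rewrite indicE; case: (_ \in _); rewrite ?normr1 ?normr0. Qed.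

Lemma indic_disjointU {R : realType} {T : Type} (A B : set T) z : A `&` B = set0 ->
  \1_(A `|` B) z = \1_A z + \1_B z :> R.
Proof.
move=> AB; rewrite !indicE in_setU.
have [a|] := boolP (z \in A); have [b|] := boolP (z \in B); rewrite ?addr0 ?add0r//.
by move: a b; rewrite !inE => a b; exfalso; have : (A `&` B) z by []; rewrite AB.
Qed.

Section finite_measure_integral.
Context d {T : measurableType d} {R : realType}.
Implicit Types (m : {finite_measure set T -> \bar R}) (f g : T -> R).

Lemma bounded_integrable m A f M : measurable A -> measurable_fun A f ->
  (forall z, A z -> `|f z| <= M) -> m.-integrable A (EFin \o f).
Proof.
move=> mA mf fM; apply: measurable_bounded_integrable => //.
  by rewrite ltey_eq fin_num_measure.
exists M; split; first exact: num_real.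
by move=> x Mx z Az; exact: le_trans (fM z Az) (ltW Mx).
Qed.

Lemma dist_Rintegral_le m A f g e : measurable A ->
  m.-integrable A (EFin \o f) -> m.-integrable A (EFin \o g) ->
  (forall z, A z -> `|f z - g z| <= e) ->
  `|\int[m]_(z in A) f z - \int[m]_(z in A) g z| <= e * fine (m A).
Proof.
move=> mA mf mg fg; have mfg : m.-integrable A (EFin \o (fun z => f z - g z)).
  by have := integrableB mA mf mg; apply: eq_integrable.
rewrite -RintegralB// (le_trans (le_normr_Rintegral _ _))//.
rewrite -Rintegral_cst//; apply: le_Rintegral => //.
  exact: integrable_norm.
exact: finite_measure_integrable_cst.
Qed.

Lemma finite_measure_of (m : {measure set T -> \bar R}) : (m setT < +oo)%E ->
  exists m' : {finite_measure set T -> \bar R}, forall A, m' A = m A.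
Proof.
move=> moo; exists (mfrestr measurableT moo) => A.
by rewrite /= /mfrestr/= /mrestr setIT.
Qed.

End finite_measure_integral.

Section compact_functions.
Context {R : realType} {T : pseudoPMetricType R} (X : set T).
Implicit Types f : T -> R.

Lemma compact_unif_continuous f : compact X -> {within X, continuous f} ->
  forall e : R, 0 < e -> exists2 d : R, 0 < d & forall z z', X z -> X z' ->
    ball z d z' -> `|f z - f z'| < e.
Proof.
move=> cX /subspace_continuousP cf e e0.
have e20 : 0 < e / 2 by rewrite divr_gt0.
have /choice[r rP] : forall z, exists r : R, 0 < r /\ (X z -> forall z', X z' ->
    ball z r z' -> `|f z - f z'| < e / 2).
  move=> z; have [Xz|] := pselect (X z); last by exists 1.
  have /cvgrPdist_lt/(_ _ e20) := cf z Xz.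
  rewrite near_withinE => /nbhs_ballP[r /= r0 h].
  by exists r; split=> // _ z' Xz' bz; exact: h.
have cX' : cover_compact X by rewrite -compact_cover.
have r20 z : 0 < r z / 2 by rewrite divr_gt0//; have [] := rP z.
have [||D' D'X cov] := cX' T X (fun z => (ball z (r z / 2))°).
- by move=> z _; exact: open_interior.
- by move=> z Xz; exists z => //; exact: nbhsx_ballx.
exists (\big[Order.min/1]_(z <- enum_fset D') (r z / 2)).
  by elim/big_ind : _ => // x y x0 y0; rewrite lt_min x0.
move=> z z' Xz Xz' zz'.
have [c cD' /interior_subset cz] := cov z Xz.
have Xc : X c by have := D'X c cD'; rewrite inE.
have ls : \big[Order.min/1]_(z <- enum_fset D') (r z / 2) <= r c / 2.
  by apply: ge_bigmin_seq => //.
have cz' : ball c (r c) z'.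
  by rewrite (splitr (r c)); apply: ball_triangle cz _; exact: le_ball zz'.
have czr : ball c (r c) z.
  by apply: le_ball cz; rewrite ler_pdivrMr// ler_peMr ?ler1n// ltW//; have [] := rP c.
have h1 := (rP c).2 Xc z' Xz' cz'; have h2 := (rP c).2 Xc z Xz czr.
rewrite (splitr e) (_ : f z - f z' = (f c - f z') - (f c - f z)); last by ring.
by rewrite (le_lt_trans (ler_normB _ _))// ltrD.
Qed.

Lemma compact_bounded_fun f : compact X -> {within X, continuous f} ->
  bounded_on X f.
Proof.
move=> cX cf; have /compact_bounded[M [_ h]] := continuous_compact cf cX.
by exists (M + 1) => z Xz; apply: h; [rewrite ltrDl|exists z].
Qed.

End compact_functions.

(** * Riesz representation on a compact metric space *)

Section coding.
Context {R : realType} {T : pseudoPMetricType R} (X : set T) (x0 : T).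
Hypothesis Xx0 : X x0.

Definition separating (code : T -> cantor) := forall e : R, 0 < e ->
  exists n, forall z z', X z -> X z' -> agree n (code z) (code z') -> ball z e z'.

(** For each [N] finitely many balls of radius [1/(N+1)] cover [X]; the bit of index [pickle (N, j)]
    records membership in the [j]-th of them. Two points with equal bits up to the last index of
    generation [N] share a ball. The bits are open sets, which later makes the code measurable. *)
Lemma compact_code : compact X -> exists code : T -> cantor,
  (forall k, open [set z | code z k]) /\ separating code.
Proof.
move=> cX.
have /choice[t tX] : forall N : nat, exists t : seq T, forall z, X z ->
    exists2 c, c \in t & (ball c (N.+1%:R^-1 : R))° z.
  move=> N; have {}cX : cover_compact X by rewrite -compact_cover.
  have [||D' _ cov] := cX T X (fun c => (ball c (N.+1%:R^-1 : R))°).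
  - by move=> c _; exact: open_interior.
  - by move=> z Xz; exists z => //; apply: nbhsx_ballx; rewrite invr_gt0.
  - by exists (enum_fset D') => z /cov[c cD cz]; exists c.
pose U (k : nat) : set T := if (choice.unpickle k : option (nat * nat)) is Some (N, j) then
  (if (j < size (t N))%N then (ball (nth x0 (t N) j) (N.+1%:R^-1 : R))° else set0) else set0.
exists (fun z k => `[< U k z >]); split=> [k|e e0].
  rewrite (_ : [set _ | _] = U k).
    rewrite /U; case: (choice.unpickle k : option (nat * nat)) => [[N j]|]; last exact: open0.
    by case: ifP => _; [exact: open_interior|exact: open0].
  by apply/seteqP; split=> z /= /asboolP.
have e20 : 0 < e / 2 by rewrite divr_gt0.
have [N _ /(_ _ (leqnn _)) /= Ne] := near_infty_natSinv_lt (PosNum e20).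
pose n := (\max_(j < size (t N)) (choice.pickle (N, nat_of_ord j)).+1)%N.
exists n => z z' Xz Xz' zz'.
have [c ct cz] := tX N z Xz.
have jt : (index c (t N) < size (t N))%N by rewrite index_mem.
pose k := choice.pickle (N, index c (t N)).
have kn : (k < n)%N by exact: (leq_bigmax (Ordinal jt)).
have UE : U k = (ball c (N.+1%:R^-1 : R))° by rewrite /U choice.pickleK jt nth_index.
have := zz' k kn; rewrite UE (asboolT cz) => /esym/asboolP cz'.
have /ball_sym czN := interior_subset cz; have czN' := interior_subset cz'.
by apply: le_ball (ball_triangle czN czN'); rewrite (splitr e); apply: lerD; exact: ltW.
Qed.

(** [zn n b] is a point of [X] whose code agrees with [b] on the longest prefix, of length at most
    [n], that some point realises. By separation these points are uniformly Cauchy in [n]; [pi b] is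
    a cluster point of them, which compactness provides inside [X]. *)
Lemma compact_decode (code : T -> cantor) : compact X -> separating code ->
  exists (zn : nat -> cantor -> T) (pi : cantor -> T),
  [/\ forall b, X (pi b) /\ forall n, X (zn n b),
      forall n b b', agree n b b' -> zn n b = zn n b',
      forall e : R, 0 < e -> exists N, forall n, (N <= n)%N -> forall b, ball (pi b) e (zn n b) &
      forall e : R, 0 < e -> exists N, forall n, (N <= n)%N ->
        forall z, X z -> ball z e (zn n (code z))].
Proof.
move=> cX sep.
pose cell n b : set T := [set z | X z /\ agree n b (code z)].
(* When the cell of level [n] is empty the previous representative is kept, so that words outside
   the range of [code] are decoded as well. *)
pose zn := fix zn n b := if n is n'.+1 then
  (if pselect (cell n b !=set0) then xget x0 (cell n b) else zn n' b) else x0.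
have znX n b : X (zn n b).
  elim: n => //= n IH; case: pselect => // c0.
  by have [] := @xgetPex _ x0 _ c0.
have zna n b : cell n b !=set0 -> agree n b (code (zn n b)).
  case: n => [//|n] c0 /=; case: pselect => // c0'.
  by have [] := @xgetPex _ x0 _ c0'.
have celle m n b : (m <= n)%N -> cell n b !=set0 -> cell m b !=set0.
  by move=> mn [z [Xz]] /(agree_le mn); exists z.
have znm n m b : (n <= m)%N -> (agree n (code (zn n b)) (code (zn m b))) \/ zn m b = zn n b.
  move=> nm; have [c0|c0] := pselect (cell n b !=set0).
    left; have h := agree_sym (zna _ _ c0); apply: (agree_trans h).
    rewrite -(subnKC nm); elim: (m - n)%N => [|k IH]; first by rewrite addn0; exact: agree_sym.
    rewrite addnS /=; case: pselect => // c1.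
    have [_] := @xgetPex _ x0 _ c1; apply: agree_le; exact: leq_trans (leq_addr _ _) (leqnSn _).
  right; rewrite -(subnKC nm); elim: (m - n)%N => [|k IH]; first by rewrite addn0.
  rewrite addnS /=; case: pselect => // c1; exfalso; apply: c0.
  by apply: celle c1; exact: leq_trans (leq_addr _ _) (leqnSn _).
have unif e : 0 < e -> exists N, forall m, (N <= m)%N -> forall b, ball (zn N b) e (zn m b).
  move=> e0; have [N hN] := sep e e0; exists N => m Nm b.
  by have [h|->] := znm _ _ b Nm; [exact: hN|exact: ballxx].
have /choice[pi piP] : forall b, exists y, X y /\ forall e : R, 0 < e -> forall N,
    exists2 m, (N <= m)%N & ball y e (zn m b).
  move=> b; have [|y [Xy cy]] := cX ((fun m => zn m b) @ \oo) _.
    by exists 0%N => // m _; exact: znX.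
  exists y; split=> // e e0 N.
  have [||z [[m Nm <-] bz]] := cy [set zn m b | m in [set m | (N <= m)%N]] (ball y e).
  - by exists N => // m Nm; exists m.
  - exact: nbhsx_ballx.
  - by exists m.
exists zn, pi; split.
- by move=> b; split=> //; have [] := piP b.
- elim => //= n IH b b' bb'.
  have -> : cell n.+1 b' = cell n.+1 b.
    apply/seteqP; split=> z [Xz zz]; split=> //; first exact: agree_trans zz.
    exact: agree_trans (agree_sym bb') zz.
  by rewrite (IH b b')//; exact: agree_le bb'.
- move=> e e0; have e30 : 0 < e / 3 by rewrite divr_gt0.
  have [N hN] := unif _ e30; exists N => n Nn b.
  have [m Nm hm] := (piP b).2 _ e30 N.
  rewrite (_ : e = e / 3 + e / 3 + e / 3); last by field.
  apply: ball_triangle (hN n Nn b); apply: ball_triangle hm _.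
  by apply: ball_sym; exact: hN.
- move=> e e0; have [N hN] := sep e e0; exists N => n Nn z Xz.
  apply: hN => //; have c0 : cell n (code z) !=set0 by exists z.
  exact: agree_le Nn (zna _ _ c0).
Qed.

End coding.

Section finitely_additive.
Context {R : realType} {T : Type}.
Implicit Types nu : set T -> R.

Definition finitely_additive nu := forall A B, A `&` B = set0 -> nu (A `|` B) = nu A + nu B.

(** Positive part of the Jordan decomposition. Since [nu] is defined on every subset, the supremum
    runs over all subsets. *)
Definition upper_variation nu A := sup [set nu B | B in [set B | B `<=` A]].

Section variation.
Variables (nu : set T -> R) (C : R).
Hypotheses (nuD : finitely_additive nu) (nuC : forall A, nu A <= C).

Let nu0 : nu set0 = 0.
Proof. by have := nuD (setI0 set0); rewrite setU0 => h; lra. Qed.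

Let vub A : has_ubound [set nu B | B in [set B | B `<=` A]].
Proof. by exists C => _ [B _ <-]. Qed.

Lemma le_upper_variation A B : B `<=` A -> nu B <= upper_variation nu A.
Proof. by move=> BA; apply: ub_le_sup => //; exists B. Qed.

Lemma upper_variation_ge0 A : 0 <= upper_variation nu A.
Proof. by rewrite -nu0; exact: le_upper_variation. Qed.

Lemma upper_variation_additive : finitely_additive (upper_variation nu).
Proof.
move=> A A' AA'; apply/le_anti/andP; split.
  apply: ge_sup; first by exists (nu set0), set0.
  move=> _ [B BA <-]; rewrite -(setUIDK B A) nuD; last first.
    by rewrite -subset0 => x [[_ Ax] [_ /(_ Ax)]].
  apply: lerD; apply: le_upper_variation; first by move=> x [].
  by move=> x [/BA[]].
rewrite -lerBrDl; apply: ge_sup; first by exists (nu set0), set0.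
move=> _ [B' BA' <-]; rewrite lerBrDl -lerBrDr; apply: ge_sup; first by exists (nu set0), set0.
move=> _ [B BA <-]; rewrite lerBrDr -nuD; last first.
  by rewrite -subset0 -AA' => x [/BA ? /BA' ?].
by apply: le_upper_variation; exact: setUSS.
Qed.

End variation.

End finitely_additive.

Section cantor_integral.
Context {R : realType}.
Implicit Types (G : cantor -> R) (m : {finite_measure set cantorM -> \bar R}).

(** The induction shared by two computations: [h] is the integral over cones for a measure, and the
    value of the linear form on localised step functions for Riesz. *)
Lemma tree_sum_unfold (w h : seq bool -> R) n s G :
  (forall t, h t = h (rcons t false) + h (rcons t true)) ->
  (forall t, depends (size t) G -> h t = w t * G (cantor_ext t)) ->
  depends (size s + n) G -> h s = tree_sum w n s G.
Proof.
move=> hD hw; elim: n s => [|n IH] s dG /=; first by apply: hw; rewrite -(addn0 (size s)).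
by rewrite hD; congr (_ + _); apply: IH; rewrite size_rcons addSnnS.
Qed.

Lemma measurable_cylinder n A : cylinder n A -> measurable (A : set cantorM).
Proof. by move=> nA; apply: sub_sigma_algebra; exists n. Qed.

Lemma measurable_cantor_cone s : measurable (cone s : set cantorM).
Proof. exact: measurable_cylinder (@cone_cylinder s). Qed.

Lemma depends_measurable n G : depends n G -> measurable_fun setT (G : cantorM -> R).
Proof.
move=> dG _ U _; rewrite setTI; apply: (@measurable_cylinder n) => x y xy /=.
by rewrite (dG _ _ xy).
Qed.

Lemma depends_bounded n G : depends n G -> exists M : R, forall x, `|G x| <= M.
Proof.
move=> dG; pose f (t : n.-tuple bool) := `|G (cantor_ext t)|.
exists (\sum_(t : n.-tuple bool) f t) => x.
have xn : size (mkseq x n) == n by rewrite size_mkseq.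
rewrite (bigD1 (Tuple xn))//= /f /= (dG _ x) ?lerDl ?sumr_ge0//.
by move=> k kn; rewrite /cantor_ext nth_mkseq.
Qed.

Lemma Rintegral_tree m (w : seq bool -> R) n G : (forall s, m (cone s) = (w s)%:E) ->
  depends n G -> \int[m]_(x in setT) G x = tree_sum w n [::] G.
Proof.
move=> mw dG; have [M GM] := depends_bounded dG.
have iG A : measurable A -> m.-integrable A (EFin \o G).
  move=> mA; apply: (@bounded_integrable _ _ _ _ _ _ M) => //.
  by apply: measurable_funTS; exact: (depends_measurable dG).
rewrite -cone0; apply: (@tree_sum_unfold w (fun s => \int[m]_(x in cone s) G x)) => //.
- move=> t; rewrite [in LHS]cone_rcons Rintegral_setU//; try exact: measurable_cantor_cone.
    by apply: iG; apply: measurableU; exact: measurable_cantor_cone.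
  by apply/eqP/cone_rcons_disj.
- move=> t dt; transitivity (\int[m]_(x in cone t) (cst (G (cantor_ext t)) x)).
    apply: eq_Rintegral => x; rewrite inE => cx; apply: dt; apply/mkseq_agree.
    by rewrite mkseq_nth.
  rewrite Rintegral_cst; last exact: measurable_cantor_cone.
  by rewrite mulrC -[w t]/(fine (w t)%:E) -(mw t).
Qed.

End cantor_integral.

Section riesz.
Context {R : realType} {T : pseudoPMetricType R} (X : set T) (x0 : T).
Hypotheses (Xx0 : X x0) (cX : compact X).
Implicit Types f g : T -> R.

Definition decoding (code : T -> cantor) (zn : nat -> cantor -> T) (pi : cantor -> T) :=
  [/\ forall b, X (pi b) /\ forall n, X (zn n b),
      forall n b b', agree n b b' -> zn n b = zn n b',
      forall e : R, 0 < e -> exists N, forall n, (N <= n)%N -> forall b, ball (pi b) e (zn n b) &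
      forall e : R, 0 < e -> exists N, forall n, (N <= n)%N ->
        forall z, X z -> ball z e (zn n (code z))].

Context (code : T -> cantor) (zn : nat -> cantor -> T) (pi : cantor -> T).
Hypothesis dec : decoding code zn pi.

(** One depth [n] serves both sides of the Riesz formula: the step function [f \o zn n] is close to
    [f \o pi] on the Cantor space, and after composition with [code] it is close to [f] on [X]. *)
Lemma decode_approx f : {within X, continuous f} -> forall e : R, 0 < e ->
  exists n, (forall b, `|f (pi b) - f (zn n b)| <= e) /\
    (forall z, X z -> `|f z - f (zn n (code z))| <= e).
Proof.
move=> cf e e0; have [pX znd pzn zcode] := dec.
have [d d0 fd] := compact_unif_continuous cX cf e0.
have [N hN] := pzn _ d0; have [M hM] := zcode _ d0.
exists (maxn N M); split=> [b|z Xz]; apply/ltW/fd => //; try by have [] := pX b.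
- by apply: hN; rewrite leq_maxl.
- by have [] := pX (code z).
- by apply: hM => //; rewrite leq_maxr.
Qed.

Lemma measurable_decode f : {within X, continuous f} ->
  measurable_fun setT (f \o pi : cantorM -> R).
Proof.
move=> cf; apply/measurable_EFinP.
have /choice[n nP] : forall k : nat, exists n, forall b, `|f (pi b) - f (zn n b)| <= k.+1%:R^-1.
  by move=> k; have [|n [h _]] := decode_approx cf (_ : 0 < k.+1%:R^-1); [rewrite invr_gt0|exists n].
apply: (emeasurable_fun_cvg (fun k (b : cantorM) => (f (zn (n k) b))%:E)).
  move=> k; apply/measurable_EFinP; apply: (@depends_measurable _ (n k)) => x y xy.
  by have [_ /(_ _ _ _ xy) ->] := dec.
move=> b _; apply: cvg_EFin; first exact: nearW.
apply/cvgrPdist_le => e e0; near=> k => /=; apply: le_trans (nP k b) _.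
by apply: ltW; near: k; exact: (near_infty_natSinv_lt (PosNum e0)).
Unshelve. all: by end_near. Qed.

Lemma decode_integrable f (m : {finite_measure set cantorM -> \bar R}) :
  {within X, continuous f} -> m.-integrable setT (EFin \o (f \o pi)).
Proof.
move=> cf; have [M fM] := compact_bounded_fun cX cf.
apply: (@bounded_integrable _ _ _ _ _ _ M) => //; first exact: measurable_decode.
by move=> b _; apply: fM; have [/(_ b)[]] := dec.
Qed.

(** On functions of finitely many letters of the code, the form and the difference of integrals are
    the same finite sum. A continuous [f] is uniformly close to such a function, and both sides are
    Lipschitz for the sup norm. The form must accept discontinuous arguments, because step functions
    of the code are discontinuous in general. *)
Lemma riesz_signed (l : (T -> R) -> R) (C : R) (w1 w2 : seq bool -> R)
    (m1 m2 : {finite_measure set cantorM -> \bar R}) f :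
  (forall a g h, bounded_on X g -> bounded_on X h -> l (fun z => a * g z + h z) = a * l g + l h) ->
  (forall g (M : R), (forall z, X z -> `|g z| <= M) -> `|l g| <= C * M) ->
  (forall s, m1 (cone s) = (w1 s)%:E) -> (forall s, m2 (cone s) = (w2 s)%:E) ->
  (forall s, l (\1_(code @^-1` cone s)) = w1 s - w2 s) ->
  {within X, continuous f} ->
  l f = \int[m1]_b f (pi b) - \int[m2]_b f (pi b).
Proof.
move=> llin lC mw1 mw2 lw cf.
have C0 : 0 <= C.
  have : `|l (fun=> 0)| <= C * 1 by apply: lC => z _; rewrite normr0.
  by rewrite mulr1; exact: le_trans.
have lE n G : depends n G -> l (G \o code) =
    \int[m1]_b G b - \int[m2]_b G b.
  move=> dG; rewrite (Rintegral_tree mw1 dG) (Rintegral_tree mw2 dG).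
  have [M GM] := depends_bounded dG.
  pose h s := l (fun z => G (code z) * \1_(code @^-1` cone s) z).
  have bG s : bounded_on X (fun z => G (code z) * \1_(code @^-1` cone s) z).
    exists M => z _; rewrite normrM (le_trans _ (GM (code z)))// ler_piMr//.
    exact: normr_indic_le1.
  have -> : l (G \o code) = h [::].
    by congr l; apply/funext => z /=; rewrite cone0 preimage_setT indicT mulr1.
  rewrite (@tree_sum_unfold _ (fun s => w1 s - w2 s) h n [::] G)//.
  - elim: n [::] {dG} => [|n IH] s /=; first by rewrite mulrBl.
    by rewrite !IH; ring.
  - move=> t; rewrite /h -[RHS](congr1 (+%R^~ _) (mul1r _)) -llin//; congr l.
    apply/funext => z; rewrite mul1r -mulrDr; congr (_ * _).
    rewrite [in LHS]cone_rcons preimage_setU indic_disjointU//.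
    by rewrite -preimage_setI cone_rcons_disj preimage_set0.
  - move=> t dt; rewrite /h -lw.
    have b0 : bounded_on X (fun=> 0 : R) by exists 0 => z _; rewrite normr0.
    have b1 : bounded_on X (\1_(code @^-1` cone t) : T -> R).
      by exists 1 => z _; exact: normr_indic_le1.
    have l0 : l (fun=> 0) = 0.
      have := llin (-1) _ _ b0 b0; rewrite (_ : (fun=> _) = fun=> 0); last by apply/funext => z; rewrite mulr0 addr0.
      by move=> h0; lra.
    have := llin (G (cantor_ext t)) _ _ b1 b0; rewrite l0 addr0 mulrC => <-.
    congr l; apply/funext => z; rewrite addr0 indicE.
    have [|] := boolP (z \in _); last by rewrite !mulr0.
    rewrite inE !mulr1 => cz; apply: dt; apply/mkseq_agree; rewrite mkseq_nth; exact: cz.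
apply/eqP; rewrite -subr_eq0 -normr_le0; apply/ler_addgt0Pl => e e0; rewrite addr0.
(* The three approximation errors have Lipschitz constants [C], [m1 setT] and [m2 setT]; the extra 1
   keeps the divisor positive. *)
pose K := C + fine (m1 setT) + fine (m2 setT) + 1.
have K0 : 0 < K by rewrite ltr_wpDl// !addr_ge0 ?fine_ge0.
have [n [hpi hcode]] := decode_approx cf (divr_gt0 e0 K0).
have dG : depends n (fun b => f (zn n b)).
  by move=> x y xy; have [_ /(_ _ _ _ xy) ->] := dec.
have iG (m : {finite_measure set cantorM -> \bar R}) :
    m.-integrable setT (EFin \o (fun b : cantorM => f (zn n b))).
  have [M fM] := depends_bounded dG.
  apply: (@bounded_integrable _ _ _ _ _ _ M) => //; exact: (depends_measurable dG).
have h1 := dist_Rintegral_le measurableT (decode_integrable m1 cf) (iG m1) (fun b _ => hpi b).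
have h2 := dist_Rintegral_le measurableT (decode_integrable m2 cf) (iG m2) (fun b _ => hpi b).
have h3 : `|l f - l (fun z => f (zn n (code z)))| <= C * (e / K).
  have bf : bounded_on X f by exact: compact_bounded_fun.
  have bfn : bounded_on X (fun z => f (zn n (code z))).
    by have [M fM] := depends_bounded dG; exists M => z _; exact: fM.
  have := llin (-1) _ _ bfn bf; rewrite mulN1r addrC => <-.
  by apply: lC => z Xz; rewrite mulN1r addrC; exact: hcode.
have := lE n _ dG; rewrite /comp => E.
set a1 := \int[m1]_b f (pi b) in h1 *; set a2 := \int[m2]_b f (pi b) in h2 *.
rewrite (_ : l f - _ = (l f - l (fun z => f (zn n (code z))))
  - (a1 - \int[m1]_b f (zn n b)) + (a2 - \int[m2]_b f (zn n b))); last by rewrite E; ring.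
rewrite (le_trans (ler_normD _ _))//.
apply: (@le_trans _ _ (C * (e / K) + e / K * fine (m1 setT) + e / K * fine (m2 setT))).
  by apply: lerD => //; rewrite (le_trans (ler_normB _ _))// lerD.
rewrite [leLHS](_ : _ = e * ((K - 1) / K)); last by rewrite /K; field; rewrite -/K gt_eqF.
by rewrite ler_piMr ?(ltW e0)// ler_pdivrMr// mul1r gerBl.
Qed.

End riesz.

(** * Charges, image measures and measures built from kernels *)

Section charge_integrals.
Context d {T : measurableType d} {R : realType}.
Implicit Types (nu : {charge set T -> \bar R}) (m : {finite_measure set T -> \bar R}).

Lemma charge_of_difference m1 m2 : exists nu, forall A, nu A = (m1 A - m2 A)%E.
Proof.
by exists (cadd (charge_of_finite_measure m1) (copp (charge_of_finite_measure m2))).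
Qed.

Lemma charge_integral_jordan nu : exists m1 m2,
  (forall B, measurable B -> nu B = (m1 B - m2 B)%E) /\
  forall A f, charge_integral nu A f = \int[m1]_(z in A) f z - \int[m2]_(z in A) f z.
Proof.
pose nuPN := projT2 (cid (projT2 (cid (Hahn_decomposition nu)))).
exists (jordan_pos nuPN), (jordan_neg nuPN); split=> // B mB.
have := jordan_decomp nuPN mB; rewrite /cadd/= cscaleN1 => -> //.
Qed.

(** [charge_integral] is tied to a chosen Hahn decomposition [j1 - j2]. Any other decomposition
    gives the same integral because [j1 + m2] and [m1 + j2] are equal positive measures. *)
Lemma charge_integral_difference nu m1 m2 (A : set T) (f : T -> R) (M : R) : measurable A -> measurable_fun A f ->
  (forall z, A z -> `|f z| <= M) ->
  (forall B, measurable B -> nu B = (m1 B - m2 B)%E) ->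
  charge_integral nu A f = \int[m1]_(z in A) f z - \int[m2]_(z in A) f z.
Proof.
move=> mA mf fM nuE; have [j1 [j2 [nujE ->]]] := charge_integral_jordan nu.
have I m : m.-integrable A (EFin \o f) by exact: bounded_integrable fM.
have F m : (\int[m]_(z in A) (f z)%:E)%E \is a fin_num by exact: (integrable_fin_num mA (I m)).
have : (\int[measure_add j1 m2]_(z in A) (f z)%:E = \int[measure_add m1 j2]_(z in A) (f z)%:E)%E.
  apply: eq_measure_integral => B mB _.
  transitivity (j1 B + m2 B)%E; first exact: measure_addE.
  transitivity (m1 B + j2 B)%E; last by rewrite [RHS]measure_addE.
  have := nujE B mB; rewrite nuE//.
  rewrite -(fineK (fin_num_measure m1 B mB)) -(fineK (fin_num_measure m2 B mB)).
  rewrite -(fineK (fin_num_measure j1 B mB)) -(fineK (fin_num_measure j2 B mB)).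
  by move=> [h]; congr (_%:E); lra.
rewrite (integral_measure_add mA (I j1) (I m2)) (integral_measure_add mA (I m1) (I j2)).
move=> /(congr1 fine); rewrite (fineD (F j1) (F m2)) (fineD (F m1) (F j2)) => h.
by rewrite /Rintegral; lra.
Qed.

End charge_integrals.

Section image_measure.
Context d1 d2 {T1 : measurableType d1} {T2 : measurableType d2} {R : realType}.

Definition image_measure (m : {measure set T1 -> \bar R}) (f : T1 -> T2)
    (mf : measurable_fun setT f) : {measure set T2 -> \bar R} :=
  measure_function_pushforward__canonical__measure_function_Measure m mf.

Lemma image_measureE m f (mf : measurable_fun setT f) A :
  image_measure m mf A = m (f @^-1` A).
Proof. by []. Qed.

Lemma image_finite_measure (m : {finite_measure set T1 -> \bar R}) (f : T1 -> T2) :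
  measurable_fun setT f -> exists m' : {finite_measure set T2 -> \bar R},
  (forall A, m' A = m (f @^-1` A)) /\
  forall A g, measurable A -> measurable_fun A g -> bounded_on A g ->
    \int[m']_(y in A) g y = \int[m]_(x in f @^-1` A) g (f x).
Proof.
move=> mf; have [|m' m'E] := @finite_measure_of _ _ _ (image_measure m mf).
  by rewrite -[X in (X < _)%E]/(m (f @^-1` setT)) preimage_setT ltey_eq fin_num_measure.
exists m'; split=> // A g mA mg [M gM].
rewrite Rintegral_mkcond [RHS]Rintegral_mkcond.
have mgA : measurable_fun setT (g \_ A) by rewrite -(measurable_restrictT _ mA).
rewrite /Rintegral (@eq_measure_integral _ _ _ _ (pushforward m f) m')//; last first.
  by move=> B mB _; rewrite /= m'E.
have gAM z : `|(g \_ A) z| <= `|M|.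
  rewrite patchE; case: ifPn; last by rewrite normr0.
  by rewrite inE => /gM /le_trans; apply; exact: ler_norm.
have mgf : measurable_fun setT ((g \_ A) \o f) by exact: measurableT_comp.
have I : m.-integrable setT (EFin \o ((g \_ A) \o f)).
  by apply: (@bounded_integrable _ _ _ m _ _ `|M|) => // x _; exact: gAM.
rewrite (integral_pushforward mf (f := EFin \o (g \_ A)))//; last exact/measurable_EFinP.
Qed.

End image_measure.

Section total_measure.
Context d1 d2 {X : measurableType d1} {Y : measurableType d2} {R : realType}.
Variables (lam : {finite_measure set X -> \bar R}) (P : X -> probability Y R).
Hypothesis mP : forall B, measurable B -> measurable_fun setT (P ^~ B).

(** The measurability proof is an argument so that the kernel instances can be attached to the
    term. *)
Definition family_kernel (_ : forall B, measurable B -> measurable_fun setT (P ^~ B))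
  : X -> {measure set Y -> \bar R} := P.

HB.instance Definition _ := isKernel.Build _ _ _ _ _ (family_kernel mP) mP.

Let family_kernel_prob x : family_kernel mP x setT = 1%E.
Proof. exact: (probability_setT (P x)). Qed.

HB.instance Definition _ := Kernel_isProbability.Build _ _ _ _ _ (family_kernel mP)
  family_kernel_prob.

(** Law of [(x, y)] with [y] drawn from [P x]. The argument is a pair because composition of kernels
    hands over the starting point together with the intermediate point [x = z.2]. *)
Definition graph_kernel (_ : forall B, measurable B -> measurable_fun setT (P ^~ B))
    (z : X * X) : {measure set (X * Y)%type -> \bar R} :=
  image_measure (P z.2) (pair1_measurable z.2).

Let graph_kernel_measurable U : measurable U -> measurable_fun setT (graph_kernel mP ^~ U).
Proof.
move=> mU; rewrite (_ : graph_kernel mP ^~ U =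
    (fun x => family_kernel mP x (xsection U x)) \o snd); last first.
  apply/funext => -[u x]; rewrite -[LHS]/(P x (pair x @^-1` U)).
  by congr (P x _); apply/seteqP; split=> y; rewrite /xsection/= inE.
have h := @measurable_fun_xsection_finite_kernel _ _ _ _ _ (family_kernel mP) U (mem_set mU).
exact: (measurableT_comp h measurable_snd).
Qed.

HB.instance Definition _ := isKernel.Build _ _ _ _ _ (graph_kernel mP)
  graph_kernel_measurable.

Let graph_kernel_prob z : graph_kernel mP z setT = 1%E.
Proof. exact: (probability_setT (P z.2)). Qed.

HB.instance Definition _ := Kernel_isProbability.Build _ _ _ _ _ (graph_kernel mP)
  graph_kernel_prob.

Definition constant_kernel (m : {finite_measure set X -> \bar R}) (_ : X)
  : {measure set X -> \bar R} := m.

Let constant_kernel_measurable U : measurable U ->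
  measurable_fun setT (constant_kernel lam ^~ U).
Proof. by move=> mU; exact: measurable_cst. Qed.

HB.instance Definition _ := isKernel.Build _ _ _ _ _ (constant_kernel lam)
  constant_kernel_measurable.

Let constant_kernel_uub : measure_fam_uub (constant_kernel lam).
Proof.
exists (fine (lam setT) + 1) => x.
by rewrite /constant_kernel EFinD fineK ?fin_num_measure// lteDl ?fin_num_measure.
Qed.

HB.instance Definition _ := Kernel_isFinite.Build _ _ _ _ _ (constant_kernel lam)
  constant_kernel_uub.

(** The composition of the constant kernel [lam] with the graph kernel: a joint law built from a
    marginal and conditional laws, with its Fubini formula for bounded functions. *)
Lemma total_measure : exists M : {finite_measure set (X * Y)%type -> \bar R},
  (forall A, measurable A -> M A = (\int[lam]_x P x (xsection A x))%E) /\
  forall (f : X * Y -> R) (C : R), measurable_fun setT f -> (forall z, `|f z| <= C) ->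
    \int[M]_z f z = \int[lam]_x \int[P x]_y f (x, y).
Proof.
pose M0 : {measure set (X * Y)%type -> \bar R} :=
  mkcomp (constant_kernel lam) (graph_kernel mP) point.
have M0E A : measurable A -> M0 A = (\int[lam]_x P x (xsection A x))%E.
  move=> mA; rewrite /M0 /mkcomp/= /kcomp; apply: eq_integral => x _.
  rewrite -[LHS]/(P x (pair x @^-1` A)); congr (P x _).
  by apply/seteqP; split=> y; rewrite /xsection/= inE.
have M0T : M0 setT = lam setT.
  rewrite M0E// (eq_integral (cst 1%E)) ?integral_cst ?mul1e// => x _.
  rewrite (_ : xsection _ _ = setT) ?probability_setT//.
  by apply/seteqP; split=> y _ //; rewrite /xsection/= inE.
have [|M ME] := finite_measure_of (_ : (M0 setT < +oo)%E).
  by rewrite M0T ltey_eq fin_num_measure.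
exists M; split=> [A mA|f C mf fC]; first by rewrite ME M0E.
(* Integration against a composed kernel is available for nonnegative functions; [f] is shifted by
   its bound and the constant is removed at the end. *)
have C0 z : 0 <= f z + C by have := fC z; rewrite ler_norml => /andP[]; rewrite -subr_ge0 opprK.
have iM : M.-integrable setT (EFin \o f) by exact: bounded_integrable (fun z _ => fC z).
have mfx x : measurable_fun setT (fun y => f (x, y)) by exact: measurableT_comp.
have iP x : (P x).-integrable setT (EFin \o (fun y => f (x, y))).
  by apply: bounded_integrable => // y _; exact: fC.
pose inner x := \int[P x]_y f (x, y).
have innerE x : (\int[P x]_y (f (x, y) + C)%:E = (inner x + C)%:E)%E.
  under eq_integral do rewrite EFinD.
  rewrite integralD//; [|exact: iP|exact: finite_measure_integrable_cst].
  rewrite integral_cst// [X in (_ + _ * X)%E](probability_setT (P x)) mule1 EFinD; congr (_ + _)%E.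
  by rewrite /inner /Rintegral fineK//; exact: (integrable_fin_num measurableT (iP x)).
have innerC x : `|inner x| <= C.
  apply: (le_trans (le_normr_Rintegral measurableT (iP x))).
  apply: (@le_trans _ _ (\int[P x]_(y in setT) cst C y)).
    apply: le_Rintegral => //; first exact: integrable_norm (iP x).
    exact: finite_measure_integrable_cst.
  by rewrite Rintegral_cst// [X in fine X](probability_setT (P x)) mulr1.
have minner : measurable_fun setT inner.
  rewrite (_ : inner = (fun x => (inner x + C) - C)); last by apply/funext => x; rewrite addrK.
  apply: measurable_funB => //; apply/measurable_EFinP.
  rewrite (_ : _ \o _ = (fun x => (\int[family_kernel mP x]_y (f (x, y) + C)%:E)%E)); last first.
    by apply/funext => x; rewrite /family_kernel innerE.
  apply: (measurable_fun_integral_finite_kernel (fun z => (f z + C)%:E)) => //.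
  exact/measurable_EFinP/measurable_funD.
have il : lam.-integrable setT (EFin \o inner) by exact: bounded_integrable (fun z _ => innerC z).
have : (\int[M]_z (f z + C)%:E = \int[lam]_x (inner x + C)%:E)%E.
  transitivity (\int[M0]_z (f z + C)%:E)%E.
    by apply: eq_measure_integral => A _ _; exact: ME.
  rewrite integral_kcomp//; last exact/measurable_EFinP/measurable_funD.
  apply: eq_integral => x _; rewrite -innerE /graph_kernel/=.
  rewrite ge0_integral_pushforward//.
    exact/measurable_EFinP/measurable_funD.
  by move=> z; rewrite lee_fin.
have ED d (Z : measurableType d) (m : {finite_measure set Z -> \bar R}) (g : Z -> R) :
    m.-integrable setT (EFin \o g) ->
    (\int[m]_z (g z + C)%:E = (\int[m]_z g z)%:E + C%:E * m setT)%E.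
  move=> ig; under eq_integral do rewrite EFinD.
  rewrite integralD//; last exact: finite_measure_integrable_cst.
  by rewrite integral_cst// /Rintegral fineK//; exact: (integrable_fin_num measurableT ig).
move=> h; have := etrans (esym (ED _ _ M f iM)) (etrans h (ED _ _ lam inner il)); rewrite ME M0T => /eqP.
rewrite -(fineK (fin_num_measure lam _ measurableT)) -EFinM -!EFinD.
by rewrite eqe => /eqP/addIr.
Qed.

End total_measure.

(** * Maps into the Wasserstein space as kernels *)

Lemma probability_of d {T : measurableType d} {R : realType}
    (m : {measure set T -> \bar R}) : m setT = 1%E ->
  exists P : probability T R, forall A, P A = m A.
Proof.
move=> m1; exists (mnormalize m (dirac point)) => A /=.
by rewrite /mnormalize m1 /= onee_eq0/= invr1 mule1.
Qed.

(** The sets whose mass depends measurably on the parameter form a Dynkin class. *)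
Lemma measurable_family_generated d1 d2 {X : measurableType d1} {Y : measurableType d2}
    {R : realType} (Omega : set X) (P : X -> probability Y R) (G : set (set Y)) :
  measurable Omega -> @measurable _ Y = <<s G >> -> setI_closed G ->
  (forall A, G A -> measurable_fun Omega (fun x => P x A)) ->
  forall A, measurable A -> measurable_fun Omega (fun x => P x A).
Proof.
move=> mO YG GI PG A mA.
apply: (@dynkin_induction _ Y G (fun A => measurable_fun Omega (fun x => P x A))) => //.
- by under eq_fun do rewrite probability_setT; exact: measurable_cst.
- move=> S mS PS; under eq_fun do rewrite probability_setC//.
  exact: emeasurable_funB.
- move=> F mF tF PF.
  rewrite (_ : (fun _ => _) = fun x => (\sum_(0 <= i <oo) P x (F i))%E); last first.
    apply/funext => x; apply/esym/cvg_lim => //; apply: measure_sigma_additive => //.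
  by apply: ge0_emeasurable_sum.
- by rewrite -YG.
Qed.

Lemma norm_coord_le {R : realType} m n (x : 'M[R]_(m, n)) i j : `|x i j| <= `|x|.
Proof.
rewrite /Num.Def.normr/= mx_normrE.
exact: (le_bigmax _ (fun k : 'I_m * 'I_n => `|x k.1 k.2|) (i, j)).
Qed.

Section W2_topology.
Context {R : realType} {q : nat} (D : set 'rV[R]_q).
Hypothesis cD : compact D.
Implicit Types P Q : probability 'rV[R]_q R.

Lemma sqdist_ge0 (x y : 'rV[R]_q) : 0 <= sqdist x y.
Proof. by apply: sumr_ge0 => i _; exact: sqr_ge0. Qed.

Lemma measurable_sqdist : measurable_fun setT
  (fun z : 'rV[R]_q * 'rV[R]_q => sqdist z.1 z.2).
Proof.
rewrite /sqdist; apply: measurable_sum => i.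
apply: measurable_funX; apply: measurable_funB.
- exact: (measurableT_comp (measurable_coord_rV i) measurable_fst).
- exact: (measurableT_comp (measurable_coord_rV i) measurable_snd).
Qed.

Lemma not_ball_sqdist (x y : 'rV[R]_q) (d : R) : 0 < d -> ~ ball x d y -> d ^+ 2 <= sqdist x y.
Proof.
move=> d0 /not_andP[//|/existsNP[i /existsNP[j]]].
rewrite (ord1 i) /ball/= => /negP; rewrite -leNgt => dxy.
rewrite /sqdist (bigD1 j)//= -[_ ^+ 2 in leRHS]real_normK ?num_real//.
apply: (@le_trans _ _ (`|x 0 j - y 0 j| ^+ 2)); first by rewrite lerXn2r ?nnegrE// ltW.
by rewrite lerDl sumr_ge0// => k _; exact: sqr_ge0.
Qed.

(** Balls are those of the sup norm, whence the factor [q]. *)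
Lemma ball_sqdist (x y : 'rV[R]_q) (d : R) : ball x d y -> sqdist x y <= q%:R * d ^+ 2.
Proof.
move=> [d0 h]; rewrite /sqdist -[q in leRHS]card_ord -sumr_const -[leRHS]mulr1.
rewrite mulr1 mulr_suml; apply: ler_sum => i _; rewrite mul1r.
rewrite -real_normK ?num_real// lerXn2r ?nnegrE ?(ltW d0)//.
by have := h 0 i; rewrite /ball/= => /ltW.
Qed.

Lemma closed_measurable_rV n (A : set 'rV[R]_n) : closed A -> measurable A.
Proof.
by move=> cA; rewrite -(setCK A); apply: measurableC; apply: measurable_open_mx; exact: closed_openC.
Qed.

Lemma compact_measurable_rV n (A : set 'rV[R]_n) : compact A -> measurable A.
Proof. by move=> cA; apply: closed_measurable_rV; apply: compact_closed. Qed.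

Let mD : measurable D. Proof. exact: compact_measurable_rV. Qed.

Lemma compact_sqdist_bounded : exists C : R, 0 <= C /\ forall x y, D x -> D y -> sqdist x y <= C.
Proof.
have [M [Mr hM]] := compact_bounded cD.
pose N := `|M| + 1; have N0 : 0 < N by rewrite ltr_wpDl.
have MN : M < N by rewrite (le_lt_trans (ler_norm M))// ltrDl.
have hN x i : D x -> `|x 0 i| <= N.
  by move=> Dx; apply: le_trans (hM N MN x Dx); exact: norm_coord_le.
exists (q%:R * (2 * N) ^+ 2); split; first by rewrite mulr_ge0// sqr_ge0.
move=> x y Dx Dy; rewrite /sqdist -[q in leRHS]card_ord -sumr_const mulr_suml.
apply: ler_sum => i _; rewrite mul1r -real_normK ?num_real// lerXn2r ?nnegrE ?mulr_ge0 ?(ltW N0)//.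
by rewrite (le_trans (ler_normB _ _))// mulr2n mulrDl mul1r lerD// hN.
Qed.

(** A coupling of two measures on [D] lives on [D * D]; there the cost is at most [a] on [S] and at
    most [C] off [S]. *)
Lemma coupling_cost P Q g (S : set ('rV[R]_q * 'rV[R]_q)) (a C : R) :
  prob_on D P -> prob_on D Q -> coupling P Q g -> measurable S -> 0 <= a -> 0 <= C ->
  (forall x y, D x -> D y -> S (x, y) -> sqdist x y <= a) ->
  (forall x y, D x -> D y -> sqdist x y <= C) ->
  (\int[g]_z (sqdist z.1 z.2)%:E <= a%:E + C%:E * g (~` S))%E.
Proof.
move=> DP DQ Pg mS a0 C0 Sa DC.
have DQ' : Q (~` D) = 0%E by rewrite probability_setC// DQ subee.
have DP' : P (~` D) = 0%E by rewrite probability_setC// DP subee.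
have mDD : measurable (D `*` D) by exact: measurableX.
have gDD : g (~` (D `*` D)) = 0%E.
  apply/eqP; rewrite eq_le measure_ge0 andbT.
  rewrite (@le_trans _ _ (g ((~` D `*` setT) `|` (setT `*` ~` D))))//.
    apply: le_measure; rewrite ?inE.
    - exact: measurableC.
    - by apply: measurableU; apply: measurableX => //; exact: measurableC.
    - by move=> z /not_andP[]; [left|right].
  rewrite (le_trans (measureU2 _ _ _))//.
  - by apply: measurableX => //; exact: measurableC.
  - by apply: measurableX => //; exact: measurableC.
  have mDC : measurable (~` D) by exact: measurableC.
  by rewrite [X in (X + _)%E](Pg _ mDC).1 [X in (_ + X)%E](Pg _ mDC).2 DP' DQ' adde0.
have ms : measurable_fun setT (fun z : 'rV[R]_q * 'rV[R]_q => (sqdist z.1 z.2)%:E).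
  by apply/measurable_EFinP; exact: measurable_sqdist.
have s0 (z : 'rV[R]_q * 'rV[R]_q) : setT z -> (0 <= (sqdist z.1 z.2)%:E)%E.
  by move=> _; rewrite lee_fin sqdist_ge0.
rewrite (ge0_negligible_integral (measurableC mDD) measurableT ms s0 gDD).
rewrite setDE setTI setCK.
have mSC : measurable (~` S) by exact: measurableC.
apply: (@le_trans _ _ (\int[g]_(z in D `*` D) (a%:E + (C * \1_(~` S) z)%:E))%E).
  apply: ge0_le_integral => //.
  - by move=> z _; exact: s0.
  - exact: measurable_funTS.
  - apply: measurable_funTS; apply: emeasurable_funD => //; apply/measurable_EFinP.
    exact: measurable_funM.
  - move=> [x y] [Dx Dy]; rewrite -EFinD lee_fin indicE.
    have [xS|] := boolP ((x, y) \in ~` S).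
      by rewrite mulr1 (le_trans (DC _ _ Dx Dy))// lerDr.
    by rewrite notin_setE => /contrapT Sxy; rewrite mulr0 addr0 Sa.
rewrite ge0_integralD//; last 2 first.
- by move=> z _; rewrite lee_fin mulr_ge0// indicE.
- by apply: measurable_funTS; apply/measurable_EFinP; exact: measurable_funM.
apply: leeD.
  rewrite integral_cst// -[leRHS]mule1; apply: lee_wpmul2l => //.
  exact: probability_le1.
under eq_integral do rewrite EFinM.
rewrite ge0_integralZl//; last by apply: measurable_funTS; exact/measurable_EFinP.
apply: lee_wpmul2l => //; rewrite integral_indic//.
by apply: le_measure; rewrite ?inE//; exact: measurableI.
Qed.

Lemma W2_lt_coupling P Q r : prob_on D P -> prob_on D Q -> 0 < r -> W2 P Q < r ->
  exists2 g, coupling P Q g & (\int[g]_z (sqdist z.1 z.2)%:E < (r ^+ 2)%:E)%E.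
Proof.
move=> DP DQ r0; rewrite /W2; set S := [set _ | _ in _] => Pr.
have S0 : (0 <= ereal_inf S)%E.
  by apply: le_ereal_inf_tmp => _ [g _ <-]; apply: integral_ge0 => z _; rewrite lee_fin sqdist_ge0.
(* [fine] sends [+oo] to 0, so a small [W2] says nothing until the infimum is known to be finite.
   The product coupling, whose cost is bounded on [D], shows that it is. *)
suff Sy : (ereal_inf S < +oo)%E.
  have : (ereal_inf S < (r ^+ 2)%:E)%E.
    rewrite -(@fineK _ (ereal_inf S)) ?ge0_fin_numE// lte_fin.
    rewrite -[ltLHS]sqr_sqrtr ?fine_ge0// ltrXn2r// nnegrE ?sqrtr_ge0// ltW//.
  by move=> /ereal_inf_lt[_ [g Pg <-] gr]; exists g.
have [g gE] : exists g : probability ('rV[R]_q * 'rV[R]_q)%type R,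
    forall A, g A = (P \x Q)%E A.
  apply: probability_of; rewrite -setXTT.
  transitivity (P setT * Q setT)%E; last by rewrite !probability_setT mule1.
  exact: (product_measure1E P Q measurableT measurableT).
have gPQ A B : measurable A -> measurable B -> g (A `*` B) = (P A * Q B)%E.
  by move=> mA mB; rewrite gE; exact: product_measure1E.
have Pg : coupling P Q g.
  by move=> A mA; rewrite !gPQ// !probability_setT mule1 mul1e.
have [C [C0 hC]] := compact_sqdist_bounded.
apply: (@le_lt_trans _ _ (\int[g]_z (sqdist z.1 z.2)%:E)%E).
  by apply: ereal_inf_lbound; exists g.
have := coupling_cost DP DQ Pg measurableT C0 C0 (fun x y Dx Dy _ => hC x y Dx Dy) hC.
by rewrite setCT measure0 mule0 adde0 => /le_lt_trans; apply; exact: ltry.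
Qed.

Lemma W2_le_coupling P Q g r : coupling P Q g -> 0 <= r ->
  (\int[g]_z (sqdist z.1 z.2)%:E <= (r ^+ 2)%:E)%E -> W2 P Q <= r.
Proof.
move=> Pg r0 gr; rewrite /W2 -[leRHS]ger0_norm// -sqrtr_sqr ler_sqrt ?sqr_ge0//.
have i0 : (0 <= ereal_inf [set (\int[g]_z (sqdist z.1 z.2)%:E)%E | g in coupling P Q])%E.
  by apply: le_ereal_inf_tmp => _ [h _ <-]; apply: integral_ge0 => z _; rewrite lee_fin sqdist_ge0.
have ir : (ereal_inf [set (\int[g]_z (sqdist z.1 z.2)%:E)%E | g in coupling P Q] <= (r ^+ 2)%:E)%E.
  by apply: le_trans gr; apply: ereal_inf_lbound; exists g.
rewrite -lee_fin fineK// ge0_fin_numE//; exact: le_lt_trans ir (ltry _).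
Qed.

(** Lower semicontinuity of the mass of an open set. The sets [Gd n] of points at distance at least
    [1/(n+1)] from the complement exhaust [G]; mass starting in [Gd n] can leave [G] only by
    travelling that far, and Markov's inequality bounds the mass that does so. *)
Lemma W2_open_gt (G : set 'rV[R]_q) (c : R) : open G ->
  W2_open D [set P | prob_on D P /\ (c%:E < P G)%E].
Proof.
move=> oG; split=> [P []//|P [DP cP]].
pose Gd (n : nat) := ~` \bigcup_(y in ~` G) ball y (n.+1%:R^-1 : R).
have mGd n : measurable (Gd n).
  apply: measurableC; apply: measurable_open_mx; apply: bigcup_open => y _; exact: ball_open.
have n0 n : 0 < (n.+1%:R^-1 : R) by rewrite invr_gt0.
have GdG : \bigcup_n Gd n = G.
  apply/seteqP; split=> [x [n _ Gx]|x Gx].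
    by apply: contrapT => nGx; apply: Gx; exists x => //; exact: ballxx.
  have /nbhs_ballP[e /= e0 xeG] : nbhs x G by exact: open_nbhs_nbhs.
  have [n _ /(_ _ (leqnn _)) /= ne] := near_infty_natSinv_lt (PosNum e0).
  exists n => // -[y nGy yx]; apply: nGy; apply: xeG; apply: ball_sym.
  by apply: le_ball yx; exact: ltW.
have ndGd : nondecreasing_seq Gd.
  move=> m n mn; apply/subsetPset => x Gx [y nGy yx]; apply: Gx; exists y => //.
  by apply: le_ball yx; rewrite lef_pV2 ?posrE// ler_nat.
have cvgP : P (Gd n) @[n --> \oo] --> P G.
  rewrite -[in P G]GdG; apply: nondecreasing_cvg_mu => //; exact: bigcupT_measurable.
have [n cPn] : exists n, (c%:E < P (Gd n))%E.
  apply: contrapT => /forallNP h; move: cP; rewrite ltNge => /negP; apply.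
  rewrite -(cvg_lim _ cvgP)//; apply: lime_le; first by apply/cvg_ex; eexists; exact: cvgP.
  by apply: nearW => n; rewrite leNgt; apply/negP; exact: h.
pose d : R := n.+1%:R^-1.
pose e := fine (P (Gd n)) - c.
have e0 : 0 < e by rewrite subr_gt0 -lte_fin fineK// fin_num_measure.
(* Chosen so that [r^2 / d^2 = e], the room between [P (Gd n)] and [c]: a cost below [r^2] moves
   mass less than [e] over distance [d]. *)
pose r := d * Num.sqrt e.
have r0 : 0 < r by rewrite mulr_gt0 ?sqrtr_gt0// n0.
exists r => // Q DQ PQr; split=> //.
have [g Pg gr] := W2_lt_coupling DP DQ r0 PQr.
have mG : measurable G by exact: measurable_open_mx.
pose F := [set z : 'rV[R]_q * 'rV[R]_q | ((d ^+ 2)%:E <= `|(sqdist z.1 z.2)%:E|)%E].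
have ms : measurable_fun setT (fun z : 'rV[R]_q * 'rV[R]_q => (sqdist z.1 z.2)%:E).
  by apply/measurable_EFinP; exact: measurable_sqdist.
have mF : measurable F.
  rewrite -[F]setTI; apply: emeasurable_fun_c_infty => //; exact: measurableT_comp.
have d20 : 0 < d ^+ 2 by rewrite exprn_gt0// n0.
have gF : (g F < e%:E)%E.
  have := le_integral_abse g measurableT ms d20; rewrite setTI -/F => hF.
  rewrite -(@lte_pmul2l _ (d ^+ 2)%:E)// ?lte_fin//.
  apply: (le_lt_trans hF); rewrite -EFinM (_ : d ^+ 2 * e = r ^+ 2); last first.
    by rewrite /r exprMn sqr_sqrtr// ltW.
  apply: le_lt_trans gr; rewrite (eq_integral (fun z => (sqdist z.1 z.2)%:E))// => z _.
  by rewrite gee0_abs// lee_fin sqdist_ge0.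
have : (P (Gd n) <= Q G + g F)%E.
  rewrite -(Pg _ (mGd n)).1 -(Pg _ mG).2.
  apply: (@le_trans _ _ (g ((setT `*` G) `|` F))); last first.
    by apply: measureU2 => //; exact: measurableX.
  apply: le_measure; rewrite ?inE.
  - exact: measurableX.
  - by apply: measurableU => //; exact: measurableX.
  move=> [x y] [/= Gx _]; have [Gy|nGy] := pselect (G y); first by left.
  right; rewrite /F/= lee_fin ger0_norm ?sqdist_ge0//.
  apply: not_ball_sqdist; first exact: n0.
  by move=> /ball_sym xy; apply: Gx; exists y.
move=> h; rewrite -(@fineK _ (Q G)) ?fin_num_measure// lte_fin.
move: h gF; rewrite -(fineK (fin_num_measure P _ (mGd n))).
rewrite -(fineK (fin_num_measure Q _ mG)) -(fineK (fin_num_measure g _ mF)).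
by rewrite -EFinD lee_fin lte_fin /e /=; lra.
Qed.

End W2_topology.

(** By [W2_open_gt] the mass of an open set is measurable along the map; open sets form a generating
    pi-system. *)
Lemma L2map_kernel {R : realType} {p q : nat} (Omega : set 'rV[R]_p) (D : set 'rV[R]_q)
    (mu : 'rV[R]_p -> probability 'rV[R]_q R) :
  compact Omega -> compact D -> L2map Omega D mu ->
  forall A, measurable A -> measurable_fun Omega (fun xi => mu xi A).
Proof.
move=> cO cD [Dmu mmu].
apply: (@measurable_family_generated _ _ _ _ _ Omega mu [set U | open U]) => //.
- exact: compact_measurable_rV.
- by move=> U V; exact: openI.
- move=> U oU; apply: (measurability _ (ErealGenOInfty.measurableE R)).
  move=> _ [_ [c ->] <-].
  rewrite (_ : _ `&` _ = Omega `&` mu @^-1` [set P | prob_on D P /\ (c%:E < P U)%E]).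
    by apply: mmu; apply: sub_sigma_algebra; exact: W2_open_gt.
  apply/seteqP; split=> xi [Oxi /=]; rewrite in_itv/= andbT; last by case.
  by move=> h; split=> //; split=> //; exact: Dmu.
Qed.

Section kernel_L2map.
Context {R : realType} {q : nat} (D : set 'rV[R]_q).
Hypothesis cD : compact D.
Implicit Types P Q : probability 'rV[R]_q R.

(** A finite cover by balls of radius [e / 2], made disjoint by removing from each ball the previous
    ones. *)
Lemma small_partition (e : R) : 0 < e -> exists (N : nat) (A : nat -> set 'rV[R]_q),
  [/\ forall k, measurable (A k) /\ ((N <= k)%N -> A k = set0), trivIset setT A,
      D `<=` \bigcup_(k < N) A k & forall k x y, A k x -> A k y -> ball x e y].
Proof.
move=> e0; have e20 : 0 < e / 2 by rewrite divr_gt0.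
have cD' : cover_compact D by rewrite -compact_cover.
have [||D' _ cov] := cD' _ D (fun z => ball z (e / 2)).
- by move=> z _; exact: ball_open.
- by move=> z Dz; exists z => //; exact: ballxx.
pose s := enum_fset D'; pose U k := if (k < size s)%N then ball (nth 0 s k) (e / 2) else set0.
have mU k : measurable (U k).
  by rewrite /U; case: ifP => _ //; apply: measurable_open_mx; exact: ball_open.
exists (size s), (seqDU U); split.
- move=> k; split; first by apply: measurableD => //; exact: bigsetU_measurable.
  by move=> kN; rewrite /seqDU /U ltnNge kN set0D.
- exact: trivIset_seqDU.
- move=> x /cov[c cs cx].
  have : (\bigcup_k U k) x.
    exists (index c s) => //; rewrite /U index_mem (_ : c \in s)//= nth_index//.
  rewrite seqDU_bigcup_eq => -[k _ kx]; exists k => //=.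
  by case: kx; rewrite /U; case: ifP.
- move=> k x y [+ _] [+ _]; rewrite /U; case: ifP => // _ /ball_sym cx cy.
  by rewrite (splitr e); exact: ball_triangle cx cy.
Qed.

Section coupling_of_lower_bound.
Variables (P Q : probability 'rV[R]_q R) (N : nat) (A : nat -> set 'rV[R]_q) (eta : R).
Hypotheses (DP : prob_on D P) (DQ : prob_on D Q) (mA : forall k, measurable (A k))
  (tA : trivIset setT A) (DA : D `<=` \bigcup_(k < N) A k)
  (eta1 : eta <= 1)
  (PQ : forall k, (1 - eta) * fine (P (A k)) <= fine (Q (A k))).

Let p k := fine (P (A k)).
Let r k := fine (Q (A k)).

Let sumA (m : probability 'rV[R]_q R) X : prob_on D m -> measurable X ->
  (\sum_(k < N) m (X `&` A k) = m X)%E.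
Proof.
move=> Dm mX; have mD : measurable D by exact: compact_measurable_rV.
have mbig : measurable (\big[setU/set0]_(k < N) (X `&` A k)).
  by apply: bigsetU_measurable => k _; exact: measurableI.
have -> : (\sum_(k < N) m (X `&` A k))%E = m (\big[setU/set0]_(k < N) (X `&` A k)).
  apply/esym; apply: (@measure_bigsetU _ _ _ m (fun k => X `&` A k)).
    by move=> k; exact: measurableI.
  exact: trivIset_setIl.
apply/eqP; rewrite eq_le; apply/andP; split.
  apply: le_measure; [by rewrite inE|by rewrite inE|rewrite -(bigcup_mkord N (fun k => X `&` A k))].
  by apply: bigcup_sub => k _ x [].
have D0 : m (~` D) = 0%E by rewrite probability_setC// Dm subee.
rewrite (@le_trans _ _ (m (\big[setU/set0]_(k < N) (X `&` A k) `|` ~` D)))//.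
  apply: le_measure; rewrite ?inE//.
    by apply: measurableU => //; exact: measurableC.
  move=> x Xx; have [Dx|] := pselect (D x); last by right.
  by left; rewrite -(bigcup_mkord N (fun k => X `&` A k)); have [k kN Ak] := DA Dx; exists k.
rewrite (le_trans (measureU2 _ mbig (measurableC mD)))//.
by rewrite [X in (_ + X)%E]D0 adde0.
Qed.

Let r0 k : 0 <= r k. Proof. exact: fine_ge0. Qed.

Let p0 k : 0 <= p k. Proof. exact: fine_ge0. Qed.

(** Mass [(1 - eta) p k] is kept inside the cell by a multiple of the product measure on
    [A k * A k]; the mass [r k - (1 - eta) p k] that [Q] still lacks there is drawn from all of [P]
    by a multiple of the product on [setT * A k]. The coefficients are the ones that give both
    marginals after summation over [k]. *)
Let a k : R := (1 - eta) / r k.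
Let b k : R := 1 - (1 - eta) * p k / r k.

Let a0 k : 0 <= a k. Proof. by rewrite divr_ge0// subr_ge0. Qed.

Let b0 k : 0 <= b k.
Proof.
rewrite subr_ge0; have [->|rk] := eqVneq (r k) 0; first by rewrite invr0 mulr0.
by rewrite ler_pdivrMr ?mul1r ?PQ// lt_neqAle eq_sym rk r0.
Qed.

Let part k : {measure set ('rV[R]_q * 'rV[R]_q)%type -> \bar R} :=
  measure_add (mscale (NngNum (a0 k)) (mrestr (P \x Q)%E (measurableX (mA k) (mA k))))
    (mscale (NngNum (b0 k)) (mrestr (P \x Q)%E (measurableX measurableT (mA k)))).

Let partE k X : part k X = ((a k)%:E * (P \x Q)%E (X `&` (A k `*` A k)) +
  (b k)%:E * (P \x Q)%E (X `&` (setT `*` A k)))%E.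
Proof. exact: measure_addE. Qed.

Let partX k X Y : measurable X -> measurable Y -> part k (X `*` Y) =
  ((a k)%:E * (P (X `&` A k) * Q (Y `&` A k)) + (b k)%:E * (P X * Q (Y `&` A k)))%E.
Proof.
move=> mX mY; rewrite partE -!setXI setIT; congr (_ * _ + _ * _)%E.
  by apply: product_measure1E; exact: measurableI.
by apply: product_measure1E => //; exact: measurableI.
Qed.

Let g0 := msum part N.

Let pE k : P (A k) = (p k)%:E. Proof. by rewrite fineK// fin_num_measure. Qed.
Let rE k : Q (A k) = (r k)%:E. Proof. by rewrite fineK// fin_num_measure. Qed.

Let sum_p : \sum_(k < N) p k = 1.
Proof.
apply: EFin_inj; rewrite -sumEFin -(probability_setT P) -(sumA DP measurableT).
by apply: eq_bigr => k _; rewrite setTI pE.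
Qed.

Let sum_r : \sum_(k < N) r k = 1.
Proof.
apply: EFin_inj; rewrite -sumEFin -(probability_setT Q) -(sumA DQ measurableT).
by apply: eq_bigr => k _; rewrite setTI rE.
Qed.

(** On a cell of zero [Q]-mass the quotients by [r k] are 0 by convention. The first marginal
    survives because [P] then gives the cell no mass either; [eta = 1] is treated apart. *)
Let rp0 k : r k = 0 -> eta < 1 -> p k = 0.
Proof.
move=> rk e1; apply/le_anti; rewrite p0 andbT.
by have := PQ k; rewrite -/(p k) -/(r k) rk pmulr_rle0// subr_gt0.
Qed.

Let marginal1 X : measurable X -> g0 (X `*` setT) = P X.
Proof.
move=> mX; rewrite /g0 /msum.
have fX k : P (X `&` A k) = (fine (P (X `&` A k)))%:E.
  by rewrite fineK// fin_num_measure//; exact: measurableI.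
transitivity (\sum_(k < N) ((1 - eta) * fine (P (X `&` A k)) +
    (r k - (1 - eta) * p k) * fine (P X))%:E)%E.
  apply: eq_bigr => k _; rewrite partX// setTI rE fX -(fineK (fin_num_measure P _ mX)).
  rewrite -!EFinM -EFinD; congr (_%:E); rewrite /a /b.
  have [rk|rk] := eqVneq (r k) 0; last by rewrite /=; field.
  have [e1|] := ltP eta 1; last first.
    by move=> e1; rewrite (_ : eta = 1); [rewrite rk /=; ring|apply/le_anti; rewrite eta1].
  have pk := rp0 rk e1; have PX : fine (P (X `&` A k)) = 0.
    apply/le_anti; rewrite fine_ge0// andbT -pk fine_le ?fin_num_measure//; first exact: measurableI.
    by apply: le_measure; rewrite ?inE//; exact: measurableI.
  by rewrite PX rk pk /=; ring.
rewrite sumEFin big_split/= -mulr_sumr -mulr_suml sumrB -mulr_sumr sum_p sum_r.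
rewrite -[RHS](fineK (fin_num_measure P _ mX)).
have -> : \sum_(k < N) fine (P (X `&` A k)) = fine (\sum_(k < N) P (X `&` A k))%E.
  by rewrite (eq_bigr (fun k : 'I_N => (fine (P (X `&` A k)))%:E)) ?sumEFin// => k _; exact: fX.
by rewrite (sumA DP mX); congr (_%:E); ring.
Qed.

Let marginal2 Y : measurable Y -> g0 (setT `*` Y) = Q Y.
Proof.
move=> mY; rewrite /g0 /msum -(sumA DQ mY); apply: eq_bigr => k _.
rewrite partX// setTI pE probability_setT mul1e.
rewrite -(@fineK _ (Q (Y `&` A k))); last by rewrite fin_num_measure//; exact: measurableI.
rewrite -!EFinM -EFinD; congr (_%:E); rewrite /a /b.
by rewrite /=; ring.
Qed.

(** Only the second part of each piece leaves the diagonal cells, and its total mass is the sum of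
    [r k - (1 - eta) p k], that is [eta]. *)
Lemma coupling_of_lower_bound : exists2 g, coupling P Q g &
  (g (~` \bigcup_(k < N) (A k `*` A k)) <= eta%:E)%E.
Proof.
have [g gE] : exists g : probability ('rV[R]_q * 'rV[R]_q)%type R, forall X, g X = g0 X.
  apply: probability_of; rewrite -setXTT.
  by rewrite [LHS](marginal1 measurableT) probability_setT.
exists g; first by move=> X mX; rewrite !gE marginal1// marginal2.
have mAA k : measurable (A k `*` A k) by exact: measurableX.
have mB : measurable (\bigcup_(k < N) (A k `*` A k)) by apply: bigcup_measurable.
rewrite gE /g0 /msum.
have -> : eta = \sum_(k < N) (r k - (1 - eta) * p k).
  by rewrite sumrB -mulr_sumr sum_p sum_r; ring.
rewrite -sumEFin; apply: lee_sum => k _; rewrite partE.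
rewrite (_ : _ `&` (A k `*` A k) = set0); last first.
  by rewrite -subset0 => z [nz kz]; apply: nz; exists k => //=.
rewrite measure0 mule0 add0e.
apply: (@le_trans _ _ ((b k)%:E * (P setT * Q (A k)))%E).
  apply: lee_wpmul2l; first by rewrite lee_fin.
  rewrite -(product_measure1E P Q measurableT (mA k)).
  apply: le_measure; rewrite ?inE//; last exact: measurableX.
  by apply: measurableI; [exact: measurableC|exact: measurableX].
rewrite probability_setT mul1e rE -EFinM lee_fin /b mulrBl mul1r.
have [rk|rk] := eqVneq (r k) 0; last by rewrite mulfVK.
rewrite rk !mulr0 subr0 add0r; have [e1|e1] := ltP eta 1; first by rewrite (rp0 rk e1) mulr0 oppr0.
by rewrite (_ : eta = 1) ?subrr ?mul0r ?oppr0//; apply/le_anti; rewrite eta1.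
Qed.

End coupling_of_lower_bound.

(** Every [W2]-open set is a countable union of sets [V z], each given by a level of partition and
    finitely many rational lower bounds on the masses of its cells, hence measurable along a kernel.
    Lower bounds suffice: a measure whose cell masses are at least [1 - eta] times those of [P] is
    [W2]-close to [P] by [coupling_of_lower_bound]. *)
Lemma kernel_L2map {p : nat} (Omega : set 'rV[R]_p)
    (mu : 'rV[R]_p -> probability 'rV[R]_q R) : measurable Omega ->
  (forall xi, Omega xi -> prob_on D (mu xi)) ->
  (forall A, measurable A -> measurable_fun Omega (fun xi => mu xi A)) ->
  L2map Omega D mu.
Proof.
move=> mO Dmu mmu; split=> //.
suff : W2_borel D `<=` [set B | measurable (Omega `&` mu @^-1` B)] by [].
have n0 (n : nat) : 0 < (n.+1%:R^-1 : R) by rewrite invr_gt0.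
have /choice[N /choice[A NA]] := fun n : nat => small_partition (n0 n).
apply: smallest_sub.
  split=> [|B mB|F mF].
  - by rewrite /= preimage_set0 setI0.
  - rewrite /= (_ : _ `&` _ = Omega `\` (Omega `&` mu @^-1` B)); first exact: measurableD.
    apply/seteqP; split=> xi [Oxi]; first by move=> [_ nB]; split=> // -[_ /nB].
    by move=> nB; split=> //; split; [exact: Dmu|move=> Bxi; exact: nB].
  - rewrite /= preimage_bigcup setI_bigcupr; exact: bigcupT_measurable.
move=> U [UD Uball] /=.
pose V (z : nat * seq rat) := [set Q | prob_on D Q /\
  forall k, (k < N z.1)%N -> ((ratr (nth 0 z.2 k) : R)%:E <= Q (A z.1 k))%E].
pose V' z := if `[< V z `<=` U >] then V z else set0.
have mV z : measurable (Omega `&` mu @^-1` V z).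
  pose F k := if (k < N z.1)%N then
    Omega `&` [set xi | ((ratr (nth 0 z.2 k) : R)%:E <= mu xi (A z.1 k))%E] else Omega.
  rewrite (_ : _ `&` _ = \bigcap_k F k).
    apply: bigcapT_measurable => k; rewrite /F; case: ifP => // _.
    by apply: emeasurable_fun_c_infty => //; apply: mmu; have [/(_ k)[]] := NA z.1.
  apply/seteqP; split=> [xi [Oxi [_ h]] k _|xi h].
    by rewrite /F; case: ifP => // kN; split=> //; exact: h.
  have Oxi : Omega xi by have := h 0%N I; rewrite /F; case: ifP => // _ [].
  split=> //; split; first exact: Dmu.
  by move=> k kN; have := h k I; rewrite /F kN => -[].
suff -> : U = \bigcup_z V' z.
  rewrite preimage_bigcup setI_bigcupr.
  apply: countable_bigcupT_measurable => [|z]; first exact: countableP.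
  by rewrite /V'; case: ifP => _; [exact: mV|rewrite preimage_set0 setI0].
apply/seteqP; split=> [P UP|P [z _]]; last by rewrite /V'; case: asboolP => // h /h.
have DP := UD _ UP; have [r r0 rU] := Uball _ UP.
have [C [C0 hC]] := compact_sqdist_bounded cD.
(* The budget [(r / 2)^2] for the transport cost is split evenly between the mass kept in its cell,
   at cost [q / (n+1)^2] at most, and the fraction [eta] moved at cost at most [C]. *)
pose s := (r / 2) ^+ 2 / 2; have s0 : 0 < s by rewrite divr_gt0// exprn_gt0// divr_gt0.
have q1 : 0 < q%:R + 1 :> R by rewrite ltr_wpDl.
have sq0 : 0 < s / (q%:R + 1) by rewrite divr_gt0.
have [n _ /(_ _ (leqnn _)) /= nq] := near_infty_natSinv_lt (PosNum sq0).
have C1 : 0 < C + 1 by rewrite ltr_wpDl.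
pose eta := Order.min 1 (s / (C + 1)).
have eta0 : 0 < eta by rewrite lt_min ltr01 divr_gt0.
have eta1 : eta <= 1 by rewrite ge_min lexx.
have Ceta : C * eta <= s.
  rewrite (@le_trans _ _ ((C + 1) * eta))//; first by rewrite ler_wpM2r ?ltW// ltrDl.
  by rewrite mulrC -ler_pdivlMr// ge_min lexx orbT.
have [/all_and2[mA A0] tA DA dA] := NA n.
(* The factor [1 - eta] leaves room for a rational below the true mass; on a cell of mass zero the
   rational is 0. *)
have /choice[rho rhoP] : forall k, exists a : rat,
    (1 - eta) * fine (P (A n k)) <= ratr a <= fine (P (A n k)).
  move=> k; have : 0 <= fine (P (A n k)) by exact: fine_ge0.
  rewrite le_eqVlt => /orP[/eqP<-|pk]; first by exists 0; rewrite mulr0 rmorph0 lexx.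
  have [a] : exists a : rat, ratr a \in `](1 - eta) * fine (P (A n k)), fine (P (A n k))[.
    by apply: rat_in_itvoo; rewrite gtr_pMl// ltrBlDr ltrDl.
  by rewrite in_itv/= => /andP[a1 a2]; exists a; rewrite !ltW.
pose z := (n, mkseq rho (N n)); exists z => //.
have PE k : P (A n k) = (fine (P (A n k)))%:E by rewrite fineK// fin_num_measure.
have VzU : V z `<=` U.
  move=> Q [DQ hQ]; apply: rU => //.
  have PQ k : (1 - eta) * fine (P (A n k)) <= fine (Q (A n k)).
    have [kN|kN] := ltnP k (N n); last by rewrite A0// !measure0 mulr0.
    have := hQ k kN; rewrite /z/= nth_mkseq// => h.
    have /andP[+ _] := rhoP k; move=> /le_trans; apply.
    by rewrite -lee_fin fineK// fin_num_measure.
  have [g Pg gS] := coupling_of_lower_bound DP DQ mA tA DA eta1 PQ.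
  have r2 : 0 <= r / 2 by rewrite divr_ge0// ltW.
  apply: (@le_lt_trans _ _ (r / 2)); last by rewrite ltr_pdivrMr// ltr_pMr// ltr1n.
  apply: (W2_le_coupling Pg r2).
  have mS : measurable (\bigcup_(k < N n) (A n k `*` A n k)).
    by apply: bigcup_measurable => k _; exact: measurableX.
  have e0 : 0 <= q%:R * (n.+1%:R^-1 : R) ^+ 2 by rewrite mulr_ge0// exprn_ge0// ltW.
  have := coupling_cost cD DP DQ Pg mS e0 C0 _ hC.
  move=> /(_ _)/le_trans; apply.
    by move=> x y _ _ [k _ [/= Ax Ay]]; apply: ball_sqdist; exact: dA Ay.
  apply: (@le_trans _ _ (s%:E + C%:E * eta%:E)%E).
    apply: leeD; last by rewrite lee_wpmul2l ?lee_fin.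
    rewrite lee_fin (@le_trans _ _ (q%:R * n.+1%:R^-1))//.
      by rewrite ler_wpM2l// expr2 ler_piMl// ?(ltW (n0 n))// invf_le1// ler1n.
    rewrite (@le_trans _ _ ((q%:R + 1) * n.+1%:R^-1))//.
      by rewrite ler_wpM2r ?(ltW (n0 n))// lerDl.
    by rewrite mulrC -ler_pdivlMr// ltW.
  by rewrite -EFinM -EFinD lee_fin (le_trans (lerD (lexx s) Ceta))// /s; lra.
rewrite /V' asboolT//; split=> // k kN.
by rewrite /z/= nth_mkseq// PE lee_fin; have /andP[] := rhoP k.
Qed.

End kernel_L2map.

(** * Lebesgue measure of Lipschitz boundaries *)

Section generators.
Context {R : realType} {n : nat}.
Implicit Types (a b v : 'rV[R]_n).

(** The identity from the sigma-algebra generated by [G] is measurable because its coordinates are;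
    half-spaces are therefore all that has to be generated. *)
Lemma measurable_rV_generated (G : set (set 'rV[R]_n)) : G `<=` measurable ->
  (forall i (c : R), <<s G >> [set x | c < x 0 i]) -> @measurable _ 'rV[R]_n = <<s G >>.
Proof.
move=> Gm Gray; apply/seteqP; split; last first.
  apply: smallest_sub => //; split; [exact: measurable0|move=> A mA|exact: bigcupT_measurable].
  by rewrite setTD; exact: measurableC.
move=> A mA.
have mid : measurable_fun setT (id : g_sigma_algebraType G -> 'rV[R]_n).
  apply: measurable_fun_rV => i.
  apply: (measurability _ (RGenOInfty.measurableE R)) => _ [_ [c ->] <-].
  rewrite setTI (_ : _ @^-1` _ = [set x : 'rV[R]_n | c < x 0 i]); first exact: Gray.
  by apply/seteqP; split=> x /=; rewrite in_itv/= andbT.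
by have := mid measurableT A mA; rewrite setTI preimage_id.
Qed.

Definition rV_box a b : set 'rV[R]_n := [set x | forall i, a 0 i <= x 0 i <= b 0 i].
Definition rV_orthant a : set 'rV[R]_n := [set x | forall i, a 0 i < x 0 i].

Lemma measurable_rV_coord_itv i (I : interval R) :
  measurable [set x : 'rV[R]_n | x 0 i \in I].
Proof.
by have := measurable_coord_rV i measurableT (measurable_itv I); rewrite setTI.
Qed.

Lemma measurable_rV_box a b : measurable (rV_box a b).
Proof.
rewrite (_ : rV_box a b = \bigcap_(i in [set: 'I_n]) [set x : 'rV[R]_n | x 0 i \in `[a 0 i, b 0 i]]).
  by apply: fin_bigcap_measurable => // i _; exact: measurable_rV_coord_itv.
by apply/seteqP; split=> x h i; [move=> _ /=|]; have := h i; rewrite /= ?in_itv//=; apply.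
Qed.

Lemma measurable_rV_orthant a : measurable (rV_orthant a).
Proof.
rewrite (_ : rV_orthant a = \bigcap_(i in [set: 'I_n]) [set x : 'rV[R]_n | x 0 i \in `]a 0 i, +oo[]).
  by apply: fin_bigcap_measurable => // i _; exact: measurable_rV_coord_itv.
by apply/seteqP; split=> x h i; [move=> _ /=|]; have := h i; rewrite /= ?in_itv/= ?andbT//; apply.
Qed.

Lemma rV_boundedP (x : 'rV[R]_n) : exists m : nat, forall i, `|x 0 i| < m%:R.
Proof.
exists (Num.bound `|x|).+1 => i; apply: (le_lt_trans (norm_coord_le x 0 i)).
have := archi_boundP (normr_ge0 x); move=> /lt_trans; apply; rewrite ltr_nat//.
Qed.

Lemma rV_orthant_generated : @measurable _ 'rV[R]_n = <<s range rV_orthant >>.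
Proof.
apply: measurable_rV_generated => [_ [a _ <-]|i c]; first exact: measurable_rV_orthant.
rewrite [X in smallest _ _ X](_ : _ = \bigcup_m rV_orthant (\row_j (if j == i then c else - m%:R))).
  apply: (@bigcupT_measurable _ (g_sigma_algebraType (range rV_orthant))) => m.
  by apply: sub_sigma_algebra; exists (\row_j (if j == i then c else - m%:R)).
apply/seteqP; split=> [x /= cx|x [m _ /(_ i)]]; last by rewrite mxE eqxx.
have [m xm] := rV_boundedP x; exists m => // j; rewrite mxE; case: eqP => [->//|_].
by have := xm j; rewrite ltr_norml => /andP[].
Qed.

Lemma rV_box_generated : @measurable _ 'rV[R]_n = <<s [set rV_box z.1 z.2 | z in setT] >>.
Proof.
apply: measurable_rV_generated => [_ [z _ <-]|i c]; first exact: measurable_rV_box.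
rewrite [X in smallest _ _ X](_ : _ = \bigcup_m rV_box
  (\row_j (if j == i then c + m.+1%:R^-1 else - m%:R)) (const_mx m%:R)).
  apply: (@bigcupT_measurable _ (g_sigma_algebraType _)) => m.
  apply: sub_sigma_algebra.
  by exists (\row_j (if j == i then c + m.+1%:R^-1 else - m%:R), const_mx m%:R).
apply/seteqP; split=> [x /= cx|x [m _ /(_ i)]]; last first.
  rewrite mxE eqxx => /andP[+ _]; apply: lt_le_trans.
  by rewrite ltrDl invr_gt0.
have [m xm] := rV_boundedP x.
have e0 : 0 < x 0 i - c by rewrite subr_gt0.
have [k _ kP] := near_infty_natSinv_lt (PosNum e0).
exists (maxn m k) => // j; rewrite !mxE.
have mm : m%:R <= (maxn m k)%:R :> R by rewrite ler_nat leq_maxl.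
have := xm j; rewrite ltr_norml => /andP[x1 x2].
rewrite (le_trans (ltW x2) mm) andbT; case: eqP => [->|_]; last first.
  by rewrite (le_trans _ (ltW x1))// lerN2.
by have /= := kP _ (leq_maxr m k); rewrite -lerBrDl => /ltW.
Qed.

Lemma lebesgue_rV_translate v A : measurable A ->
  lebesgue_rV n [set x | A (x + v)] = lebesgue_rV n A.
Proof.
move=> mA; pose s (x : 'rV[R]_n) := x + v.
have ms : measurable_fun setT s.
  apply: measurable_fun_rV => i; under eq_fun do rewrite mxE.
  by apply: measurable_funD => //; exact: measurable_coord_rV.
pose g (m : nat) : set 'rV[R]_n := rV_box (const_mx (- m%:R)) (const_mx m%:R).
have box0 a b : ~ (forall i, a 0 i <= b 0 i) -> rV_box a b = set0.
  move=> nab; rewrite -subset0 => x h; apply: nab => i.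
  by have /andP[] := h i; exact: le_trans.
rewrite -[LHS]/(image_measure (lebesgue_rV n) ms A).
apply/esym; apply: (measure_unique [set rV_box z.1 z.2 | z in setT] g) mA => //.
- exact: rV_box_generated.
- move=> _ _ [[a b] _ <-] [[c d] _ <-] /=.
  exists (\row_i Order.max (a 0 i) (c 0 i), \row_i Order.min (b 0 i) (d 0 i)) => //=.
  apply/seteqP; split=> [x h|x [h1 h2] i].
    by split=> i; have := h i; rewrite !mxE ge_max le_min => /andP[/andP[? ?] /andP[? ?]]; apply/andP.
  have /andP[h3 h4] := h1 i; have /andP[h5 h6] := h2 i.
  by rewrite !mxE ge_max le_min; do 2?(apply/andP; split).
- by move=> m; exists (const_mx (- m%:R), const_mx m%:R).
- rewrite -subTset => x _; have [m xm] := rV_boundedP x; exists m => // i; rewrite !mxE.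
  by have := xm i; rewrite ltr_norml => /andP[/ltW-> /ltW->].
- move=> _ [[a b] _ <-] /=.
  rewrite -[RHS]/(lebesgue_rV n (s @^-1` rV_box a b)).
  rewrite (_ : s @^-1` _ = rV_box (a - v) (b - v)); last first.
    by apply/seteqP; split=> x h i; have := h i; rewrite /s !mxE lerBlDr lerBrDr.
  have [ab|nab] := pselect (forall i, a 0 i <= b 0 i).
    rewrite [LHS]lebesgue_rV_box// [RHS]lebesgue_rV_box => [|i]; last first.
      by rewrite !mxE lerD2r.
    by congr (_%:E); apply: eq_bigr => i _; rewrite !mxE; ring.
  rewrite !box0//= => h; apply: nab => i; by have := h i; rewrite !mxE lerD2r.
- move=> m; rewrite [X in (X < _)%E]lebesgue_rV_box ?ltry// => i.
  by rewrite !mxE (le_trans _ (ler0n _ _))// oppr_le0.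
Qed.

Lemma lebesgue_rV_bounded (A : set 'rV[R]_n) (M : R) : measurable A ->
  (forall x, A x -> `|x| <= M) -> (lebesgue_rV n A < +oo)%E.
Proof.
move=> mA AM; apply: (@le_lt_trans _ _ (lebesgue_rV n (rV_box (const_mx (- `|M|)) (const_mx `|M|)))).
  apply: le_measure; rewrite ?inE//; first exact: measurable_rV_box.
  move=> x Ax i; rewrite !mxE -ler_norml (le_trans (norm_coord_le x 0 i))//.
  by rewrite (le_trans (AM x Ax))// ler_norm.
rewrite [X in (X < _)%E]lebesgue_rV_box ?ltry// => i.
by rewrite !mxE (le_trans _ (normr_ge0 _))// oppr_le0.
Qed.

(** Translates of [A] along [w] by different amounts lie in different level sets of [h], so they are
    disjoint, and they have equal measure. *)
Lemma lebesgue_rV_graph_null (h : 'rV[R]_n -> R) (w : 'rV[R]_n) (A : set 'rV[R]_n) (M : R) :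
  (forall x t, h (x + t *: w) = h x + t) -> measurable A ->
  (forall x, A x -> h x = 0 /\ `|x| <= M) -> lebesgue_rV n A = 0%E.
Proof.
move=> hw mA AM.
have M0 : (forall x, A x -> `|x| <= M) by move=> x /AM[].
(* The shifts [1/(k+1)] are distinct and bounded, which keeps the union in a set of finite
   measure. *)
pose B (k : nat) := [set x | A (x + k.+1%:R^-1 *: w)].
have mB k : measurable (B k).
  rewrite -[B k]setTI; apply: (_ : measurable_fun setT (fun x : 'rV[R]_n => x + k.+1%:R^-1 *: w)) => //.
  apply: measurable_fun_rV => i; under eq_fun do rewrite mxE.
  by apply: measurable_funD => //; exact: measurable_coord_rV.
have tB : trivIset setT B.
  apply/trivIsetP => i j _ _ ij; rewrite -subset0 => x [Bi Bj].
  have [hi _] := AM _ Bi; have [hj _] := AM _ Bj.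
  move: hi hj; rewrite !hw => hi hj; move/eqP: ij; apply.
  have : (i.+1%:R^-1 : R) = j.+1%:R^-1 by apply: (addrI (h x)); rewrite hi hj.
  by move=> /invr_inj/eqP; rewrite eqr_nat => /eqP[].
have BA k : lebesgue_rV n (B k) = lebesgue_rV n A by exact: lebesgue_rV_translate.
have mUB : measurable (\bigcup_k B k) by exact: bigcupT_measurable.
have fin : (lebesgue_rV n (\bigcup_k B k) < +oo)%E.
  apply: (@lebesgue_rV_bounded _ (M + `|w|)) => // x [k _ Bx].
  rewrite -[x](addrK (k.+1%:R^-1 *: w)) (le_trans (ler_normB _ _))// lerD ?M0//.
  rewrite normrZ ger0_norm ?invr_ge0// ler_piMl// invf_le1// ler1n.
  by [].
apply/eqP; rewrite eq_le measure_ge0 andbT leNgt; apply/negP => A0.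
have finA : (lebesgue_rV n A < +oo)%E by exact: lebesgue_rV_bounded M0.
have := measure_semi_bigcup (lebesgue_rV n) mB tB mUB.
rewrite (eq_eseriesr (fun k _ => BA k)) => E.
have Afin : lebesgue_rV n A \is a fin_num by rewrite ge0_fin_numE.
have Ufin : lebesgue_rV n (\bigcup_k B k) \is a fin_num by rewrite ge0_fin_numE.
have le_k (k : nat) : k%:R * fine (lebesgue_rV n A) <= fine (lebesgue_rV n (\bigcup_k B k)).
  rewrite -lee_fin fineK// E.
  rewrite (_ : (k%:R * _)%:E = (\sum_(0 <= i < k) lebesgue_rV n A)%E); last first.
    by rewrite -[in RHS](fineK Afin) sumEFin big_mkord sumr_const card_ord mulr_natl.
  exact: nneseries_lim_ge.
have a0 : 0 < fine (lebesgue_rV n A) by apply: fine_gt0; rewrite A0.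
pose t := fine (lebesgue_rV n (\bigcup_k B k)) / fine (lebesgue_rV n A).
have t0 : 0 <= t by rewrite divr_ge0// fine_ge0.
have := archi_boundP t0; rewrite ltNge => /negP; apply.
by rewrite ler_pdivlMr.
Qed.

End generators.

Lemma norm_le_coord {R : realType} m n (x : 'M[R]_(m, n)) c : 0 <= c ->
  (forall i j, `|x i j| <= c) -> `|x| <= c.
Proof.
move=> c0 xc; rewrite /Num.Def.normr/= mx_normrE; apply: bigmax_le => // -[i j] _; exact: xc.
Qed.

Section lipschitz_domain.
Context {R : realType} {p : nat} (Omega : set 'rV[R]_p).
Hypotheses (cO : compact Omega) (lO : lipschitz_boundary Omega).

(** [h] is the height above the graph in the rotated frame, and [w] the vertical direction pulled
    back, so [h] grows at unit speed along [w]. Near [xi] the domain is [0 <= h]; as [h] is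
    Lipschitz, a point with [0 < h] is interior, so [h] vanishes at boundary points. *)
Lemma boundary_graph (xi : 'rV[R]_p) : (Omega `\` Omega°) xi ->
  exists (h : 'rV[R]_p -> R) (w : 'rV[R]_p) (r : R),
    [/\ 0 < r, forall x t, h (x + t *: w) = h x + t &
        forall x, (Omega `\` Omega°) x -> ball xi r x -> h x = 0].
Proof.
have clO : closed Omega by exact: compact_closed.
move=> Bxi; have [|A [i [f [AAT [k lf] /nbhs_ballP[r /= r0 near_xi]]]]] := lO (_ : _ xi).
  by have /closure_id <- := clO.
pose h (x : 'rV[R]_p) : R := (x *m A) 0 i - f (col' i (x *m A)).
pose w : 'rV[R]_p := delta_mx 0 i *m A^T.
have wA : w *m A = delta_mx 0 i by rewrite /w -mulmxA (mulmx1C AAT) mulmx1.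
have hw x t : h (x + t *: w) = h x + t.
  rewrite /h mulmxDl -scalemxAl wA !mxE !eqxx mulr1.
  rewrite (_ : col' i _ = col' i (x *m A)); first by ring.
  apply/matrixP => a b; rewrite !mxE [lift _ _ == _]eq_sym (negbTE (neq_lift _ _)).
  by rewrite andbF mulr0 addr0.
pose C : R := \sum_a \sum_b `|A a b|.
have C0 : 0 <= C by apply: sumr_ge0 => a _; apply: sumr_ge0.
have AC (x y : 'rV[R]_p) b : `|(x *m A) 0 b - (y *m A) 0 b| <= C * `|x - y|.
  rewrite !mxE -sumrB (le_trans (ler_norm_sum _ _ _))// mulr_suml; apply: ler_sum => a _.
  rewrite -mulrBl normrM mulrC; apply: ler_pM => //.
    by rewrite (bigD1 b)//= lerDl sumr_ge0.
  by have := norm_coord_le (x - y) 0 a; rewrite !mxE.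
pose K := C + `|k| * C.
have K0 : 0 <= K by rewrite addr_ge0// mulr_ge0.
have hK x y : `|h x - h y| <= K * `|x - y|.
  rewrite /h (_ : _ - _ - _ = ((x *m A) 0 i - (y *m A) 0 i) -
    (f (col' i (x *m A)) - f (col' i (y *m A)))); last by ring.
  rewrite (le_trans (ler_normB _ _))// mulrDl; apply: lerD; first exact: AC.
  have := lf (col' i (x *m A), col' i (y *m A)) (conj I I) => /= /le_trans; apply.
  rewrite -mulrA (@le_trans _ _ (`|k| * `|col' i (x *m A) - col' i (y *m A)|))//.
    by rewrite ler_wpM2r// ler_norm.
  rewrite ler_wpM2l//; apply: norm_le_coord => [|a b]; first by rewrite mulr_ge0.
  by rewrite !mxE (ord1 a); have := AC x y (lift i b); rewrite !mxE.
have h_pos x : 0 < h x -> \forall y \near x, 0 < h y.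
  move=> hx; have d0 : 0 < h x / (K + 1) by rewrite divr_gt0// ltr_wpDl.
  apply/nbhs_ballP; exists (h x / (K + 1)) => // y.
  rewrite -ball_normE => xy; have {}xy : K * `|x - y| + `|x - y| < h x.
    by rewrite -[X in _ + X]mul1r -mulrDl mulrC -ltr_pdivlMr ?ltr_wpDl.
  have := hK x y; rewrite ler_norml => /andP[_].
  have d := normr_ge0 (x - y).
  move=> hxy; change (0 < h y); move: hxy xy d.
  move: (h x) (h y) (`|x - y|) => u v d'; lra.
exists h, w, r; split=> // x [Ox nOx] xix.
have [+ _] := near_xi _ xix; move=> /(_ Ox) hx0.
apply/eqP; rewrite eq_le -[in X in _ && X](subr_ge0 _) subr0.
rewrite [X in _ && X]subr_ge0 hx0 andbT leNgt; apply/negP => hx.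
apply: nOx; have xir : nbhs x (ball xi r).
  by apply: open_nbhs_nbhs; split=> //; exact: ball_open.
apply: filterS2 (h_pos x hx) xir => y hy xiy.
by have [_] := near_xi _ xiy; apply; rewrite -subr_ge0 ltW.
Qed.

Lemma lebesgue_boundary_null : lebesgue_rV p (Omega `\` Omega°) = 0%E.
Proof.
have clO : closed Omega by exact: compact_closed.
have clB : closed (Omega `\` Omega°).
  by rewrite setDE; apply: closedI => //; apply: open_closedC; exact: open_interior.
have cB : compact (Omega `\` Omega°) by apply: subclosed_compact cO _ => // x [].
have /choice[r rP] : forall xi, exists r : R, 0 < r /\ ((Omega `\` Omega°) xi ->
    lebesgue_rV p ((Omega `\` Omega°) `&` ball xi r) = 0%E).
  move=> xi; have [Bxi|] := pselect ((Omega `\` Omega°) xi); last by exists 1.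
  have [h [w [r [r0 hw hB]]]] := boundary_graph Bxi.
  exists r; split=> // _; apply: (lebesgue_rV_graph_null (M := `|xi| + r) hw).
    apply: measurableI; first exact: closed_measurable_rV.
    by apply: measurable_open_mx; exact: ball_open.
  move=> x [Bx xix]; split; first exact: hB.
  move: xix; rewrite -ball_normE/= => /ltW xix.
  by rewrite -[x](subrK xi) addrC (le_trans (ler_normD _ _))// lerD// distrC.
have cB' : cover_compact (Omega `\` Omega°) by rewrite -compact_cover.
have [||D' D'B cov] := cB' _ (Omega `\` Omega°) (fun z => ball z (r z)).
- by move=> z _; exact: ball_open.
- by move=> z Bz; exists z => //; apply: ballxx; have [] := rP z.
pose F k := if (k < size (enum_fset D'))%N then
  (Omega `\` Omega°) `&` ball (nth 0 (enum_fset D') k) (r (nth 0 (enum_fset D') k)) else set0.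
have : (lebesgue_rV p).-negligible (\bigcup_k F k).
  apply: negligible_bigcup => k; rewrite /F; case: ifP => [kD|_]; last exact: negligible_set0.
  apply/negligibleP.
    apply: measurableI; first exact: closed_measurable_rV.
    by apply: measurable_open_mx; exact: ball_open.
  have /D'B : nth 0 (enum_fset D') k \in D' by exact: mem_nth.
  by rewrite inE => BB; apply: (rP _).2.
move=> nF; apply/negligibleP; first exact: closed_measurable_rV.
apply: negligibleS nF => x Bx; have [c cD cx] := cov x Bx.
exists (index c (enum_fset D')) => //; rewrite /F index_mem (_ : c \in enum_fset D')// nth_index//.
Qed.

End lipschitz_domain.

(** * Test functions and the boundary trace *)

Section smooth_ramps.
Context {R : realType}.

(* Quadratic Taylor remainder: survives affine combinations and gives
   differentiability of [th \o coordinate] without differentiating [max]. *)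
Definition qsmooth (th th' : R -> R) := exists C : R, [/\ 0 <= C,
  forall t h, `|th (t + h) - th t - h * th' t| <= C * h ^+ 2 &
  forall t u, `|th' t - th' u| <= C * `|t - u|].

Lemma qsmoothD th1 th1' th2 th2' (a : R) : qsmooth th1 th1' -> qsmooth th2 th2' ->
  qsmooth (fun t => a * th1 t + th2 t) (fun t => a * th1' t + th2' t).
Proof.
move=> [C1 [C10 h1 l1]] [C2 [C20 h2 l2]]; exists (`|a| * C1 + C2); split.
- by rewrite addr_ge0// mulr_ge0.
- move=> t h; rewrite (_ : _ - _ - _ = a * (th1 (t + h) - th1 t - h * th1' t) +
    (th2 (t + h) - th2 t - h * th2' t)); last by ring.
  by rewrite (le_trans (ler_normD _ _))// mulrDl lerD// normrM -mulrA ler_wpM2l.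
- move=> t u; rewrite (_ : _ - _ = a * (th1' t - th1' u) + (th2' t - th2' u)); last by ring.
  by rewrite (le_trans (ler_normD _ _))// mulrDl lerD// normrM -mulrA ler_wpM2l.
Qed.

Lemma qsmooth_affine th th' (a b : R) : qsmooth th th' ->
  qsmooth (fun t => th (a * t + b)) (fun t => a * th' (a * t + b)).
Proof.
move=> [C [C0 h l]]; exists (C * a ^+ 2); split.
- by rewrite mulr_ge0// sqr_ge0.
- move=> t k; have := h (a * t + b) (a * k).
  rewrite (_ : a * t + b + a * k = a * (t + k) + b); last by ring.
  rewrite (_ : a * k * th' (a * t + b) = k * (a * th' (a * t + b))); last by ring.
  by rewrite (_ : C * (a * k) ^+ 2 = C * a ^+ 2 * k ^+ 2); last by ring.
- move=> t u; rewrite -mulrBr normrM; have := l (a * t + b) (a * u + b).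
  rewrite (_ : a * t + b - _ = a * (t - u)); last by ring.
  rewrite normrM => /(ler_wpM2l (normr_ge0 a))/le_trans; apply.
  by rewrite -[a ^+ 2]real_normK ?num_real// le_eqVlt; apply/orP; left; apply/eqP; ring.
Qed.

Definition sqpos (t : R) : R := Order.max t 0 ^+ 2 / 2.

Lemma qsmooth_sqpos : qsmooth sqpos (fun t => Order.max t 0).
Proof.
exists 1; split => // [t h|t u]; rewrite mul1r /sqpos ler_norml.
  by case: (leP t 0); case: (leP (t + h) 0) => *; apply/andP; split; nra.
have [tu|ut] := leP u t; [rewrite ger0_norm ?subr_ge0//|rewrite ltr0_norm ?subr_lt0//];
  by case: (leP t 0); case: (leP u 0) => *; apply/andP; split; lra.
Qed.

(** Quadratic spline from 0 to 1 on [0, 1]; its second derivative is 4 on the first half and -4 on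
    the second. *)
Definition smooth_step (t : R) : R :=
  4 * sqpos t - 8 * sqpos (t - 1 / 2) + 4 * sqpos (t - 1).
Definition smooth_step' (t : R) : R :=
  4 * Order.max t 0 - 8 * Order.max (t - 1 / 2) 0 + 4 * Order.max (t - 1) 0.
(** Antiderivative of the clamp [ramp]. In the direction of differentiation the test field uses the
    primitive, so that its divergence shows [ramp] itself. *)
Definition ramp_primitive (t : R) : R := sqpos t - sqpos (t - 1).
Definition ramp (t : R) : R := Order.max t 0 - Order.max (t - 1) 0.

Lemma qsmooth_step : qsmooth smooth_step smooth_step'.
Proof.
have h1 := qsmooth_affine 1 0 qsmooth_sqpos.
have h2 := qsmooth_affine 1 (- (1 / 2)) qsmooth_sqpos.
have h3 := qsmooth_affine 1 (- 1) qsmooth_sqpos.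
have h4 := qsmoothD 3 h3 h3.
have := qsmoothD 4 h1 (qsmoothD (-8) h2 h4).
by congr (qsmooth _ _); apply/funext => t;
  rewrite ?/smooth_step ?/smooth_step' !mul1r addr0; ring.
Qed.

Lemma qsmooth_ramp_primitive : qsmooth ramp_primitive ramp.
Proof.
have := qsmoothD (-1) (qsmooth_affine 1 (- 1) qsmooth_sqpos) (qsmooth_affine 1 0 qsmooth_sqpos).
by congr (qsmooth _ _); apply/funext => t;
  rewrite ?/ramp_primitive ?/ramp !mul1r addr0; ring.
Qed.

Lemma smooth_step_le0 t : t <= 0 -> smooth_step t = 0.
Proof.
by move=> t0; rewrite /smooth_step /sqpos !max_r; lra.
Qed.

Lemma smooth_step_ge1 t : 1 <= t -> smooth_step t = 1.
Proof. by move=> t1; rewrite /smooth_step /sqpos !max_l; try lra; field. Qed.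

Lemma smooth_step_itv t : 0 <= smooth_step t <= 1.
Proof.
rewrite /smooth_step /sqpos.
by case: (leP t 0); case: (leP (t - 1 / 2) 0); case: (leP (t - 1) 0) => *;
  apply/andP; split; nra.
Qed.

Lemma ramp_le0 t : t <= 0 -> ramp t = 0.
Proof. by move=> t0; rewrite /ramp !max_r ?subr0//; lra. Qed.

Lemma ramp_ge1 t : 1 <= t -> ramp t = 1.
Proof. by move=> t1; rewrite /ramp !max_l; try lra; ring. Qed.

Lemma ramp_itv t : 0 <= ramp t <= 1.
Proof.
by rewrite /ramp; case: (leP t 0); case: (leP (t - 1) 0) => *; apply/andP; split; lra.
Qed.

End smooth_ramps.

Section scalar_C1.
Context {R : realType} {p q : nat}.
Local Notation T := ('rV[R]_p * 'rV[R]_q)%type.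
Implicit Types (f g : T -> R) (df dg : T -> T -> R).

Definition coord_form (c : R) (j : 'I_p) (v : T) : R^o := c * v.1 0 j.

Lemma coord_form_linear c j : linear (coord_form c j).
Proof.
by move=> a u v; rewrite /coord_form /= !mxE /GRing.scale/= mulrDr mulrCA.
Qed.

HB.instance Definition _ c j := GRing.isLinear.Build R T R^o *:%R (coord_form c j)
  (coord_form_linear c j).

Lemma coord_norm_le (v : T) j : `|v.1 0 j| <= `|v|.
Proof. by rewrite (le_trans (norm_coord_le v.1 0 j))// /Num.Def.normr/= le_max lexx. Qed.

Lemma coord_form_continuous c j : continuous (coord_form c j).
Proof.
move=> v; apply: cvgM; first exact: cvg_cst.
by apply: (@continuous_comp _ _ _ fst (fun x : 'rV[R]_p => x 0 j)); [exact: cvg_fst|exact: coord_continuous].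
Qed.

(** Multipliers for test functions. The last clause says that [f] is constant along [D], so that
    [gradD] commutes with multiplication by [f]. *)
Definition scalar_C1 f df := (forall z, is_diff z (f : T -> R^o) (df z : T -> R^o)) /\
  (forall v, continuous (df ^~ v)) /\ forall z w, df z (0, w) = 0.

Lemma scalar_C1_coord th th' j : qsmooth th th' ->
  scalar_C1 (fun z => th (z.1 0 j)) (fun z v => th' (z.1 0 j) * v.1 0 j).
Proof.
move=> [C [C0 hth lth]]; split=> [z|]; last split.
- have E : (fun z : T => th (z.1 0 j) : R^o) \o shift z =
     cst (th (z.1 0 j) : R^o) + coord_form (th' (z.1 0 j)) j +o_ (0 : T) id.
    apply/eqaddoP => e e0; near=> v => /=.
    change (`|th ((v + z).1 0 j) - (th (z.1 0 j) + th' (z.1 0 j) * v.1 0 j)| <= e * `|v|).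
    rewrite (_ : (v + z).1 0 j = z.1 0 j + v.1 0 j); last by rewrite mxE addrC.
    rewrite opprD addrA [th' _ * _]mulrC.
    rewrite (le_trans (hth _ _))// -real_normK ?num_real// expr2 mulrA.
    apply: ler_pM => //; [exact: mulr_ge0| |exact: coord_norm_le].
    rewrite (le_trans (ler_wpM2l C0 (coord_norm_le v j)))//.
    near: v; apply/nbhs_ballP; exists (e / (C + 1)) => /=; first by rewrite divr_gt0// ltr_wpDl.
    move=> v; rewrite -ball_normE/= sub0r normrN ltr_pdivlMr ?ltr_wpDl// => vC.
    by have := normr_ge0 v; move: vC; move: `|v| => u; nra.
  have D := diff_unique (@coord_form_continuous (th' (z.1 0 j)) j) E.
  apply: DiffDef => //; apply/diff_locallyP; split; rewrite D => //.
  exact: coord_form_continuous.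
- move=> v z; apply: cvgM; last exact: cvg_cst.
  have th'c : continuous th'.
    move=> t; apply/cvgrPdist_lt => e e0; near=> u; apply: (le_lt_trans (lth t u)).
    have : `|t - u| < e / (C + 1).
      by near: u; apply: cvgr_dist_lt; rewrite ?divr_gt0// ltr_wpDl.
    by rewrite ltr_pdivlMr ?ltr_wpDl//; have := normr_ge0 (t - u); move: `|t - u| => d; nra.
  apply: (@continuous_comp _ _ _ (fun z : T => z.1 0 j) th'); last exact: th'c.
  by apply: (@continuous_comp _ _ _ fst (fun x : 'rV[R]_p => x 0 j)); [exact: cvg_fst|exact: coord_continuous].
- by move=> z w; rewrite /= mxE mulr0.
Unshelve. all: by end_near. Qed.

Lemma scalar_C1_continuous f df : scalar_C1 f df -> continuous f.
Proof. by move=> [h _] z; apply: differentiable_continuous; have [] := h z. Qed.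

Lemma scalar_C1_cst c : scalar_C1 (fun=> c) (fun _ _ => 0).
Proof.
split=> [z|]; first exact: is_diff_cst.
by split=> // v; exact: cst_continuous.
Qed.

Lemma scalar_C1M f df g dg : scalar_C1 f df -> scalar_C1 g dg ->
  scalar_C1 (fun z => f z * g z) (fun z v => f z * dg z v + g z * df z v).
Proof.
move=> fC gC; have cf := scalar_C1_continuous fC; have cg := scalar_C1_continuous gC.
case: fC => fd [fc f0]; case: gC => gd [gc g0]; split=> [z|].
  by have := @is_diffM _ _ f g (df z) (dg z) z (fd z) (gd z).
split=> [v z|z w]; last by rewrite f0 g0 !mulr0 addr0.
by apply: cvgD; apply: cvgM; [exact: cf|exact: gc|exact: cg|exact: fc].
Qed.

Lemma scalar_C1_1B f df : scalar_C1 f df -> scalar_C1 (fun z => 1 - f z) (fun z v => - df z v).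
Proof.
move=> fC; case: fC => fd [fc f0]; split=> [z|].
  have := @is_diffB _ _ _ (cst (1 : R^o)) f 0 (df z) z (is_diff_cst _ _) (fd z).
  by rewrite (_ : 0 - df z = (fun v => - df z v))//; apply/funext => v; rewrite /= fctE sub0r.
split=> [v z|z w]; last by rewrite f0 oppr0.
by apply: cvgN; exact: fc.
Qed.

(** The second conclusion is for a product whose factors are all stationary in a direction: no
    further information on the derivative is kept. *)
Lemma scalar_C1_prod (I : Type) (s : seq I) (F : I -> T -> R) (dF : I -> T -> T -> R) :
  (forall i, scalar_C1 (F i) (dF i)) ->
  exists df, scalar_C1 (fun z => \prod_(i <- s) F i z) df /\
    forall v, (forall i z, dF i z v = 0) -> forall z, df z v = 0.
Proof.
move=> FC; elim: s => [|i s [df [IH IHv]]].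
  exists (fun _ _ => 0); split=> //.
  rewrite (_ : (fun _ => _) = fun=> 1); first exact: scalar_C1_cst.
  by apply/funext => z; rewrite big_nil.
eexists; rewrite (_ : (fun _ => _) = fun z => F i z * \prod_(i <- s) F i z).
  split; first exact: scalar_C1M (FC i) IH.
  by move=> v h z /=; rewrite IHv// h !mulr0 addr0.
by apply/funext => z; rewrite big_cons.
Qed.

End scalar_C1.

(** * Borel sets of the product and iterated integrals *)

Section product_space.
Context {R : realType} {p q : nat}.
Local Notation T := ('rV[R]_p * 'rV[R]_q)%type.

Lemma rV_rational_near n (x : 'rV[R]_n) (e : R) : 0 < e ->
  exists r : 'rV[rat]_n, ball (map_mx (ratr : rat -> R) r) e x.
Proof.
move=> e0; have /choice[r rP] : forall i : 'I_n, exists r : rat, ball (x 0 i) e (ratr r).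
  move=> i; have := @dense_rat R (ball (x 0 i) e).
  case; [|exact: ball_open|by move=> _ [] /[swap] -[r _ <-]; exists r].
  by exists (x 0 i); exact: ballxx.
exists (\row_i r i); apply: ball_sym; split => // i j; rewrite !mxE (ord1 i); exact: rP.
Qed.

(** Second countability: an open set is a countable union of products of balls with rational
    centres. *)
Lemma measurable_open_prod (U : set T) : open U -> measurable U.
Proof.
move=> oU; pose B (z : 'rV[rat]_p * 'rV[rat]_q * nat) : set T :=
  ball (map_mx (ratr : rat -> R) z.1.1) (z.2.+1%:R^-1 : R) `*` ball (map_mx (ratr : rat -> R) z.1.2) (z.2.+1%:R^-1 : R).
pose B' z := if `[< B z `<=` U >] then B z else set0.
have -> : U = \bigcup_z B' z.
  apply/seteqP; split => [x Ux|x [z _]]; last first.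
    by rewrite /B'; case: asboolP => // zU /zU.
  have /nbhs_ballP[e /= e0 xeU] : nbhs x U by exact: open_nbhs_nbhs.
  have e20 : 0 < e / 2 by rewrite divr_gt0.
  have [k _ /(_ _ (leqnn _)) /= ke] := near_infty_natSinv_lt (PosNum e20).
  have k0 : 0 < (k.+1%:R^-1 : R) by rewrite invr_gt0.
  have [u ux] := rV_rational_near x.1 k0; have [v vx] := rV_rational_near x.2 k0.
  exists (u, v, k) => //; rewrite /B'; case: asboolP => // -[].
  move=> y [/= y1 y2]; apply: xeU; split => /=; rewrite (splitr e).
    by apply: ball_triangle (le_ball (ltW ke) y1); apply/ball_sym; exact: le_ball (ltW ke) _ ux.
  by apply: ball_triangle (le_ball (ltW ke) y2); apply/ball_sym; exact: le_ball (ltW ke) _ vx.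
apply: countable_bigcupT_measurable => [|z]; first exact: countableP.
rewrite /B'; case: ifP => _ //.
by apply: measurableX; apply: measurable_open_mx; exact: ball_open.
Qed.

Lemma within_continuous_measurable (A : set T) (f : T -> R) : measurable A ->
  {within A, continuous f} -> measurable_fun A f.
Proof.
move=> mA cf; apply: (measurability _ (RGenOpens.measurableE R)) => _ [_ [a [b ->] <-]].
have oU : open (f @^-1` `]a, b[ : set (subspace A)).
  by move/continuousP : cf; apply; exact: interval_open.
have [V oV VE] := (open_subspaceP _ _).1 oU.
by rewrite setIC -VE; apply: measurableI => //; exact: measurable_open_prod.
Qed.

End product_space.

Section map_integrals.
Context {R : realType} {p q : nat} (Omega : set 'rV[R]_p) (D : set 'rV[R]_q).
Hypotheses (cO : compact Omega) (cD : compact D) (O1 : lebesgue_rV p Omega = 1%E).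
Local Notation T := ('rV[R]_p * 'rV[R]_q)%type.

(** Replaces the iterated integral by an integral against one finite measure, for which linearity,
    monotonicity and convergence theorems are at hand. *)
Lemma map_integral_measure (mu : 'rV[R]_p -> probability 'rV[R]_q R) :
  (forall xi, Omega xi -> prob_on D (mu xi)) ->
  (forall A, measurable A -> measurable_fun Omega (fun xi => mu xi A)) ->
  exists M : {finite_measure set T -> \bar R},
    [/\ M setT = 1%E,
      forall A B, measurable A -> measurable B ->
        M (A `*` B) = (\int[lebesgue_rV p]_(xi in A `&` Omega) mu xi B)%E &
      forall f : T -> R, measurable_fun (Omega `*` D) f -> bounded_on (Omega `*` D) f ->
        map_integral Omega D mu f = \int[M]_(z in Omega `*` D) f z].
Proof.
move=> Dmu mmu; have mO : measurable Omega by exact: compact_measurable_rV.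
have mD : measurable D by exact: compact_measurable_rV.
have mOD : measurable (Omega `*` D) by exact: measurableX.
have O1y : (lebesgue_rV p Omega < +oo)%E by rewrite O1 ltry.
pose lam : {finite_measure set 'rV[R]_p -> \bar R} := mfrestr mO O1y.
(* Outside [Omega] the map is uncontrolled; a fixed value makes it a kernel on the whole space, and
   [lam] does not charge that region. *)
pose P xi := if xi \in Omega then mu xi else mu point.
have mP B : measurable B -> measurable_fun setT (fun xi => P xi B).
  move=> mB; rewrite (_ : (fun _ => _) =
      fun xi => if xi \in Omega then mu xi B else mu point B); last first.
    by apply/funext => xi; rewrite /P; case: ifP.
  apply: measurable_fun_if => //.
  - apply: (measurable_fun_bool true); rewrite setTI.
    by rewrite (_ : _ @^-1` _ = Omega)//; apply/seteqP; split=> x; [exact: set_mem|exact: mem_set].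
  - by rewrite setTI; rewrite (_ : _ @^-1` _ = Omega); [exact: mmu|apply/seteqP; split=> x; [exact: set_mem|exact: mem_set]].
have [M [ME Mint]] := total_measure lam mP.
have PT xi : P xi setT = 1%E by rewrite probability_setT.
exists M; split.
- rewrite ME// (eq_integral (cst 1%E)) => [|xi _].
    rewrite integral_cst// mul1e; transitivity (lebesgue_rV p (setT `&` Omega)); first by [].
    by rewrite setTI.
  rewrite (_ : xsection _ _ = setT) ?PT//.
  by apply/seteqP; split=> y _ //; rewrite /xsection/= inE.
- move=> A B mA mB; rewrite ME; last exact: measurableX.
  have -> : (\int[lam]_x P x (xsection (A `*` B) x) = \int[lam]_(x in A) P x B)%E.
    rewrite [RHS]integral_mkcond; apply: eq_integral => x _; rewrite patchE.
    by case: ifPn => xA; [rewrite in_xsectionX|rewrite notin_xsectionX// measure0].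
  transitivity (\int[lam]_(x in A `&` Omega) P x B)%E.
    rewrite [RHS]integral_mkcondr [LHS]integral_mkcond [RHS]integral_mkcond.
    have n0 : lebesgue_rV p ((~` Omega) `&` Omega) = 0%E by rewrite setICl measure0.
    apply: ae_eq_integral => //.
    + by rewrite -(measurable_restrictT _ mA); apply: measurable_funTS; exact: mP.
    + rewrite -(measurable_restrictT _ mA); apply: measurable_funTS.
      by rewrite -(measurable_restrictT _ mO); apply: measurable_funTS; exact: mP.
    + exists (~` Omega); split; [exact: measurableC|exact: n0|].
      move=> x /=; apply: contra_not => Ox _ /=; rewrite !patchE.
      by rewrite (mem_set Ox).
  transitivity (\int[lebesgue_rV p]_(x in A `&` Omega) P x B)%E.
    apply: eq_measure_integral => C mC CAO; transitivity (lebesgue_rV p (C `&` Omega)); first by [].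
    by congr (lebesgue_rV p _); apply/setIidPl => x /CAO[].
  by apply: eq_integral => x; rewrite inE => -[_ Ox]; rewrite /P mem_set.
- move=> f mf [C fC]; pose h := f \_ (Omega `*` D).
  have mh : measurable_fun setT h by rewrite -(measurable_restrictT _ mOD).
  have hC z : `|h z| <= `|C|.
    rewrite /h patchE; case: ifPn; last by rewrite normr0.
    by rewrite inE => /fC /le_trans; apply; exact: ler_norm.
  rewrite [RHS]Rintegral_mkcond (Mint h `|C| mh hC) /map_integral.
  rewrite (_ : (\int[lam]_x \int[P x]_y h (x, y)) =
      \int[lam]_(x in Omega) \int[P x]_y h (x, y)); last first.
    rewrite [RHS]Rintegral_mkcond; apply: eq_Rintegral => x _; rewrite patchE.
    case: ifPn => // /negP xO.
    transitivity (\int[P x]_(y in setT) (cst 0 y)); last by rewrite Rintegral_cst// mul0r.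
    apply: eq_Rintegral => y _.
    rewrite /h patchE; case: ifPn => //; rewrite inE => -[/= Ox _].
    by exfalso; apply: xO; rewrite inE.
  have -> : \int[lam]_(x in Omega) \int[P x]_y h (x, y) =
      \int[lebesgue_rV p]_(x in Omega) \int[P x]_y h (x, y).
    congr fine; apply: eq_measure_integral => A mA AO.
    transitivity (lebesgue_rV p (A `&` Omega)); first by [].
    by congr (lebesgue_rV p _); exact/setIidPl.
  apply: eq_Rintegral => x xO; rewrite /P xO [LHS]Rintegral_mkcond.
  apply: eq_Rintegral => y _; rewrite /h !patchE; congr (if _ then _ else _).
  by move: xO; rewrite inE => Ox; apply/idP/idP; rewrite !inE; [by move=> Dy; split|by case].
Qed.

End map_integrals.

(** * Operations on C1 test functions *)

Section vector_scaling.
Context {R : realType} {p : nat}.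

Definition scale_form (c : R^o) (x : 'rV[R]_p) : 'rV[R]_p := c *: x.

Lemma scale_form_bilinear : bilinear_for
  (GRing.Scale.Law.clone _ _ *:%R _) (GRing.Scale.Law.clone _ _ *:%R _) scale_form.
Proof.
split=> [u'|u] a x y; rewrite /scale_form /=.
- by rewrite scalerDl -scalerA.
- by rewrite scalerDr !scalerA mulrC.
Qed.

HB.instance Definition _ := bilinear_isBilinear.Build R R^o 'rV[R]_p 'rV[R]_p _ _ scale_form
  scale_form_bilinear.

Lemma scale_form_continuous : continuous (fun z : R^o * 'rV[R]_p => scale_form z.1 z.2).
Proof. by move=> z; apply: cvgZ; [exact: cvg_fst|exact: cvg_snd]. Qed.

Lemma is_diff_scale_form (V : normedModType R) (f df : V -> R^o) (g dg : V -> 'rV[R]_p) z :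
  is_diff z f df -> is_diff z g dg ->
  is_diff z (fun y => f y *: g y) (fun v => f z *: dg v + df v *: g z).
Proof.
move=> fd gd; have pd := is_diff_pair fd gd.
have sd : is_diff (f z, g z) (fun w : R^o * 'rV[R]_p => scale_form w.1 w.2)
    (fun w => scale_form (f z) w.2 + scale_form w.1 (g z)).
  apply: DiffDef; first by apply: differentiable_bilin; exact: scale_form_continuous.
  by rewrite diff_bilin//; exact: scale_form_continuous.
exact: (is_diff_comp pd sd).
Qed.

End vector_scaling.

Lemma within_continuous_sum {R : realType} {T : topologicalType} (A : set T) (I : Type)
    (r : seq I) (F : I -> T -> R) : (forall i, {within A, continuous (F i)}) ->
  {within A, continuous (fun z => \sum_(i <- r) F i z)}.
Proof.
move=> cF; elim: r => [|i r IH].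
  rewrite (_ : (fun _ => _) = fun=> 0); first by move=> z; exact: cvg_cst.
  by apply/funext => z; rewrite big_nil.
rewrite (_ : (fun _ => _) = fun z => F i z + \sum_(i <- r) F i z).
  by move=> z; apply: cvgD; [exact: cF|exact: IH].
by apply/funext => z; rewrite big_cons.
Qed.

Section C1_functions.
Context {R : realType} {p q : nat} (Omega : set 'rV[R]_p) (D : set 'rV[R]_q).
Local Notation T := ('rV[R]_p * 'rV[R]_q)%type.
Local Notation OD := (Omega `*` D).
Implicit Types (phi psi : C1 Omega D).

Lemma C1_continuous phi : {within OD, continuous phi}.
Proof. by case: phi. Qed.

Lemma C1_diff_continuous phi v : {within OD, continuous (c1_diff phi ^~ v)}.
Proof. by case: phi. Qed.

Lemma C1_is_diff phi z : OD° z -> is_diff z phi (c1_diff phi z).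
Proof. by case: phi => f df cf cdf h /h. Qed.

Lemma C1_cst (w : 'rV[R]_p) : exists psi,
  (forall z, psi z = w) /\ forall z v, c1_diff psi z v = 0.
Proof.
have H1 : {within OD, continuous (fun=> w)} by move=> z; exact: cvg_cst.
have H2 (v : T) : {within OD, continuous ((fun _ _ => 0 : 'rV[R]_p) ^~ v)}.
  by move=> z; exact: cvg_cst.
have H3 z : OD° z -> is_diff z (fun=> w) ((fun _ _ => 0 : 'rV[R]_p) z).
  by move=> _; exact: is_diff_cst.
by exists (MkC1 H1 H2 H3).
Qed.

Lemma C1_lin phi psi (a : R) : exists chi : C1 Omega D,
  (forall z, chi z = a *: phi z + psi z) /\
  forall z v, c1_diff chi z v = a *: c1_diff phi z v + c1_diff psi z v.
Proof.
have H1 : {within OD, continuous (fun z => a *: phi z + psi z)}.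
  move=> z; apply: cvgD; last exact: C1_continuous.
  by apply: cvgZ; [exact: cvg_cst|exact: C1_continuous].
pose d z v := a *: c1_diff phi z v + c1_diff psi z v.
have H2 v : {within OD, continuous (d ^~ v)}.
  move=> z; apply: cvgD; last exact: C1_diff_continuous.
  by apply: cvgZ; [exact: cvg_cst|exact: C1_diff_continuous].
have H3 z : OD° z -> is_diff z (fun z => a *: phi z + psi z) (d z).
  move=> ODz; have h1 := C1_is_diff phi ODz; have h2 := C1_is_diff psi ODz.
  exact: (is_diffD (is_diffZ a h1) h2).
by exists (MkC1 H1 H2 H3).
Qed.

Lemma C1_scale phi f df : scalar_C1 f df -> exists psi,
  (forall z, psi z = f z *: phi z) /\
  forall z v, c1_diff psi z v = f z *: c1_diff phi z v + df z v *: phi z.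
Proof.
move=> fC; have cf := scalar_C1_continuous fC; case: fC => fd [fc _].
have cf' : {within OD, continuous f} by exact: continuous_subspaceT.
have H1 : {within OD, continuous (fun z => f z *: phi z)}.
  by move=> z; apply: cvgZ; [exact: cf'|exact: C1_continuous].
pose d z v := f z *: c1_diff phi z v + df z v *: phi z.
have H2 v : {within OD, continuous (d ^~ v)}.
  have fc' : {within OD, continuous (df ^~ v)} by exact: continuous_subspaceT.
  move=> z; apply: cvgD; apply: cvgZ.
  - exact: cf'.
  - exact: C1_diff_continuous.
  - exact: fc'.
  - exact: C1_continuous.
have H3 z : OD° z -> is_diff z (fun z => f z *: phi z) (d z).
  by move=> ODz; exact: (is_diff_scale_form (fd z) (C1_is_diff phi ODz)).
by exists (MkC1 H1 H2 H3).
Qed.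

Lemma entry_continuous m n (b : T -> 'M[R]_(m, n)) a i :
  {within OD, continuous b} -> {within OD, continuous (fun z => b z a i)}.
Proof.
move=> cb z; apply: (@continuous_comp (subspace OD) _ _ b (fun M : 'M[R]_(m, n) => M a i)).
  exact: cb.
exact: coord_continuous.
Qed.

Lemma divO_continuous phi : {within OD, continuous (divO phi)}.
Proof.
apply: within_continuous_sum => a.
have h := @entry_continuous _ _ _ 0 a (@C1_diff_continuous phi (delta_mx 0 a, 0)).
exact: h.
Qed.

Lemma gradD_entry_continuous phi a i : {within OD, continuous (fun z => gradD phi z a i)}.
Proof.
under eq_fun do rewrite mxE.
exact: (@entry_continuous _ _ _ 0 a (@C1_diff_continuous phi _)).
Qed.

Lemma matrix_continuous m n (b : T -> 'M[R]_(m, n)) :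
  (forall a i, {within OD, continuous (fun z => b z a i)}) -> {within OD, continuous b}.
Proof.
move=> cb z; apply/cvg_ballP => e e0.
have H : \forall y \near (z : subspace OD), forall (k : 'I_m * 'I_n), ball (b z k.1 k.2) e (b y k.1 k.2).
  by apply: filter_forall => -[a i]; exact: (cvg_ball (cb a i z) e0).
by apply: filterS H => y h; split => // a i; exact: (h (a, i)).
Qed.

Lemma sqnorm_continuous (b : T -> 'M[R]_(p, q)) :
  {within OD, continuous b} -> {within OD, continuous (fun z => sqnorm (b z))}.
Proof.
move=> cb; apply: within_continuous_sum => a; apply: within_continuous_sum => i z.
have h := @entry_continuous _ _ _ a i cb.
by rewrite (_ : (fun _ => _) = fun z => b z a i * b z a i);
  [apply: cvgM; exact: h|apply/funext => y; rewrite expr2].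
Qed.

End C1_functions.

(** * Cutoff functions supported in the interior of the domain *)

Section cutoff.
Context {R : realType} {p q : nat} (Omega : set 'rV[R]_p).
Local Notation T := ('rV[R]_p * 'rV[R]_q)%type.
Hypothesis cO : compact Omega.

Lemma rV_box_compact n (a b : 'rV[R]_n) : compact (rV_box a b).
Proof.
apply: bounded_closed_compact.
  exists (\sum_i (`|a 0 i| + `|b 0 i|)); split; first exact: num_real.
  move=> M hM x ax; apply: le_trans (ltW hM); apply: norm_le_coord => [|k i].
    by apply: sumr_ge0 => i _; exact: addr_ge0.
  rewrite (ord1 k) (bigD1 i)//= (@le_trans _ _ (`|a 0 i| + `|b 0 i|))//; last first.
    by rewrite lerDl; apply: sumr_ge0 => j _; exact: addr_ge0.
  have /andP[h1 h2] := ax i; rewrite ler_norml.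
  have := ler_norm (b 0 i); have := ler_norm (- a 0 i); rewrite normrN => h3 h4.
  have := normr_ge0 (a 0 i); have := normr_ge0 (b 0 i) => h5 h6.
  by apply/andP; split; lra.
rewrite (_ : rV_box a b = \bigcap_(i in [set: 'I_n]) ((fun x : 'rV[R]_n => x 0 i) @^-1` `[a 0 i, b 0 i])).
  apply: closed_bigI => i _; apply: closed_comp; first by move=> x _; exact: coord_continuous.
  exact: interval_closed.
by apply/seteqP; split=> x h i; [move=> _ /=|]; have := h i; rewrite /= ?in_itv//=; apply.
Qed.

(** Tensor product of steps [smooth_step (2 +- (2 / r) (x_i - c_i))], one for each coordinate and
    sign: the argument is at least 1 for [|x_i - c_i| <= r / 2], and for one of the signs at most 0
    once [|x_i - c_i| >= r]. *)
Lemma bump (c : 'rV[R]_p) (r : R) : 0 < r -> exists (f : T -> R) (df : T -> T -> R),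
  [/\ scalar_C1 f df, forall z, 0 <= f z <= 1,
      forall z, ball c (r / 2) z.1 -> f z = 1 &
      forall z, f z != 0 -> rV_box (c - const_mx r) (c + const_mx r) z.1].
Proof.
move=> r0; pose F (i : 'I_p * bool) (z : T) := smooth_step
  ((if i.2 then - (2 / r) else 2 / r) * z.1 0 i.1 + (2 - (if i.2 then - (2 / r) else 2 / r) * c 0 i.1)).
have FE (i : 'I_p * bool) z : F i z = smooth_step (2 + (if i.2 then -1 else 1) * (2 / r) * (z.1 0 i.1 - c 0 i.1)).
  by rewrite /F; congr smooth_step; case: i.2; ring.
have FC i := scalar_C1_coord (q := q) i.1
  (qsmooth_affine (if i.2 then - (2 / r) else 2 / r)
    (2 - (if i.2 then - (2 / r) else 2 / r) * c 0 i.1) (@qsmooth_step R)).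
have [df [fC _]] := scalar_C1_prod (index_enum ('I_p * bool)%type) FC.
exists (fun z => \prod_i F i z), df; split.
- exact: fC.
- have F01 i z : 0 <= F i z <= 1 by exact: smooth_step_itv.
  move=> z; apply/andP; split; last by apply: prodr_ile1 => i _; exact: F01.
  by apply: prodr_ge0 => i _; have /andP[] := F01 i z.
- move=> z [_ cz]; apply: big1 => -[j u] _; rewrite FE /=; apply: smooth_step_ge1.
  have := cz 0 j; rewrite /ball/= ltr_norml => /andP[h1 h2].
  have r1 : r / 2 * (2 / r) = 1 by field; rewrite gt_eqF.
  have r2 : 0 < 2 / r by rewrite divr_gt0.
  by case: u; nra.
- move=> z fz j; rewrite !mxE; move: fz; rewrite -ler_distl.
  apply: contraR; rewrite -ltNge => h; apply/eqP.
  pose u : bool := 0 < z.1 0 j - c 0 j.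
  rewrite (bigD1 (j, u))//= FE /= smooth_step_le0 ?mul0r//.
  have r1 : r * (2 / r) = 2 by field; rewrite gt_eqF.
  have r2 : 0 < 2 / r by rewrite divr_gt0.
  have [s|s] := boolP u; first by rewrite gtr0_norm// in h; nra.
  by rewrite ler0_norm ?leNgt// in h; nra.
Qed.

(** [1 - \prod (1 - f c)] is a smooth substitute for the maximum of finitely many bumps: it is 1
    where one of them is 1, and 0 where all of them vanish. *)
Lemma cutoff (K : set 'rV[R]_p) : compact K -> K `<=` Omega° ->
  exists (f : T -> R) (df : T -> T -> R) (X : set 'rV[R]_p),
  [/\ scalar_C1 f df, forall z, 0 <= f z <= 1, forall z, K z.1 -> f z = 1,
      compact X /\ X `<=` Omega° & forall z, f z != 0 -> X z.1].
Proof.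
move=> cK KO.
have /choice[r rP] : forall c, exists r : R, 0 < r /\ (K c -> ball c r `<=` Omega°).
  move=> c; have [Kc|] := pselect (K c); last by exists 1.
  have /nbhs_ballP[r r0 h] : nbhs c Omega°.
    by apply: open_nbhs_nbhs; split; [exact: open_interior|exact: KO].
  by exists r.
have r20 c : 0 < r c / 2 by rewrite divr_gt0//; have [] := rP c.
have r40 c : 0 < r c / 2 / 2 by rewrite divr_gt0.
have /choice[f /choice[df fP]] := fun c => bump c (r20 c).
have cK' : cover_compact K by rewrite -compact_cover.
have [||D' D'K cov] := cK' _ K (fun c => ball c (r c / 2 / 2)).
- by move=> z _; exact: ball_open.
- by move=> z Kz; exists z => //; exact: ballxx.
pose s := enum_fset D'.
have [dF [FC _]] := scalar_C1_prod s (fun c => scalar_C1_1B (let: And4 h _ _ _ := fP c in h)).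
exists (fun z => 1 - \prod_(c <- s) (1 - f c z)), (fun z v => - dF z v).
exists (\big[setU/set0]_(c <- s) rV_box (c - const_mx (r c / 2)) (c + const_mx (r c / 2))).
have f01 c z : 0 <= 1 - f c z <= 1.
  by have [_ /(_ z)/andP[h1 h2] _ _] := fP c; apply/andP; split; lra.
have P01 z : 0 <= \prod_(c <- s) (1 - f c z) <= 1.
  apply/andP; split; first by apply: prodr_ge0 => c _; have /andP[] := f01 c z.
  by apply: prodr_ile1 => c _; exact: f01.
split.
- exact: scalar_C1_1B FC.
- by move=> z; have /andP[h1 h2] := P01 z; apply/andP; split; lra.
- move=> z Kz; have [c cs cz] := cov _ Kz.
  rewrite (big_rem c)//=; have [_ _ /(_ _ cz) -> _] := fP c.
  by rewrite subrr mul0r subr0.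
- split.
    elim/big_ind : _ => [|A B cA cB|c _]; [exact: compact0|exact: compactU|exact: rV_box_compact].
  rewrite -bigcup_seq; apply: bigcup_sub => c cs x xc.
  have Kc : K c by have := D'K c cs; rewrite inE.
  apply: (rP c).2 => //; split; first by have [] := rP c.
  move=> i j; have := xc j; rewrite (ord1 i) !mxE -ler_distl distrC.
  rewrite /ball/= => /le_lt_trans; apply.
  by rewrite ltr_pdivrMr// ltr_pMr ?ltr1n//; have [] := rP c.
- move=> z fz; apply: contrapT => nX; move/eqP: fz; apply.
  rewrite big1_seq ?subrr// => c /= cs; have [_ _ _ /(_ z) h] := fP c.
  have [->|/h xc] := eqVneq (f c z) 0; first by rewrite subr0.
  by exfalso; apply: nX; rewrite -bigcup_seq; exists c.
Qed.

End cutoff.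

(* Neither row vectors nor their products are pointed pseudometric spaces in
   the library; these aliases are. *)
Definition prod_rV (R : realType) p q := ('rV[R]_p * 'rV[R]_q)%type.
HB.instance Definition _ (R : realType) p q := Pointed.on (prod_rV R p q).
HB.instance Definition _ (R : realType) p q := PseudoMetric.on (prod_rV R p q).

Definition single_rV (R : realType) n := 'rV[R]_n.
HB.instance Definition _ (R : realType) n := Pointed.on (single_rV R n).
HB.instance Definition _ (R : realType) n := PseudoMetric.on (single_rV R n).

(** * The boundary trace and its independence of [E] *)

Section boundary_trace.
Context {R : realType} {p q : nat} (Omega : set 'rV[R]_p) (D : set 'rV[R]_q).
Local Notation T := ('rV[R]_p * 'rV[R]_q)%type.
Local Notation OD := (Omega `*` D).
Hypotheses (cO : compact Omega) (cD : compact D).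
Implicit Types (phi psi : C1 Omega D) (E : 'I_p -> 'I_q -> {charge set T -> \bar R})
  (b : T -> 'M[R]_(p, q)) (f g : T -> R).

Let mO : measurable Omega. Proof. exact: compact_measurable_rV. Qed.
Let mD : measurable D. Proof. exact: compact_measurable_rV. Qed.

Lemma measurable_OD : measurable OD. Proof. exact: measurableX. Qed.

Lemma compact_OD : compact OD. Proof. exact: compact_setX. Qed.

Lemma continuous_nice f : {within OD, continuous f} ->
  measurable_fun OD f /\ bounded_on OD f.
Proof.
move=> cf; split; first exact: within_continuous_measurable measurable_OD cf.
exact: (@compact_bounded_fun R (prod_rV R p q) _ _ compact_OD cf).
Qed.

Lemma continuous_integrable (m : {finite_measure set T -> \bar R}) f :
  {within OD, continuous f} -> m.-integrable OD (EFin \o f).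
Proof.
by move=> /continuous_nice[mf [M fM]]; exact: bounded_integrable measurable_OD mf fM.
Qed.

Lemma Rintegral_linear (m : {finite_measure set T -> \bar R}) f g (a : R) :
  {within OD, continuous f} -> {within OD, continuous g} ->
  \int[m]_(z in OD) (a * f z + g z) = a * \int[m]_(z in OD) f z + \int[m]_(z in OD) g z.
Proof.
move=> cf cg; have iF := continuous_integrable m cf; have iG := continuous_integrable m cg.
rewrite RintegralD ?RintegralZl//; try exact: measurable_OD.
by apply: continuous_integrable => z; apply: cvgM; [exact: cvg_cst|exact: cf].
Qed.

Lemma charge_integral_linear (nu : {charge set T -> \bar R}) f g (a : R) :
  {within OD, continuous f} -> {within OD, continuous g} ->
  charge_integral nu OD (fun z => a * f z + g z) =
  a * charge_integral nu OD f + charge_integral nu OD g.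
Proof.
move=> cf cg; have [m1 [m2 [_ nuE]]] := charge_integral_jordan nu.
by rewrite !nuE !Rintegral_linear//; ring.
Qed.

Lemma eq_charge_integral (nu : {charge set T -> \bar R}) f g :
  (forall z, OD z -> f z = g z) -> charge_integral nu OD f = charge_integral nu OD g.
Proof.
move=> fg; rewrite /charge_integral; congr (_ - _); apply: eq_Rintegral => z;
  by rewrite inE; exact: fg.
Qed.

Lemma eq_vmeasure_integral E b b' : (forall z, OD z -> b z = b' z) ->
  vmeasure_integral Omega D E b = vmeasure_integral Omega D E b'.
Proof.
move=> bb'; apply: eq_bigr => a _; apply: eq_bigr => i _.
by apply: eq_charge_integral => z /bb' ->.
Qed.

Lemma vmeasure_integral_linear E b b' (a : R) :
  {within OD, continuous b} -> {within OD, continuous b'} ->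
  vmeasure_integral Omega D E (fun z => a *: b z + b' z) =
  a * vmeasure_integral Omega D E b + vmeasure_integral Omega D E b'.
Proof.
move=> cb cb'; rewrite /vmeasure_integral mulr_sumr -big_split /=; apply: eq_bigr => k _.
rewrite mulr_sumr -big_split /=; apply: eq_bigr => i _.
rewrite -charge_integral_linear; [|exact: entry_continuous|exact: entry_continuous].
by apply: eq_charge_integral => z _; rewrite !mxE.
Qed.

Lemma vmeasure_integral0 E : vmeasure_integral Omega D E (fun=> 0) = 0.
Proof.
have cz : {within OD, continuous (fun=> 0 : 'M[R]_(p, q))} by move=> z; exact: cvg_cst.
have := vmeasure_integral_linear E (-1) cz cz.
rewrite (_ : (fun _ => _) = fun=> 0) => [h|]; first by lra.
by apply/funext => z; rewrite scaler0 addr0.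
Qed.

Lemma gradD_continuous phi : {within OD, continuous (gradD phi)}.
Proof. by apply: matrix_continuous => a i; exact: gradD_entry_continuous. Qed.

Section fixed_map.
Hypotheses (O1 : lebesgue_rV p Omega = 1%E) (lO : lipschitz_boundary Omega).
Variables (mu : 'rV[R]_p -> probability 'rV[R]_q R) (muL : L2map Omega D mu).

Lemma L2map_integral_measure : exists M : {finite_measure set T -> \bar R},
    [/\ M setT = 1%E,
      forall A B, measurable A -> measurable B ->
        M (A `*` B) = (\int[lebesgue_rV p]_(xi in A `&` Omega) mu xi B)%E &
      forall f, measurable_fun OD f -> bounded_on OD f ->
        map_integral Omega D mu f = \int[M]_(z in OD) f z].
Proof.
apply: map_integral_measure => //; first exact: muL.1.
exact: L2map_kernel cO cD muL.
Qed.

(** The supremum is tested with the largest [a] allowed for a given [b], namely [- |b|^2 / 2]. *)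
Lemma Dir2_bound E : (Dir2 Omega D mu E < +oo)%E -> exists2 C : R, 0 <= C &
  forall b, {within OD, continuous b} -> vmeasure_integral Omega D E b <=
    C + map_integral Omega D mu (fun z => sqnorm (b z) / 2).
Proof.
move=> Efin; have [M [M1 _ Mint]] := L2map_integral_measure.
have le_Dir b : {within OD, continuous b} ->
    ((map_integral Omega D mu (fun z => - (sqnorm (b z) / 2)) +
     vmeasure_integral Omega D E b)%:E <= Dir2 Omega D mu E)%E.
  move=> cb; apply: ereal_sup_ubound.
  exists (fun z => - (sqnorm (b z) / 2)), b; split=> //.
  - have cs := sqnorm_continuous cb.
    by move=> z; apply: cvgN; apply: cvgM; [exact: cs|exact: cvg_cst].
  - by move=> z _; rewrite addNr.
have D0 : (Dir2 Omega D mu E)%E \is a fin_num.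
  rewrite fin_numElt Efin andbT.
  have c0 : {within OD, continuous (fun=> 0 : 'M[R]_(p, q))} by move=> z; exact: cvg_cst.
  by apply: lt_le_trans (le_Dir _ c0); rewrite ltNyr.
exists `|fine (Dir2 Omega D mu E)| => // b cb.
have := le_Dir b cb; rewrite -(fineK D0) lee_fin.
have cs : {within OD, continuous (fun z => sqnorm (b z) / 2)}.
  have cs := sqnorm_continuous cb.
  by move=> z; apply: cvgM; [exact: cs|exact: cvg_cst].
have [ms bs] := continuous_nice cs.
have cz : {within OD, continuous (fun=> 0 : R)} by move=> z; exact: cvg_cst.
have Neq : (fun z => - (sqnorm (b z) / 2)) = (fun z => -1 * (sqnorm (b z) / 2) + 0).
  by apply/funext => z; rewrite mulN1r addr0.
have cN : {within OD, continuous (fun z => -1 * (sqnorm (b z) / 2) + 0)}.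
  by move=> z; apply: cvgD; [apply: cvgM; [exact: cvg_cst|exact: cs]|exact: cvg_cst].
have [mN bN] := continuous_nice cN.
rewrite Neq (Mint _ mN bN) (Mint _ ms bs) Rintegral_linear//.
have -> : \int[M]_(z in OD) 0 = 0 by rewrite Rintegral_cst ?mul0r//; exact: measurable_OD.
have := ler_norm (fine (Dir2 Omega D mu E)).
move: (\int[M]_(z in OD) _) (vmeasure_integral _ _ _ _) => u v; lra.
Qed.

(** Points at distance at least [1/(n+1)] from the complement form compact sets increasing to the
    interior, which has full measure since the boundary is null. *)
Lemma inner_exhaustion (e : R) : 0 < e -> exists K : set 'rV[R]_p,
  [/\ compact K, K `<=` Omega° & fine (lebesgue_rV p (Omega `\` K)) <= e].
Proof.
move=> e0; pose K (n : nat) := ~` \bigcup_(y in ~` Omega) ball y (n.+1%:R^-1 : R).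
have n0 n : 0 < (n.+1%:R^-1 : R) by rewrite invr_gt0.
have clK n : closed (K n).
  by apply: open_closedC; apply: bigcup_open => y _; exact: ball_open.
have KO n : K n `<=` Omega°.
  move=> x Kx; apply/nbhs_ballP; exists (n.+1%:R^-1 : R) => //= y xy.
  by apply: contrapT => nOy; apply: Kx; exists y => //; exact: ball_sym.
have cK n : compact (K n).
  by apply: subclosed_compact cO _ => //; move=> x /KO /interior_subset.
have ndK : nondecreasing_seq K.
  move=> m n mn; apply/subsetPset => x Gx [y nGy yx]; apply: Gx; exists y => //.
  by apply: le_ball yx; rewrite lef_pV2 ?posrE// ler_nat.
have UK : \bigcup_n K n = Omega°.
  apply/seteqP; split=> [x [n _ /KO//]|x /nbhs_ballP[r /= r0 xr]].
  have [n _ /(_ _ (leqnn _)) /= ne] := near_infty_natSinv_lt (PosNum r0).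
  exists n => // -[y nGy yx]; apply: nGy; apply: xr; apply: ball_sym.
  by apply: le_ball yx; exact: ltW.
have mK n : measurable (K n) by exact: closed_measurable_rV.
have mOi : measurable Omega° by apply: measurable_open_mx; exact: open_interior.
have Oi1 : lebesgue_rV p Omega° = 1%E.
  have h : lebesgue_rV p Omega =
      (lebesgue_rV p (Omega `\` Omega°) + lebesgue_rV p (Omega `&` Omega°))%E.
    exact: measureDI.
  rewrite O1 (lebesgue_boundary_null cO lO) add0e (setIidr (@interior_subset _ _)) in h.
  by rewrite -h.
have cvgK : lebesgue_rV p (K n) @[n --> \oo] --> lebesgue_rV p Omega°.
  rewrite -UK; apply: nondecreasing_cvg_mu => //; exact: bigcupT_measurable.
have [n hn] : exists n, ((1 - e)%:E < lebesgue_rV p (K n))%E.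
  apply: contrapT => /forallNP h.
  have : (lebesgue_rV p Omega° <= (1 - e)%:E)%E.
    rewrite -(cvg_lim _ cvgK)//; apply: lime_le; first by apply/cvg_ex; eexists; exact: cvgK.
    by apply: nearW => n; rewrite leNgt; apply/negP; exact: h.
  by rewrite Oi1 lee_fin lerBrDr gerDl leNgt e0.
exists (K n); split=> //.
have E1 : lebesgue_rV p Omega =
    (lebesgue_rV p (Omega `\` K n) + lebesgue_rV p (Omega `&` K n))%E.
  exact: measureDI.
rewrite O1 setIidr in E1; last by move=> x /KO /interior_subset.
have Kfin : lebesgue_rV p (K n) \is a fin_num.
  rewrite ge0_fin_numE// (le_lt_trans _ (ltry 1))// -O1.
  by apply: le_measure; rewrite ?inE// => x /KO /interior_subset.
have Dfin : lebesgue_rV p (Omega `\` K n) \is a fin_num.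
  rewrite ge0_fin_numE// (le_lt_trans _ (ltry 1))// -O1.
  by apply: le_measure; rewrite ?inE//; exact: measurableD.
move: E1 hn; rewrite -(fineK Kfin) -(fineK Dfin) -EFinD lte_fin => -[/= E1] hn.
by move: E1 hn; rewrite /=; lra.
Qed.

(** [Dir2_bound] applied to [+- t (1 - f) gradD phi], which vanishes over [K], gives
    [t |I| <= C + t^2 N |Omega \ K| / 2] for the integral [I]. A large [t] absorbs [C], and then a
    small remainder absorbs the quadratic term. *)
Lemma vmeasure_cutoff_small E phi (e : R) : (Dir2 Omega D mu E < +oo)%E -> 0 < e ->
  exists2 d : R, 0 < d & forall K f df, compact K -> fine (lebesgue_rV p (Omega `\` K)) <= d ->
    scalar_C1 (f : T -> R) df -> (forall z, 0 <= f z <= 1) -> (forall z, K z.1 -> f z = 1) ->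
    `|vmeasure_integral Omega D E (fun z => (1 - f z) *: gradD phi z)| <= e.
Proof.
move=> Efin e0; have [C C0 hC] := Dir2_bound Efin.
have [M [M1 Mmarg Mint]] := L2map_integral_measure.
have [_ [N hN]] := continuous_nice (sqnorm_continuous (@gradD_continuous phi)).
(* With this [t] the target [t e] equals [2 (C + 1)], and the radius [e / (t N1)] below makes the
   quadratic term [t e / 2 = C + 1]. *)
pose t : R := 2 * (C + 1) / e.
have t0 : 0 < t by rewrite divr_gt0// mulr_gt0// ltr_wpDl.
pose N1 := `|N| + 1; have N10 : 0 < N1 by rewrite ltr_wpDl.
exists (e / (t * N1)); first by rewrite divr_gt0// mulr_gt0.
move=> K f df cK Kd fC f01 fK.
pose b z := (1 - f z) *: gradD phi z.
have cf : {within OD, continuous f} by apply: continuous_subspaceT; exact: scalar_C1_continuous fC.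
have cb : {within OD, continuous b}.
  move=> z; apply: cvgZ; last exact: gradD_continuous.
  by apply: cvgB; [exact: cvg_cst|exact: cf].
have cz : {within OD, continuous (fun=> 0 : 'M[R]_(p, q))} by move=> z; exact: cvg_cst.
suff key s : s = t \/ s = - t -> s * vmeasure_integral Omega D E b <= t * e.
  have h1 := key t (or_introl erefl); have h2 := key (- t) (or_intror erefl).
  rewrite ler_norml; apply/andP; split.
    by rewrite -(ler_pM2l t0) mulrN lerNl -mulNr.
  by rewrite -(ler_pM2l t0).
move=> st; have s2 : s ^+ 2 = t ^+ 2 by case: st => ->; rewrite ?sqrrN.
have csb : {within OD, continuous (fun z => s *: b z + 0)}.
  by move=> z; apply: cvgD; [apply: cvgZ; [exact: cvg_cst|exact: cb]|exact: cvg_cst].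
have := hC _ csb; rewrite (vmeasure_integral_linear E s cb cz) vmeasure_integral0 addr0 => /le_trans; apply.
have ct : {within OD, continuous (fun z => sqnorm (s *: b z + 0) / 2)}.
  have cs := sqnorm_continuous csb.
  by move=> z; apply: cvgM; [exact: cs|exact: cvg_cst].
have [mt bt] := continuous_nice ct.
have mK : measurable K by exact: compact_measurable_rV.
have mOK : measurable (Omega `\` K) by exact: measurableD.
pose c := t ^+ 2 * N1 / 2.
have c0 : 0 <= c by rewrite divr_ge0// mulr_ge0// ?sqr_ge0// ltW.
have mi : measurable ((Omega `\` K) `*` [set: 'rV[R]_q]) by exact: measurableX.
have bnd z : OD z -> sqnorm (s *: b z + 0) / 2 <= c * \1_((Omega `\` K) `*` [set: 'rV[R]_q]) z.
  move=> ODz; rewrite addr0.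
  have sq : sqnorm (s *: b z) = t ^+ 2 * (1 - f z) ^+ 2 * sqnorm (gradD phi z).
    rewrite -s2 /sqnorm mulr_sumr; apply: eq_bigr => a _; rewrite mulr_sumr.
    by apply: eq_bigr => i _; rewrite !mxE; ring.
  rewrite sq indicE; have [_|] := boolP (z \in _).
    rewrite mulr1 /c ler_pM2r// ler_pM//.
    - by rewrite mulr_ge0// sqr_ge0.
    - by apply: sumr_ge0 => a _; apply: sumr_ge0 => i _; exact: sqr_ge0.
    - rewrite ler_piMr ?sqr_ge0//; have /andP[h1 h2] := f01 z.
      by rewrite expr_le1//; lra.
    - have := hN z ODz; have := ler_norm (sqnorm (gradD phi z)); have := ler_norm N.
      by rewrite /N1; lra.
  move=> /negP zK; rewrite fK ?subrr ?expr0n/= ?mulr0 ?mul0r//.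
  by apply: contrapT => nK; apply: zK; rewrite inE; split=> //; split=> //; case: ODz.
rewrite (Mint _ mt bt).
have : \int[M]_(z in OD) (sqnorm (s *: b z + 0) / 2) <= c * fine (lebesgue_rV p (Omega `\` K)).
  apply: (@le_trans _ _ (\int[M]_(z in OD) (c * \1_((Omega `\` K) `*` [set: 'rV[R]_q]) z))).
    apply: le_Rintegral; [exact: measurable_OD|exact: continuous_integrable| |exact: bnd].
    apply: (@bounded_integrable _ _ _ _ _ _ c); first exact: measurable_OD.
      by apply: measurable_funTS; exact: measurable_funM.
    by move=> z _; rewrite normrM (ger0_norm c0) ler_piMr// normr_indic_le1.
  rewrite RintegralZl; [|exact: measurable_OD|]; last first.
    apply: (@bounded_integrable _ _ _ _ _ _ 1); first exact: measurable_OD.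
      exact: measurable_funTS.
    by move=> z _; exact: normr_indic_le1.
  rewrite ler_wpM2l// /Rintegral integral_indic//; last exact: measurable_OD.
  have -> : lebesgue_rV p (Omega `\` K) = M ((Omega `\` K) `*` setT).
    rewrite Mmarg// (eq_integral (cst 1%E)) => [|x _]; last by rewrite probability_setT.
    rewrite integral_cst ?mul1e//; last exact: measurableI.
    by congr (lebesgue_rV p _); apply/esym/setIidPl => x [].
  apply: fine_le; rewrite ?fin_num_measure//.
    by apply: measurableI => //; exact: measurable_OD.
  apply: le_measure; rewrite ?inE//.
  by apply: measurableI => //; exact: measurable_OD.
move=> h; apply: (@le_trans _ _ (C + c * (e / (t * N1)))).
  by rewrite lerD2l (le_trans h)// ler_wpM2l.
have -> : c * (e / (t * N1)) = t * e / 2.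
  by rewrite /c; field; rewrite !gt_eqF.
have -> : t * e = 2 * (C + 1) by rewrite /t mulfVK// gt_eqF.
lra.
Qed.

(** Write [gradD phi] as [(1 - f) gradD phi + gradD (f phi)]. The field [f phi] has interior
    support, so the continuity equation fixes its contribution for both [E] and [E']; the rest is
    small by [vmeasure_cutoff_small]. *)
Lemma pairing_unique E E' phi : continuity_eq Omega D mu E -> continuity_eq Omega D mu E' ->
  (Dir2 Omega D mu E < +oo)%E -> (Dir2 Omega D mu E' < +oo)%E ->
  pairing mu E phi = pairing mu E' phi.
Proof.
move=> [_ cE] [_ cE'] fE fE'; rewrite /pairing; congr (_ + _).
apply/eqP; rewrite -subr_eq0 -normr_le0; apply/ler_addgt0Pl => e e0; rewrite addr0.
have e20 : 0 < e / 2 by rewrite divr_gt0.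
have [d d0 hd] := vmeasure_cutoff_small phi fE e20.
have [d' d'0 hd'] := vmeasure_cutoff_small phi fE' e20.
have dd0 : 0 < Order.min d d' by rewrite lt_min d0.
have [K [cK KO Kd]] := inner_exhaustion dd0.
have [f [df [X [fC f01 fK [cX XO] fX]]]] := cutoff (q := q) cK KO.
move: Kd; rewrite le_min => /andP[Kd Kd'].
have h1 := hd K f df cK Kd fC f01 fK; have h2 := hd' K f df cK Kd' fC f01 fK.
have [psi [psiE dpsiE]] := C1_scale phi fC.
have psi_int : interior_support psi.
  exists X; split=> // z _; rewrite psiE scaler_eq0 negb_or => /andP[fz _].
  exact: fX.
have dpsi z : gradD psi z = f z *: gradD phi z.
  apply/matrixP => a i; rewrite !mxE dpsiE.
  by have [_ [_ ->]] := fC; rewrite scale0r addr0 !mxE.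
have v E1 : vmeasure_integral Omega D E1 (gradD phi) =
    vmeasure_integral Omega D E1 (fun z => (1 - f z) *: gradD phi z) +
    vmeasure_integral Omega D E1 (gradD psi).
  rewrite -[X in X + _]mul1r -vmeasure_integral_linear.
  - by apply: eq_vmeasure_integral => z _; rewrite dpsi scale1r scalerBl scale1r subrK.
  - move=> z; apply: cvgZ; last exact: gradD_continuous.
    apply: cvgB; first exact: cvg_cst.
    by apply: continuous_subspaceT; exact: scalar_C1_continuous fC.
  - exact: gradD_continuous.
have := cE psi psi_int; have := cE' psi psi_int; rewrite /pairing => p1 p2.
rewrite (v E) (v E').
have -> : forall x y z w : R, x + y - (z + w) = (x - z) + (y - w) by move=> *; ring.
rewrite (_ : vmeasure_integral _ _ E (gradD psi) - _ = 0) ?addr0; last by lra.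
by rewrite (le_trans (ler_normB _ _))// (splitr e) lerD.
Qed.

Lemma BT_pairing E phi : continuity_eq Omega D mu E -> (Dir2 Omega D mu E < +oo)%E ->
  BT mu phi = pairing mu E phi.
Proof.
move=> cE fE; rewrite /BT; set S := [set _ | _].
have : S (xget 0 S) by apply: (@xgetPex _ 0 S); exists (pairing mu E phi), E.
by move=> [E' [cE' fE' ->]]; exact: pairing_unique.
Qed.

End fixed_map.
End boundary_trace.

(** * Representation and disintegration *)

Section riesz_product.
Context {R : realType} {p q : nat} (Omega : set 'rV[R]_p) (D : set 'rV[R]_q).
Local Notation T := ('rV[R]_p * 'rV[R]_q)%type.
Local Notation OD := (Omega `*` D).
Hypotheses (cO : compact Omega) (cD : compact D) (ODn0 : OD !=set0).
Variables (l : (T -> R) -> R) (C : R).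
Hypothesis llin : forall a g h, bounded_on OD g -> bounded_on OD h ->
  l (fun z => a * g z + h z) = a * l g + l h.
Hypothesis lC : forall g (M : R), (forall z, OD z -> `|g z| <= M) -> `|l g| <= C * M.

Let cOD : compact (OD : set (prod_rV R p q)). Proof. exact: compact_OD. Qed.

Let separating_code : exists code : T -> cantor, @separating R (prod_rV R p q) OD code.
Proof.
have [z0 _] := ODn0; have [code [_ sep]] := @compact_code R (prod_rV R p q) OD z0 cOD.
by exists code.
Qed.

Let nu (A : set T) := l (\1_A).

Let bounded_indic (A : set T) : bounded_on OD (\1_A : T -> R).
Proof. by exists 1 => z _; exact: normr_indic_le1. Qed.

Let nuD : finitely_additive nu.
Proof.
move=> A B AB; rewrite /nu -[X in X + _]mul1r -llin//; congr l; apply/funext => z.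
by rewrite mul1r indic_disjointU.
Qed.

Let nuC A : nu A <= C.
Proof.
rewrite (le_trans (ler_norm _))// -[leRHS]mulr1; apply: lC => z _.
exact: normr_indic_le1.
Qed.

(** The measures are built on the Cantor space and pushed forward by the decoding [pi]; they sit on
    [OD] because [pi] takes its values there. *)
Let riesz_weights (code : T -> cantor) (w1 w2 : seq bool -> R) :
  @separating R (prod_rV R p q) OD code -> tree_weight w1 -> tree_weight w2 ->
  (forall s, nu (code @^-1` cone s) = w1 s - w2 s) ->
  exists M1 M2 : {finite_measure set T -> \bar R},
    [/\ forall A, A `&` OD = set0 -> M1 A = 0%E /\ M2 A = 0%E,
        M2 setT = (w2 [::])%:E &
        forall f : T -> R, {within OD, continuous f} ->
          l f = \int[M1]_(z in OD) f z - \int[M2]_(z in OD) f z].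
Proof.
move=> sep tw1 tw2 lw; have [z0 Oz0] := ODn0.
have [zn [pi dec]] := compact_decode Oz0 cOD sep.
have mpi : measurable_fun setT (pi : cantorM -> T).
  have mc := measurable_decode cOD dec.
  have -> : (pi : cantorM -> T) = fun b => ((pi b).1, (pi b).2).
    by apply/funext => b; case: (pi b).
  apply: measurable_fun_pair; apply: measurable_fun_rV => i.
    apply: (mc (fun z : T => z.1 0 i)); apply: continuous_subspaceT => z.
    by apply: (@continuous_comp _ _ _ fst (fun x : 'rV[R]_p => x 0 i)); [exact: cvg_fst|exact: coord_continuous].
  apply: (mc (fun z : T => z.2 0 i)); apply: continuous_subspaceT => z.
  by apply: (@continuous_comp _ _ _ snd (fun x : 'rV[R]_q => x 0 i)); [exact: cvg_snd|exact: coord_continuous].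
have piOD : pi @^-1` OD = setT.
  by rewrite -subTset => b _; have [/(_ b)[]] := dec.
have fin w : tree_weight w -> exists m : {finite_measure set cantorM -> \bar R},
    forall s, m (cone s) = (w s)%:E.
  move=> tw; have [m mw] := tree_measure tw.
  have [|m' m'E] := @finite_measure_of _ _ _ m.
    by rewrite -cone0 mw ltry.
  by exists m' => s; rewrite m'E mw.
have [m1 mw1] := fin _ tw1; have [m2 mw2] := fin _ tw2.
have [M1 [M1E M1int]] := image_finite_measure m1 mpi.
have [M2 [M2E M2int]] := image_finite_measure m2 mpi.
have disj A : A `&` OD = set0 -> pi @^-1` A = set0.
  rewrite -!subset0 => A0 b /= Ab; apply: (A0 (pi b)); split=> //.
  by have [/(_ b)[]] := dec.
exists M1, M2; split=> [A /disj A0||f cf].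
- by rewrite M1E M2E A0 !measure0.
- by rewrite M2E preimage_setT -cone0 mw2.
- have [mf bf] := continuous_nice cO cD cf.
  rewrite M1int ?M2int//; try exact: measurable_OD.
  rewrite piOD.
  refine (@riesz_signed R (prod_rV R p q) OD cOD code zn pi dec l C w1 w2 m1 m2 f llin lC mw1 mw2 lw cf).
Qed.

Let preim_additive (mu : set T -> R) (code : T -> cantor) s : finitely_additive mu ->
  mu (code @^-1` cone s) =
  mu (code @^-1` cone (rcons s false)) + mu (code @^-1` cone (rcons s true)).
Proof.
move=> muD; rewrite [in LHS]cone_rcons preimage_setU muD//.
by rewrite -preimage_setI cone_rcons_disj preimage_set0.
Qed.

(** Jordan decomposition at the level of words: the upper variation of [nu] on code cells, and its
    excess over [nu], are two nonnegative additive weights. *)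
Lemma riesz_charge : exists nu : {charge set T -> \bar R},
  (forall A, A `&` OD = set0 -> nu A = 0%E) /\
  forall f : T -> R, {within OD, continuous f} -> l f = charge_integral nu OD f.
Proof.
have [code sep] := separating_code.
pose w1 s := upper_variation nu (code @^-1` cone s).
pose w2 s := w1 s - nu (code @^-1` cone s).
have uvD := upper_variation_additive nuD nuC.
have tw1 : tree_weight w1.
  by split=> s; [exact: (upper_variation_ge0 nuD nuC)|exact: preim_additive].
have tw2 : tree_weight w2.
  split=> s; first by rewrite subr_ge0; exact: (le_upper_variation nuC).
  by rewrite /w2 /w1 (preim_additive _ _ uvD) (preim_additive _ _ nuD); ring.
have [|M1 [M2 [M0 _ lM]]] := riesz_weights sep tw1 tw2.
  by move=> s; rewrite /w2; ring.
have [nu' nuE] := charge_of_difference M1 M2.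
exists nu'; split=> [A /M0[M1A M2A]|f cf].
  by rewrite nuE; apply/eqP; rewrite [X in (X - _)%E]M1A [X in (_ - X)%E]M2A subee.
have [mf [M fM]] := continuous_nice cO cD cf.
rewrite (charge_integral_difference (measurable_OD cO cD) mf fM (fun B _ => nuE B)).
exact: lM.
Qed.

(** For a positive form the cell masses are themselves nonnegative weights, and the second weight is
    taken to be zero. *)
Lemma riesz_measure : (forall g, bounded_on OD g -> (forall z, OD z -> 0 <= g z) -> 0 <= l g) ->
  exists M : {finite_measure set T -> \bar R},
  (forall A, A `&` OD = set0 -> M A = 0%E) /\
  forall f : T -> R, {within OD, continuous f} -> l f = \int[M]_(z in OD) f z.
Proof.
move=> lpos; have [code sep] := separating_code.
pose w s := nu (code @^-1` cone s).
have tw : tree_weight w.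
  split=> s; last exact: preim_additive.
  by apply: lpos => [|z _]; [exact: bounded_indic|rewrite indicE].
have tw0 : tree_weight (fun=> 0 : R) by split=> // s; rewrite addr0.
have [|M [M2 [M0 M2T lM]]] := riesz_weights sep tw tw0.
  by move=> s; rewrite subr0.
exists M; split=> [A /M0[]//|f cf]; rewrite lM//.
suff -> : \int[M2]_(z in OD) f z = 0 by rewrite subr0.
have mOD := measurable_OD cO cD.
have [mf _] := continuous_nice cO cD cf.
have M2OD : M2 OD = 0%E.
  apply/eqP; rewrite eq_le measure_ge0 andbT -[leRHS]M2T.
  by apply: le_measure; rewrite ?inE//.
by rewrite /Rintegral null_set_integral//; exact/measurable_EFinP.
Qed.

End riesz_product.

(** * Disintegration over the Cantor space *)

Section cantor_disintegration.
Context {R : realType}.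

Definition cones : set (set cantor) := [set A | A = set0 \/ exists s, A = cone s].

Lemma measurable_cantor_cones : @measurable _ cantorM = <<s cones >>.
Proof.
apply/seteqP; split; last first.
  apply: smallest_sub; first exact: sigma_algebra_measurable.
  by move=> _ [->|[s ->]]; [exact: measurable0|exact: measurable_cantor_cone].
apply: smallest_sub; first exact: smallest_sigma_algebra.
move=> A [n nA].
have -> : A = \bigcup_s (if `[< cone s `<=` A >] then cone s else set0).
  apply/seteqP; split=> [x Ax|x [s _]]; last by case: asboolP => // sA /sA.
  exists (mkseq x n) => //; rewrite asboolT; first by rewrite /cone/= size_mkseq.
  move=> y; rewrite /cone/= size_mkseq => /mkseq_agree yx.
  by apply: nA Ax; exact: agree_sym.
apply: (@countable_bigcupT_measurable _ (g_sigma_algebraType cones)); first exact: countableP.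
move=> s; case: ifP => _; last exact: measurable0.
by apply: sub_sigma_algebra; right; exists s.
Qed.

(** Two cones are nested or disjoint; the empty set is part of [cones] for this reason. *)
Lemma cones_setI : setI_closed cones.
Proof.
suff key s t : (size s <= size t)%N -> cones (cone s `&` cone t).
  move=> _ _ [->|[s ->]] [->|[t ->]]; rewrite ?set0I ?setI0; [by left..|].
  have /orP[/key//|/key] := leq_total (size s) (size t).
  by rewrite setIC.
move=> st; have [->|/set0P[x [xs xt]]] := eqVneq (cone s `&` cone t) set0; first by left.
right; exists t; apply/setIidPr => y yt; rewrite /cone/= -[RHS]xs.
apply/mkseq_agree; apply: (agree_le st); apply/mkseq_agree.
by rewrite [LHS]yt [RHS]xt.
Qed.

Context d {X : measurableType d}.

Lemma section_measure d' {Y : measurableType d'} (N : {finite_measure set (X * Y)%type -> \bar R}) B :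
  measurable B -> exists n : {finite_measure set X -> \bar R}, forall A, n A = N (A `*` B).
Proof.
move=> mB; have mTB : measurable ([set: X] `*` B) by exact: measurableX.
have NB : (N ([set: X] `*` B) < +oo)%E by rewrite ltey_eq fin_num_measure.
have [n [nE _]] := image_finite_measure (mfrestr mTB NB) (@measurable_fst _ _ X Y).
exists n => A; rewrite nE; transitivity (N (fst @^-1` A `&` (setT `*` B))); first by [].
by congr (N _); apply/seteqP; split=> -[x y] [] /= => [Ax []|Ax By].
Qed.

Lemma section_measure2 d' {Y : measurableType d'} (N : {finite_measure set (X * Y)%type -> \bar R}) A :
  measurable A -> exists n : {finite_measure set Y -> \bar R}, forall B, n B = N (A `*` B).
Proof.
move=> mA; have mTA : measurable (A `*` [set: Y]) by exact: measurableX.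
have NA : (N (A `*` [set: Y]) < +oo)%E by rewrite ltey_eq fin_num_measure.
have [n [nE _]] := image_finite_measure (mfrestr mTA NA) (@measurable_snd _ _ X Y).
exists n => B; rewrite nE; transitivity (N (snd @^-1` B `&` (A `*` setT))); first by [].
by congr (N _); apply/seteqP; split=> -[x y] [] /= => [By []|Ax By].
Qed.

(** For each word [s] let [f s] be the Radon-Nikodym density of [N (_ * cone s)] with respect to
    [lam]. There are countably many words, so outside one null set the numbers [f s x] are additive
    in [s] with total 1, and [tree_measure] turns them into a probability. *)
Lemma disintegration_cantor (N : {finite_measure set (X * cantorM)%type -> \bar R})
    (lam : {finite_measure set X -> \bar R}) :
  (forall A, measurable A -> lam A = N (A `*` setT)) ->
  exists kap : X -> probability cantorM R,
    (forall B, measurable B -> measurable_fun setT (fun x => kap x B)) /\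
    forall A B, measurable A -> measurable B -> N (A `*` B) = (\int[lam]_(x in A) kap x B)%E.
Proof.
move=> lamE.
have /choice[nu nuE] : forall s : seq bool, exists n : {finite_measure set X -> \bar R},
    forall A, n A = N (A `*` cone s).
  by move=> s; apply: section_measure; exact: measurable_cantor_cone.
have nuT A : measurable A -> nu [::] A = lam A by move=> mA; rewrite nuE cone0 lamE.
have mX A s : measurable A -> measurable (A `*` (cone s : set cantorM)).
  by move=> mA; apply: measurableX => //; exact: measurable_cantor_cone.
have numu s : nu s `<< lam.
  apply/null_content_dominatesP => A mA A0; apply/eqP; rewrite eq_le measure_ge0 andbT.
  by rewrite -A0 [X in (_ <= X)%E](lamE A mA) [X in (X <= _)%E](nuE s A); apply: le_measure; rewrite ?inE; [exact: mX|exact: measurableX|by move=> -[x y] []].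
have /choice[f fP] : forall s, exists f : X -> R, [/\ forall x, 0 <= f x,
    measurable_fun setT f & forall A, measurable A -> nu s A = (\int[lam]_(x in A) (f x)%:E)%E].
  move=> s; have [f [f0 ffin fi fE]] := radon_nikodym_sigma_finite (numu s).
  exists (fine \o f); split=> [x||A mA]; first exact: fine_ge0.
    by apply: measurableT_comp => //; exact: measurable_int fi.
  by rewrite fE//; apply: eq_integral => x _; rewrite /= fineK.

have mf s : measurable_fun setT (f s) by have [] := fP s.
have fi s : lam.-integrable setT (EFin \o f s).
  have [f0 _ fE] := fP s; apply/integrableP; split; first exact/measurable_EFinP.
  rewrite (eq_integral (fun x => (f s x)%:E)) => [|x _]; last by rewrite /= ger0_norm.
  by rewrite -fE// ltey_eq fin_num_measure.
(* Consistency at the word numbered [n]; numbering the words reduces the almost sure statement to a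
   countable intersection. *)
pose cond n x := if (choice.unpickle n : option (seq bool)) is Some s then
  (f [::] x == 1) && (f s x == f (rcons s false) x + f (rcons s true) x) else true.
have mcond n : measurable_fun setT (cond n).
  rewrite /cond; case: (choice.unpickle n : option (seq bool)) => [s|]; last exact: measurable_cst.
  apply: measurable_and; apply: measurable_fun_eqr => //.
  exact: measurable_funD.
pose good := \bigcap_n [set x | cond n x].
have mgood : measurable good.
  apply: bigcapT_measurable => n; have := mcond n measurableT [set true] I.
  by rewrite setTI.
have good_ae : (\forall x \ae lam, good x).
  suff : (\forall x \ae lam, forall n, cond n x) by apply: filterS => x h n _; exact: h.
  apply: ae_foralln => n; rewrite /cond.
  case: (choice.unpickle n : option (seq bool)) => [s|]; last exact: aeW.
  have h1 : ae_eq lam setT (EFin \o f [::]) (cst 1%E).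
    apply: (integral_ae_eq measurableT (fi _)) => //.
    move=> A _ mA; have [_ _ fE] := fP [::].
    by rewrite -[LHS]fE// integral_cst// mul1e nuT.
  have h2 : ae_eq lam setT (EFin \o f s) (EFin \o (fun x => f (rcons s false) x + f (rcons s true) x)).
    apply: (integral_ae_eq measurableT (fi _)) => //.
      by apply/measurable_EFinP; apply: measurable_funD; exact: mf.
    move=> A _ mA; have [_ _ fE] := fP s.
    rewrite -[LHS]fE//; transitivity (\int[lam]_(x in A) ((f (rcons s false) x)%:E + (f (rcons s true) x)%:E))%E; last by [].
    have iA s' : lam.-integrable A (EFin \o f s') by exact: integrableS (fi s').
    rewrite (integralD mA (iA _) (iA _)).
    have [_ _ fE0] := fP (rcons s false); have [_ _ fE1] := fP (rcons s true).
    rewrite -fE0// -fE1// !nuE [in LHS]cone_rcons -measureU.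
    - by congr (N _); apply/seteqP; split=> -[x y] /=; tauto.
    - exact: mX.
    - exact: mX.
    - rewrite -subset0 => -[x y] [[_ y0] [_ y1]].
      by have : (cone (rcons s false) `&` cone (rcons s true)) y by []; rewrite cone_rcons_disj.
  near=> x; apply/andP; split; apply/eqP; apply: EFin_inj.
  - by near: x; apply: filterS h1 => x; apply.
  - by near: x; apply: filterS h2 => x; apply.
(* On the exceptional null set the weights are those of the Dirac mass at the constant sequence
   [false]. *)
pose w x s := if x \in good then f s x else \1_(cone s) (fun=> false).
have goodP x : good x -> f [::] x = 1 /\ forall s, f s x = f (rcons s false) x + f (rcons s true) x.
  move=> gx; have gs s : (f [::] x == 1) && (f s x == f (rcons s false) x + f (rcons s true) x).
    have : cond (choice.pickle s) x by exact: gx.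
    by rewrite /cond choice.pickleK.
  split=> [|s]; first by have /andP[h _] := gs [::]; exact/eqP.
  by have /andP[_ h] := gs s; exact/eqP.
have tw x : tree_weight (w x).
  have [gx|/negbTE gx] := boolP (x \in good).
    have [_ h] := goodP x (set_mem gx).
    by split=> s; rewrite /w gx//; have [] := fP s.
  split=> s; rewrite /w gx; first by rewrite indicE.
  by rewrite [in LHS]cone_rcons indic_disjointU// cone_rcons_disj.
have w1 x : w x [::] = 1.
  rewrite /w; case: ifPn => [|_]; first by rewrite inE => /goodP[].
  by rewrite cone0 indicT.
have /choice[kap kapE] : forall x, exists k : probability cantorM R, forall s, k (cone s) = (w x s)%:E.
  move=> x; have [m mw] := tree_measure (tw x).
  have [|k kE] := @probability_of _ _ _ m; first by rewrite -cone0 mw w1.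
  by exists k => s; rewrite kE mw.
have mkap B : measurable B -> measurable_fun setT (fun x => kap x B).
  apply: (@measurable_family_generated _ _ X cantorM R setT kap cones) => //.
  - exact: measurable_cantor_cones.
  - exact: cones_setI.
  - move=> _ [->|[s ->]]; first by under eq_fun do rewrite measure0; exact: measurable_cst.
    under eq_fun do rewrite kapE; apply/measurable_EFinP; rewrite /w.
    apply: measurable_fun_ifT => //.
    apply: (measurable_fun_bool true); rewrite setTI.
    by rewrite (_ : _ @^-1` _ = good)//; apply/seteqP; split=> x; [exact: set_mem|exact: mem_set].
exists kap; split=> // A B mA mB.
have [M0 [M0E _]] := total_measure lam mkap.
have M0X K : measurable K -> M0 (A `*` K) = (\int[lam]_(x in A) kap x K)%E.
  move=> mK; rewrite M0E; last exact: measurableX.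
  rewrite [RHS]integral_mkcond; apply: eq_integral => x _; rewrite patchE.
  by case: ifPn => xA; [rewrite in_xsectionX|rewrite notin_xsectionX// measure0].
have [n1 n1E] := section_measure2 N mA; have [n2 n2E] := section_measure2 M0 mA.
rewrite -M0X// -n1E -n2E.
apply: (@measure_unique _ R cantorM cones (fun=> setT) _ _ _ _ n1 n2) => //.
- exact: measurable_cantor_cones.
- exact: cones_setI.
- by move=> _; right; exists [::]; rewrite cone0.
- by rewrite bigcup_const//; exists 0%N.
- move=> _ [->|[s ->]]; first by rewrite !measure0.
  transitivity (N (A `*` cone s)); first exact: n1E.
  transitivity (M0 (A `*` cone s)); last exact/esym/n2E.
  rewrite [RHS]M0X; last exact: measurable_cantor_cone.
  have [f0 _ fE] := fP s; rewrite -[LHS]nuE [LHS]fE//.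
  have mT := measurable_funTS (D := A).
  apply: ge0_ae_eq_integral => //.
  + by apply: mT; exact/measurable_EFinP.
  + by apply: mT; exact: mkap (measurable_cantor_cone s).
  + by move=> x _; rewrite lee_fin.
  + by apply: filterS good_ae => x gx _; rewrite kapE /w mem_set.
- by move=> _; rewrite ltey_eq fin_num_measure.
Unshelve. all: by end_near. Qed.

End cantor_disintegration.

Section disintegration.
Context {R : realType} {p q : nat} (Omega : set 'rV[R]_p) (D : set 'rV[R]_q).
Hypotheses (cO : compact Omega) (cD : compact D) (O1 : lebesgue_rV p Omega = 1%E).
Local Notation T := ('rV[R]_p * 'rV[R]_q)%type.
Local Notation OD := (Omega `*` D).

Lemma measurable_code n (code : 'rV[R]_n -> cantor) :
  (forall k, open [set z | code z k]) -> measurable_fun setT (code : 'rV[R]_n -> cantorM).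
Proof.
move=> ocode; apply: (@measurability _ _ _ cantorM setT code cones measurable_cantor_cones).
move=> _ [_ [->|[s ->]] <-]; rewrite setTI ?preimage_set0//.
have -> : code @^-1` cone s =
    \bigcap_(k in [set k | (k < size s)%N]) [set z | code z k = nth false s k].
  apply/seteqP; split=> [z zs k kn /=|z zs]; first by rewrite -[in RHS]zs nth_mkseq.
  rewrite /cone/= -[RHS](mkseq_nth false).
  by apply/mkseq_agree => k kn; exact: zs.
apply: fin_bigcap_measurable => [|k _]; first exact: finite_II.
case: (nth false s k); first by apply: measurable_open_mx; exact: ocode.
rewrite (_ : [set z | _] = ~` [set z | code z k]); last first.
  by apply/seteqP; split=> z /=; [move=> ->|case: (code z k)].
by apply: measurableC; apply: measurable_open_mx; exact: ocode.
Qed.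

Lemma measure_eq_on (M : {finite_measure set T -> \bar R}) (C C' : set T) :
  (forall A, measurable A -> A `&` OD = set0 -> M A = 0%E) -> measurable C -> measurable C' ->
  C `&` OD = C' `&` OD -> M C = M C'.
Proof.
move=> M0 mC mC' CC'; have mOD := measurable_OD cO cD.
suff h A : measurable A -> M A = M (A `&` OD) by rewrite h// CC' -h.
move=> mA; have -> : M A = (M (A `\` OD) + M (A `&` OD))%E by exact: measureDI.
rewrite M0 ?add0e//; first exact: measurableD.
by rewrite setDE -setIA setICl setI0.
Qed.

(** The second coordinate is encoded, disintegrated over the Cantor space, and decoded again. This
    recovers [M] because [pi] inverts [code] on [D] and [M] is carried by [OD]; decoded laws sit on
    [D] since [pi] maps into it. *)
Lemma disintegration (M : {finite_measure set T -> \bar R}) : D !=set0 ->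
  (forall A, measurable A -> A `&` OD = set0 -> M A = 0%E) ->
  (forall A, measurable A -> M (A `*` setT) = lebesgue_rV p (A `&` Omega)) ->
  exists mu : 'rV[R]_p -> probability 'rV[R]_q R, L2map Omega D mu /\
    forall f : T -> R, measurable_fun OD f -> bounded_on OD f ->
      map_integral Omega D mu f = \int[M]_(z in OD) f z.
Proof.
move=> [d0 Dd0] M0 Mmarg.
have mO : measurable Omega by exact: compact_measurable_rV.
have mD : measurable D by exact: compact_measurable_rV.
have [code [ocode sep]] := @compact_code R (single_rV R q) D d0 cD.
have [zn [pi dec]] := @compact_decode R (single_rV R q) D d0 Dd0 code cD sep.
have mcode := measurable_code ocode.
have mpi : measurable_fun setT (pi : cantorM -> 'rV[R]_q).
  apply: measurable_fun_rV => i.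
  apply: (@measurable_decode R (single_rV R q) D cD code zn pi dec (fun x : 'rV[R]_q => x 0 i)).
  by apply: continuous_subspaceT; exact: coord_continuous.
have pi_code z : D z -> pi (code z) = z.
  have [_ _ pzn zcode] := dec => Dz.
  apply/eqP; rewrite -subr_eq0 -normr_le0; apply/ler_addgt0Pl => e e0; rewrite addr0.
  have e20 : 0 < e / 2 by rewrite divr_gt0.
  have [N hN] := pzn _ e20; have [N' hN'] := zcode _ e20.
  have h1 := hN (maxn N N') (leq_maxl _ _) (code z).
  have /ball_sym h2 := hN' (maxn N N') (leq_maxr _ _) z Dz.
  by have := ball_triangle h1 h2; rewrite -splitr -ball_normE => /ltW.
have mg : measurable_fun setT (fun z : T => (z.1, code z.2 : cantorM)).
  apply: measurable_fun_pair; first exact: measurable_fst.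
  exact: measurableT_comp mcode measurable_snd.
have [N [NE _]] := image_finite_measure M mg.
have [lam [lamE _]] := image_finite_measure M (@measurable_fst _ _ 'rV[R]_p 'rV[R]_q).
have lamL A : measurable A -> lam A = lebesgue_rV p (A `&` Omega).
  move=> mA; rewrite -Mmarg// lamE; congr (M _).
  by apply/seteqP; split=> -[x y] // [].
have [|kap [mkap kapE]] := @disintegration_cantor R _ _ N lam.
  by move=> A mA; rewrite lamE NE; congr (M _); apply/seteqP; split=> -[x y] // [].
have /choice[mu muE] : forall x, exists P : probability 'rV[R]_q R, forall B, P B = kap x (pi @^-1` B).
  move=> x; have [|P PE] := @probability_of _ _ _ (image_measure (kap x) mpi).
    by rewrite image_measureE preimage_setT; exact: (probability_setT (kap x)).
  by exists P => B; rewrite PE.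
have mpre B : measurable B -> measurable (pi @^-1` B : set cantorM).
  by move=> mB; rewrite -[X in measurable X]setTI; exact: mpi.
have mmu B : measurable B -> measurable_fun setT (fun x => mu x B).
  move=> mB; rewrite (_ : (fun _ => _) = fun x => kap x (pi @^-1` B)); last first.
    by apply/funext => x; rewrite muE.
  exact: (mkap _ (mpre B mB)).
have muD xi : Omega xi -> prob_on D (mu xi).
  move=> _; transitivity (kap xi setT); last exact: (probability_setT (kap xi)).
  rewrite [LHS]muE; congr (kap xi _).
  by rewrite -subTset => b _; have [/(_ b)[]] := dec.
have muO B : measurable B -> measurable_fun Omega (fun x => mu x B).
  by move=> mB; apply: measurable_funTS; exact: mmu.
exists mu; split=> [|f mf bf]; first exact: kernel_L2map.
have [M' [_ M'X M'int]] := map_integral_measure cO cD O1 muD muO.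
rewrite M'int//; congr fine; apply: eq_measure_integral => A mA _.
apply: (@measure_unique _ R T [set A `*` B | A in measurable & B in measurable]
  (fun=> setT) _ _ _ _ M' M _ _ _ mA).
- exact: measurable_prod_measurableType.
- move=> _ _ [A1 mA1 [B1 mB1 <-]] [A2 mA2 [B2 mB2 <-]].
  exists (A1 `&` A2); first exact: measurableI.
  by exists (B1 `&` B2); [exact: measurableI|rewrite setXI].
- by move=> _; exists setT => //; exists setT => //; rewrite setXTT.
- by rewrite bigcup_const//; exists 0%N.
- move=> _ [A1 mA1 [B1 mB1 <-]].
  have mAO : measurable (A1 `&` Omega) by exact: measurableI.
  transitivity (N ((A1 `&` Omega) `*` (pi @^-1` B1))).
    rewrite [LHS]M'X// [RHS]kapE//; last exact: mpre.
    rewrite (eq_integral (fun x => kap x (pi @^-1` B1))) => [|x _]; last exact: muE.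
    apply: eq_measure_integral => C mC CAO; rewrite [RHS]lamL//.
    by congr (lebesgue_rV p _); apply/esym/setIidPl => x /CAO[].
  rewrite [LHS]NE; apply: measure_eq_on => //.
  + rewrite -[X in measurable X]setTI; apply: mg => //.
    by apply: measurableX => //; exact: mpre.
  + exact: measurableX.
  + apply/seteqP; split=> -[x y] [] /= [].
      by move=> [A1x Ox] By [_ Dy]; rewrite pi_code// in By.
    by move=> A1x By [Ox Dy]; rewrite pi_code.
- by move=> _; rewrite ltey_eq fin_num_measure.
Qed.

End disintegration.

(** * Identification of the first marginal *)

Section first_marginal.
Context {R : realType} {p q : nat} (Omega : set 'rV[R]_p) (D : set 'rV[R]_q).
Hypotheses (cO : compact Omega) (cD : compact D).
Local Notation T := ('rV[R]_p * 'rV[R]_q)%type.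
Local Notation OD := (Omega `*` D).

(** Approximation of the indicator of the orthant above [a]. The coordinate [i0] has a merely
    continuous profile, because it is the one that gets integrated to produce a field. *)
Definition orthant_ramp (i0 : 'I_p) (a : 'rV[R]_p) (n : nat) (z : T) : R :=
  ramp (n.+1%:R * (z.1 0 i0 - a 0 i0)) *
  \prod_j (if j == i0 then 1 else smooth_step (n.+1%:R * (z.1 0 j - a 0 j))).

Lemma orthant_ramp_itv i0 a n z : 0 <= orthant_ramp i0 a n z <= 1.
Proof.
have h j : 0 <= (if j == i0 then 1 else smooth_step (n.+1%:R * (z.1 0 j - a 0 j))) <= 1.
  by case: eqP => _; [rewrite ler01 lexx|exact: smooth_step_itv].
have /andP[r0 r1] := ramp_itv (n.+1%:R * (z.1 0 i0 - a 0 i0)).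
have P0 : 0 <= \prod_j (if j == i0 then 1 else smooth_step (n.+1%:R * (z.1 0 j - a 0 j))).
  by apply: prodr_ge0 => j _; have /andP[] := h j.
rewrite /orthant_ramp mulr_ge0//= mulr_ile1//.
by apply: prodr_ile1 => j _; exact: h.
Qed.

Lemma orthant_ramp_cvg i0 a z :
  \forall n \near \oo, orthant_ramp i0 a n z = \1_(rV_orthant a `*` setT) z.
Proof.
have [za|/negP za] := boolP (z \in rV_orthant a `*` setT); rewrite indicE.
  rewrite za; have {}za : rV_orthant a z.1 by move: za; rewrite inE => -[].
  have near_i (i : 'I_p) : \forall n \near \oo, 1 <= n.+1%:R * (z.1 0 i - a 0 i).
    have e0 : 0 < z.1 0 i - a 0 i by rewrite subr_gt0; exact: za.
    apply: filterS (near_infty_natSinv_lt (PosNum e0)) => n /= /ltW h.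
    by rewrite mulrC -ler_pdivrMr// mul1r.
  have : \forall n \near \oo, forall i : 'I_p, 1 <= n.+1%:R * (z.1 0 i - a 0 i).
    exact: filter_forall.
  apply: filterS => n h; rewrite /orthant_ramp ramp_ge1// mul1r big1// => j _.
  by case: eqP => // _; rewrite smooth_step_ge1.
rewrite (negbTE (introN idP za)); apply: nearW => n.
have [i zi] : exists i, z.1 0 i <= a 0 i.
  apply: contrapT => /forallNP h; apply: za; rewrite inE; split=> // i.
  by rewrite ltNge; exact/negP.
have le0 : n.+1%:R * (z.1 0 i - a 0 i) <= 0 by rewrite mulr_ge0_le0// subr_le0.
rewrite /orthant_ramp; have [E|ii0] := eqVneq i i0; first by rewrite -E ramp_le0 ?mul0r.
by rewrite (bigD1 i)//= (negbTE ii0) smooth_step_le0// mul0r mulr0.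
Qed.

(** The field points along [i0], with the primitive of the ramp in that coordinate and smooth steps
    in the others, so its divergence is a single partial derivative. The factor [m^-1] cancels the
    chain rule, and the factor of index [i0] in the product is 1 so that the product is stationary
    in that direction. *)
Lemma orthant_test_function (i0 : 'I_p) (a : 'rV[R]_p) (n : nat) : exists phi : C1 Omega D,
  (forall z, divO phi z = orthant_ramp i0 a n z) /\ forall z, gradD phi z = 0.
Proof.
pose m : R := n.+1%:R.
have m0 : m != 0 by rewrite pnatr_eq0.
have h1 := scalar_C1_coord (p := p) (q := q) i0 (qsmooth_affine m (- (m * a 0 i0)) qsmooth_ramp_primitive).
pose F j (z : T) : R := if j == i0 then 1 else smooth_step (m * z.1 0 j - m * a 0 j).
pose dF j (z v : T) : R := if j == i0 then 0 else m * smooth_step' (m * z.1 0 j - m * a 0 j) * v.1 0 j.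
have FC j : scalar_C1 (F j) (dF j).
  rewrite /F /dF; case: eqP => _; first exact: scalar_C1_cst.
  exact: (scalar_C1_coord j (qsmooth_affine m (- (m * a 0 j)) qsmooth_step)).
have [df [gC dfv]] := scalar_C1_prod (index_enum 'I_p) FC.
have [c [cE dc]] := @C1_cst R p q Omega D (m^-1 *: delta_mx 0 i0).
have [phi [_ dphi]] := C1_scale c (scalar_C1M h1 gC).
exists phi; split=> z; last first.
  apply/matrixP => b i; rewrite !mxE dphi dc scaler0 add0r.
  have [_ [_ ->]] := scalar_C1M h1 gC.
  by rewrite scale0r mxE.
rewrite /divO (bigD1 i0)//= big1 ?addr0 => [|b bi0]; last first.
  by rewrite dphi dc scaler0 add0r cE !mxE eqxx (negbTE bi0) !mulr0.
rewrite dphi dc scaler0 add0r cE !mxE !eqxx dfv => [|j w]; last first.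
  by rewrite /dF; case: eqP => // /eqP ji0; rewrite mxE eqxx (negbTE ji0) mulr0.
rewrite mulr0 add0r !mulr1 /orthant_ramp -/m.
rewrite (_ : \prod_j (if j == i0 then 1 else smooth_step (m * (z.1 0 j - a 0 j))) =
    \prod_(j <- index_enum 'I_p) F j z); last first.
  by apply: eq_bigr => j _; rewrite /F mulrBr.
by rewrite -mulrBr mulrCA mulrAC mulfV// mul1r mulrC.
Qed.

Lemma orthant_ramp_integral (M : {finite_measure set T -> \bar R}) i0 a :
  (forall A, measurable A -> A `&` OD = set0 -> M A = 0%E) ->
  (\int[M]_(z in OD) (orthant_ramp i0 a n z)%:E @[n --> \oo] --> M (rV_orthant a `*` setT))%E.
Proof.
move=> M0; have mOD := measurable_OD cO cD.
have mA : measurable (rV_orthant a `*` [set: 'rV[R]_q]).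
  by apply: measurableX => //; exact: measurable_rV_orthant.
have -> : M (rV_orthant a `*` setT) = (\int[M]_(z in OD) (\1_(rV_orthant a `*` setT) z)%:E)%E.
  rewrite integral_indic//; apply: (measure_eq_on cO cD M0 mA (measurableI _ _ mA mOD)).
  by apply/seteqP; split=> z [] // h1 h2; split=> //; case: h1.
have mr n : measurable_fun OD (orthant_ramp i0 a n).
  have [phi [phiE _]] := orthant_test_function i0 a n.
  have [mphi _] := continuous_nice cO cD (@divO_continuous _ _ _ _ _ phi).
  by rewrite (_ : orthant_ramp i0 a n = divO phi)//; apply/funext => z; rewrite phiE.
have [] := @dominated_convergence _ T R M OD mOD (fun n z => (orthant_ramp i0 a n z)%:E)
  (fun z => (\1_(rV_orthant a `*` setT) z)%:E) (cst 1%E) => //.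
- by move=> n; apply/measurable_EFinP; exact: mr.
- by apply/measurable_EFinP; apply: measurable_funTS; exact: measurable_indic.
- apply: aeW => z _; apply: cvg_near_cst.
  by apply: filterS (orthant_ramp_cvg i0 a z) => n ->.
- exact: finite_measure_integrable_cst.
- apply: aeW => z n _; rewrite lee_fin.
  by have /andP[r0 r1] := orthant_ramp_itv i0 a n z; rewrite ger0_norm.
Qed.

(** Fields constant along [D] see only the first marginal. Their divergences include approximate
    indicators of orthants, and orthants generate the Borel sets and are stable under
    intersection. *)
Lemma eq_first_marginal (M1 M2 : {finite_measure set T -> \bar R}) : (0 < p)%N ->
  (forall A, measurable A -> A `&` OD = set0 -> M1 A = 0%E) ->
  (forall A, measurable A -> A `&` OD = set0 -> M2 A = 0%E) ->
  (forall phi : C1 Omega D, (forall z, gradD phi z = 0) ->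
    \int[M1]_(z in OD) divO phi z = \int[M2]_(z in OD) divO phi z) ->
  forall A, measurable A -> M1 (A `*` setT) = M2 (A `*` setT).
Proof.
move=> p0 M10 M20 M12 A mA; pose i0 := Ordinal p0.
have orth a : M1 (rV_orthant a `*` setT) = M2 (rV_orthant a `*` setT).
  have h1 := @orthant_ramp_integral M1 i0 a M10; have h2 := @orthant_ramp_integral M2 i0 a M20.
  rewrite -(cvg_lim _ h1)// -(cvg_lim _ h2)//; congr (limn _); apply/funext => n.
  have [phi [phiE gphi]] := orthant_test_function i0 a n.
  have I (M : {finite_measure set T -> \bar R}) : (\int[M]_(z in OD) (orthant_ramp i0 a n z)%:E)%E
      = (\int[M]_(z in OD) divO phi z)%:E.
    rewrite /Rintegral fineK.
      by apply: eq_integral => z _; rewrite phiE.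
    apply: integrable_fin_num; first exact: measurable_OD.
    exact: (continuous_integrable cO cD M (@divO_continuous _ _ _ _ _ phi)).
  by rewrite !I M12.
have [n1 [n1E _]] := image_finite_measure M1 (@measurable_fst _ _ 'rV[R]_p 'rV[R]_q).
have [n2 [n2E _]] := image_finite_measure M2 (@measurable_fst _ _ 'rV[R]_p 'rV[R]_q).
have fstX (B : set 'rV[R]_p) : fst @^-1` B = B `*` [set: 'rV[R]_q].
  by apply/seteqP; split=> -[x y] // [].
rewrite -fstX -n1E -n2E.
apply: (@measure_unique _ R 'rV[R]_p (range rV_orthant)
  (fun k => rV_orthant (const_mx (- k%:R))) _ _ _ _ n1 n2) => //.
- exact: rV_orthant_generated.
- move=> _ _ [a _ <-] [b _ <-]; exists (\row_i Order.max (a 0 i) (b 0 i)) => //.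
  apply/seteqP; split=> [x h|x [h1 h2] i].
    by split=> i; have := h i; rewrite mxE gt_max => /andP[].
  by rewrite mxE gt_max h1 h2.
- rewrite -subTset => x _; have [m xm] := rV_boundedP x; exists m => // i; rewrite mxE.
  by have := xm i; rewrite ltr_norml => /andP[].
- by move=> _ [a _ <-]; rewrite [LHS]n1E [RHS]n2E fstX.
- by move=> k; rewrite ltey_eq fin_num_measure//; exact: measurable_rV_orthant.
Qed.

End first_marginal.

(** * The dual problem *)

Section gauge.
Context {R : realType} {p q : nat} {T : Type} (X : set T).

(** The codomain [R^o] makes scalar functions a module, so that the pairs form an [lmodType]. *)
Definition datum : lmodType R := ((T -> R^o) * (T -> 'M[R]_(p, q)))%type.
Implicit Types (u v : datum) (s t c : R).

Definition bounded_datum u := bounded_on X (u.1 : T -> R) /\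
  forall a i, bounded_on X (fun z => u.2 z a i).

(* For t = 1 this is the constraint defining the dual problem, shifted by the
   constant 1; the division by t makes it positively homogeneous in (u, t). *)
Definition feasible u t := 0 < t /\
  forall z, X z -> (u.1 z : R) + sqnorm (u.2 z) / (2 * t) <= t.

Definition gauge u : R := inf [set t | feasible u t].

Lemma sqnormZ t (b : 'M[R]_(p, q)) : sqnorm (t *: b) = t ^+ 2 * sqnorm b.
Proof.
rewrite /sqnorm mulr_sumr; apply: eq_bigr => a _; rewrite mulr_sumr.
by apply: eq_bigr => i _; rewrite mxE exprMn.
Qed.

Lemma bounded_datum_lin c u v : bounded_datum u -> bounded_datum v ->
  bounded_datum (c *: u + v).
Proof.
have lin (f g : T -> R) : bounded_on X f -> bounded_on X g ->
    bounded_on X (fun z => c * f z + g z).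
  move=> [M fM] [N gN]; exists (`|c| * M + N) => z Xz.
  by rewrite (le_trans (ler_normD _ _))// normrM lerD ?gN// ler_wpM2l// fM.
move=> [u1 u2] [v1 v2]; split=> [|a i]; first exact: lin.
rewrite (_ : (fun _ => _) = fun z => c * u.2 z a i + v.2 z a i); first exact: lin.
by apply/funext => z; rewrite !mxE.
Qed.

Lemma bounded_datum_subspace : linear_subspace bounded_datum.
Proof.
split; last by move=> a u v; exact: bounded_datum_lin.
by split=> [|a i]; exists 0 => z _; rewrite ?mxE normr0.
Qed.

Lemma feasible_exists u : bounded_datum u -> exists t, feasible u t.
Proof.
move=> [[M uM] /(_ _)/choice bM].
have /choice[N uN] : forall a, exists N : 'I_q -> R, forall i z, X z -> `|u.2 z a i| <= N i.
  by move=> a; have [N hN] := bM a; exists N => i z; exact: hN.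
pose K := \sum_a \sum_i (N a i) ^+ 2.
have K0 : 0 <= K by apply: sumr_ge0 => a _; apply: sumr_ge0 => i _; exact: sqr_ge0.
exists (`|M| + K + 1); split=> [|z Xz]; first by rewrite ltr_wpDl// addr_ge0.
have sK : sqnorm (u.2 z) <= K.
  apply: ler_sum => a _; apply: ler_sum => i _.
  by rewrite -[_ ^+ 2]real_normK ?num_real// lerXn2r ?nnegrE ?(le_trans (normr_ge0 (u.2 z a i)))// uN.
have t1 : 1 <= 2 * (`|M| + K + 1) by have := normr_ge0 M; lra.
have : sqnorm (u.2 z) / (2 * (`|M| + K + 1)) <= K.
  by rewrite ler_pdivrMr ?(lt_le_trans _ t1)// (le_trans sK)// ler_peMr.
have := uM z Xz; have := ler_norm (u.1 z : R); have := ler_norm M.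
by move: (_ / _) `|(u.1 z : R)| => x w; lra.
Qed.

Lemma gauge_le u t : feasible u t -> gauge u <= t.
Proof. by move=> ut; apply: ge_inf => //; exists 0 => s [/ltW]. Qed.

Lemma le_gauge u c : bounded_datum u -> (forall t, feasible u t -> c <= t) -> c <= gauge u.
Proof. by move=> /feasible_exists[t ut] h; apply: lb_le_inf => //; exists t. Qed.

Lemma feasibleZ u s t : 0 < s -> feasible u t -> feasible (s *: u) (s * t).
Proof.
move=> s0 [t0 ut]; split=> [|z Xz]; first exact: mulr_gt0.
rewrite [X in X + _](_ : _ = s * (u.1 z : R)) // [(s *: u).2 z](_ : _ = s *: u.2 z)//.
rewrite sqnormZ (_ : _ / _ = s * (sqnorm (u.2 z) / (2 * t))); last first.
  by field; rewrite !gt_eqF.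
by rewrite -mulrDr ler_pM2l// ut.
Qed.

(** Joint convexity of the perspective [|b|^2 / t], entry by entry. *)
Lemma feasibleD u v s t : feasible u s -> feasible v t -> feasible (u + v) (s + t).
Proof.
move=> [s0 us] [t0 vt]; have st0 : 0 < s + t by exact: addr_gt0.
split=> // z Xz; have := us z Xz; have := vt z Xz.
suff : sqnorm (u.2 z + v.2 z) / (2 * (s + t)) <=
    sqnorm (u.2 z) / (2 * s) + sqnorm (v.2 z) / (2 * t).
  rewrite -[(u + v).2 z]/(u.2 z + v.2 z) -[(u + v).1 z]/((u.1 z : R) + (v.1 z : R)).
  by move: (_ / _) (_ / _) (_ / _) => x y w; lra.
rewrite /sqnorm !mulr_suml -big_split /=; apply: ler_sum => a _.
rewrite !mulr_suml -big_split /=; apply: ler_sum => i _; rewrite mxE.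
move: (u.2 z a i) (v.2 z a i) => x y.
rewrite -subr_ge0 (_ : _ - _ = (t * x - s * y) ^+ 2 / (2 * s * t * (s + t))); last first.
  by field; rewrite !gt_eqF.
by rewrite divr_ge0 ?sqr_ge0// !mulr_ge0// ltW.
Qed.

Lemma gauge_sublinear c : 0 <= c -> sublinear_on bounded_datum (fun u => c * gauge u).
Proof.
move=> c0; split=> [u v Bu Bv|t u t0 Bu].
  rewrite -mulrDr ler_wpM2l// -lerBlDl; apply: le_gauge => // s vs.
  rewrite lerBlDl -lerBlDr; apply: le_gauge => // t ut; rewrite lerBlDr.
  by apply: gauge_le; exact: feasibleD.
rewrite mulrCA; congr (_ * _); apply/le_anti/andP; split.
  rewrite -ler_pdivrMl//; apply: le_gauge => // s us; rewrite ler_pdivrMl//.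
  by apply: gauge_le; exact: feasibleZ.
apply: le_gauge => [|s us].
  by rewrite -[t *: u]addr0; apply: bounded_datum_lin => //; have [] := bounded_datum_subspace.
rewrite -ler_pdivlMl//; apply: gauge_le; rewrite -[u](scalerK (lt0r_neq0 t0)).
by apply: feasibleZ; rewrite ?invr_gt0.
Qed.

End gauge.

(** * Representation of a linear form dominated by the gauge *)

Section functional_representation.
Context {R : realType} {p q : nat} (Omega : set 'rV[R]_p) (D : set 'rV[R]_q).
Local Notation T := ('rV[R]_p * 'rV[R]_q)%type.
Local Notation OD := (Omega `*` D).
Local Notation bounded := (@bounded_datum R p q T OD).
Hypotheses (cO : compact Omega) (cD : compact D) (ODn0 : OD !=set0).
Variables (L : @datum R p q T -> R) (c : R).
Hypotheses (c0 : 0 <= c) (Llin : linear_on bounded L)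
  (Lc : forall u, bounded u -> L u <= c * gauge OD u).

Definition entry_datum (k : 'I_p * 'I_q) (g : T -> R) : @datum R p q T :=
  ((fun=> 0), fun z => g z *: delta_mx k.1 k.2).

Definition scalar_datum (g : T -> R) : @datum R p q T := (g, fun=> 0).

Let bounded0 : bounded 0.
Proof. exact: (bounded_datum_subspace OD).1. Qed.

Let bounded_cst0 : bounded_on OD (fun=> 0 : R).
Proof. by exists 0 => z _; rewrite normr0. Qed.

Let L0 : L 0 = 0.
Proof. by have := Llin (-1) bounded0 bounded0; rewrite scaler0 addr0; lra. Qed.

Let bounded_entry k g : bounded_on OD g -> bounded (entry_datum k g).
Proof.
move=> [M gM]; split=> [|a i]; first exact: bounded_cst0.
exists M => z Oz; rewrite /= !mxE; case: (_ && _); rewrite ?mulr1 ?mulr0 ?normr0 ?gM//.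
by rewrite (le_trans _ (gM z Oz)).
Qed.

Let bounded_scalar g : bounded_on OD g -> bounded (scalar_datum g).
Proof.
move=> bg; split=> // a i; exists 0 => z _; by rewrite mxE normr0.
Qed.

(** Feasibility is required only for [t > M], since [M] may be 0 and feasible numbers are
    positive. *)
Let L_le u (M : R) : bounded u -> (forall t, M < t -> feasible OD u t) -> L u <= c * M.
Proof.
move=> Bu h; rewrite (le_trans (Lc Bu))// ler_wpM2l//.
by apply/ler_addgt0Pl => e e0; apply: gauge_le; apply: h; rewrite ltrDr.
Qed.

Let sqnorm0 : sqnorm (0 : 'M[R]_(p, q)) = 0.
Proof. by rewrite /sqnorm big1// => a _; rewrite big1// => i _; rewrite mxE expr0n. Qed.

Let sqnorm_delta k (x : R) : sqnorm (x *: delta_mx k.1 k.2 : 'M[R]_(p, q)) = x ^+ 2.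
Proof.
rewrite /sqnorm (bigD1 k.1)//= (bigD1 k.2)//= big1 => [|i ik]; last first.
  by rewrite !mxE (negbTE ik) andbF mulr0 expr0n.
rewrite big1 => [|a ak]; last first.
  by rewrite big1// => i _; rewrite !mxE (negbTE ak) mulr0 expr0n.
by rewrite !mxE !eqxx mulr1 !addr0.
Qed.

Let bound_ge0 (g : T -> R) (M : R) : (forall z, OD z -> `|g z| <= M) -> 0 <= M.
Proof. by case: ODn0 => z Oz /(_ z Oz); exact: le_trans. Qed.

Let entry_lin k a g h : bounded_on OD g -> bounded_on OD h ->
  L (entry_datum k (fun z => a * g z + h z)) = a * L (entry_datum k g) + L (entry_datum k h).
Proof.
move=> bg bh; rewrite -Llin; [|exact: bounded_entry|exact: bounded_entry]; congr L.
congr pair; apply/funext => z; last by rewrite /= !fctE scalerDl scalerA.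
by rewrite /= !fctE; apply/esym; rewrite scaler0 addr0.
Qed.

Let scalar_lin a g h : bounded_on OD g -> bounded_on OD h ->
  L (scalar_datum (fun z => a * g z + h z)) = a * L (scalar_datum g) + L (scalar_datum h).
Proof.
move=> bg bh; rewrite -Llin; [|exact: bounded_scalar|exact: bounded_scalar]; congr L.
congr pair; apply/funext => z //.
by rewrite /= !fctE; apply/esym; rewrite scaler0 addr0.
Qed.

Let normr_bound (l : (T -> R) -> R) :
  (forall (a : R) (g h : T -> R), bounded_on OD g -> bounded_on OD h ->
    l (fun z => a * g z + h z) = a * l g + l h) ->
  (forall (g : T -> R) (M : R), (forall z, OD z -> `|g z| <= M) -> l g <= c * M) ->
  forall (g : T -> R) (M : R), (forall z, OD z -> `|g z| <= M) -> `|l g| <= c * M.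
Proof.
move=> llin lle g M gM; rewrite ler_norml lle// andbT lerNl.
have bg : bounded_on OD g by exists M.
have l0 : l (fun=> 0) = 0.
  have := llin (-1) _ _ bounded_cst0 bounded_cst0.
  rewrite (_ : (fun _ => _) = fun=> 0) => [|]; first by lra.
  by apply/funext => z; rewrite mulr0 addr0.
have := llin (-1) _ _ bg bounded_cst0; rewrite l0 addr0 mulN1r => <-.
by apply: lle => z Oz; rewrite addr0 mulN1r normrN gM.
Qed.

Let entry_bound k (g : T -> R) (M : R) : (forall z, OD z -> `|g z| <= M) ->
  `|L (entry_datum k g)| <= c * M.
Proof.
move: g M; apply: normr_bound => [a g h|g M gM]; first exact: entry_lin.
apply: L_le; first by apply: bounded_entry; exists M.
move=> t Mt; have t0 : 0 < t by exact: le_lt_trans (bound_ge0 gM) Mt.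
split=> // z Oz; rewrite /= sqnorm_delta add0r ler_pdivrMr ?mulr_gt0//.
rewrite -real_normK ?num_real// (le_trans (_ : _ <= t ^+ 2))//.
  by rewrite lerXn2r ?nnegrE ?(ltW t0)// (le_trans (gM z Oz))// ltW.
by rewrite mulrCA -expr2 ler_peMl ?sqr_ge0// ler1n.
Qed.

Let scalar_bound (g : T -> R) (M : R) : (forall z, OD z -> `|g z| <= M) ->
  `|L (scalar_datum g)| <= c * M.
Proof.
move: g M; apply: normr_bound => [a g h|g M gM]; first exact: scalar_lin.
apply: L_le; first by apply: bounded_scalar; exists M.
move=> t Mt; have t0 : 0 < t by exact: le_lt_trans (bound_ge0 gM) Mt.
split=> // z Oz; rewrite /= sqnorm0 mul0r addr0.
by rewrite (le_trans (ler_norm _))// (le_trans (gM z Oz))// ltW.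
Qed.

(** For [g >= 0] the pair [(- g, 0)] is feasible for every [t > 0], so its gauge is at most 0 and
    [L] is at most 0 there. *)
Let scalar_ge0 g : bounded_on OD g -> (forall z, OD z -> 0 <= g z) -> 0 <= L (scalar_datum g).
Proof.
move=> bg g0; have := scalar_lin (-1) bg bounded_cst0.
rewrite (_ : scalar_datum (fun=> 0) = 0)// L0 addr0 mulN1r => /eqP; rewrite -eqr_oppLR => /eqP <-.
rewrite oppr_ge0 -[leRHS](mulr0 c); apply: L_le.
  apply: bounded_scalar; have [M gM] := bg.
  by exists M => z Oz; rewrite addr0 mulN1r normrN gM.
move=> t t0; split=> // z Oz; rewrite /= sqnorm0 mul0r !addr0 mulN1r.
by rewrite (le_trans _ (ltW t0))// oppr_le0 g0.
Qed.

Let L_sum (b : T -> 'M[R]_(p, q)) (s : seq ('I_p * 'I_q)) :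
  (forall k : 'I_p * 'I_q, bounded_on OD (fun z => b z k.1 k.2)) ->
  let u : @datum R p q T := ((fun=> 0), fun z => \sum_(k <- s) b z k.1 k.2 *: delta_mx k.1 k.2) in
  bounded u /\ L u = \sum_(k <- s) L (entry_datum k (fun z => b z k.1 k.2)).
Proof.
move=> bb; elim: s => [|k s [IHb IH]] /=.
  rewrite (_ : pair _ _ = 0); first by split=> //; rewrite big_nil.
  by congr pair; apply/funext => z; rewrite big_nil.
have bk := bounded_entry k (bb k).
rewrite (_ : pair _ _ = 1 *: entry_datum k (fun z => b z k.1 k.2) +
    ((fun=> 0), fun z => \sum_(k <- s) b z k.1 k.2 *: delta_mx k.1 k.2)).
  by split; [exact: bounded_datum_lin|rewrite Llin// mul1r big_cons IH].
congr pair; apply/funext => z; last by rewrite big_cons /= !fctE scale1r.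
by rewrite /= !fctE; apply/esym; rewrite scaler0 addr0.
Qed.

(** [L] is split into its restrictions to the scalar component and to each matrix entry. All are
    bounded by the gauge; the scalar one is positive and gives a measure, the others give
    charges. *)
Lemma functional_representation : exists (M : {finite_measure set T -> \bar R})
    (E : 'I_p -> 'I_q -> {charge set T -> \bar R}),
  [/\ forall A, measurable A -> A `&` OD = set0 -> M A = 0%E, vmeasure_on Omega D E &
    forall (a : T -> R) (b : T -> 'M[R]_(p, q)),
      {within OD, continuous a} -> {within OD, continuous b} ->
      L ((a : T -> R^o), b) = \int[M]_(z in OD) a z + vmeasure_integral Omega D E b].
Proof.
have [M [M0 LM]] := riesz_measure cO cD ODn0 scalar_lin scalar_bound scalar_ge0.
have /choice[E EP] : forall k, exists nu : {charge set T -> \bar R},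
    (forall A, A `&` OD = set0 -> nu A = 0%E) /\
    forall f : T -> R, {within OD, continuous f} -> L (entry_datum k f) = charge_integral nu OD f.
  move=> k.
  exact: (riesz_charge cO cD ODn0 (@entry_lin k) (@entry_bound k)).
exists M, (fun a i => E (a, i)); split=> [A _ /M0//|a i A _|a b ca cb].
  by have [h _] := EP (a, i); exact: h.
have bb (k : 'I_p * 'I_q) : bounded_on OD (fun z => b z k.1 k.2).
  by have [] := continuous_nice cO cD (@entry_continuous R p q Omega D p q b k.1 k.2 cb).
have [_ ba] := continuous_nice cO cD ca.
have [bu Lu] := L_sum (index_enum _) bb.
transitivity (L (1 *: scalar_datum a +
    ((fun=> 0), fun z => \sum_(k : 'I_p * 'I_q) b z k.1 k.2 *: delta_mx k.1 k.2))).
  congr L; congr pair; apply/funext => z.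
    by rewrite /= !fctE; apply/esym; rewrite scale1r addr0.
  rewrite /= !fctE scaler0 add0r [LHS]matrix_sum_delta.
  by rewrite pair_bigA.
rewrite Llin ?Lu ?mul1r ?LM//; last exact: bounded_scalar.
congr (_ + _); rewrite /vmeasure_integral pair_bigA /=.
apply: eq_bigr => -[a' i] _; have [_ ->]// := EP (a', i).
exact: entry_continuous.
Qed.

End functional_representation.

(** * Strong duality *)

Section duality.
Context {R : realType} {p q : nat} (Omega : set 'rV[R]_p) (D : set 'rV[R]_q).
Local Notation T := ('rV[R]_p * 'rV[R]_q)%type.
Local Notation OD := (Omega `*` D).
Hypotheses (p0 : (0 < p)%N) (cO : compact Omega) (cD : compact D) (ODn0 : OD !=set0).
Hypothesis O1 : lebesgue_rV p Omega = 1%E.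
Implicit Types (mu nu : 'rV[R]_p -> probability 'rV[R]_q R)
  (E : 'I_p -> 'I_q -> {charge set T -> \bar R}) (phi psi : C1 Omega D).

Lemma eq_map_integral mu (f g : T -> R) : (forall z, OD z -> f z = g z) ->
  map_integral Omega D mu f = map_integral Omega D mu g.
Proof.
move=> fg; apply: eq_Rintegral => x; rewrite inE => Ox.
by apply: eq_Rintegral => y; rewrite inE => Dy; exact: fg.
Qed.

Lemma C1_divO_opp1 : exists phi, (forall z, divO phi z = -1) /\ forall z, gradD phi z = 0.
Proof.
pose i0 := Ordinal p0.
have idq : qsmooth (fun t : R => t) (fun=> 1).
  exists 0; split=> // t u; rewrite mul0r; last by rewrite subrr normr0.
  by rewrite (_ : _ - _ = 0) ?normr0//; ring.
have gC := scalar_C1_coord (p := p) (q := q) i0 idq.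
have [w [wE dw]] := @C1_cst R p q Omega D (- delta_mx 0 i0).
have [phi [_ dphi]] := C1_scale w gC.
exists phi; split=> z; last first.
  apply/matrixP => b i; rewrite !mxE dphi dw scaler0 add0r.
  by rewrite /= !mxE mulr0 mul0r.
rewrite /divO (bigD1 i0)//= big1 ?addr0 => [|b bi0]; last first.
  by rewrite dphi dw scaler0 add0r wE !mxE eqxx (negbTE bi0) oppr0 mulr0.
by rewrite dphi dw scaler0 add0r wE !mxE !eqxx !mul1r.
Qed.

Section extension.
Variables (mub : 'rV[R]_p -> probability 'rV[R]_q R) (Eb : 'I_p -> 'I_q -> {charge set T -> \bar R}).
Hypothesis mubL : L2map Omega D mub.

Lemma pairing_lin phi psi (a : R) : exists chi : C1 Omega D, [/\
  forall z, divO chi z = a * divO phi z + divO psi z,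
  forall z, gradD chi z = a *: gradD phi z + gradD psi z &
  pairing mub Eb chi = a * pairing mub Eb phi + pairing mub Eb psi].
Proof.
have [chi [_ dchi]] := C1_lin phi psi a; exists chi.
have d z : divO chi z = a * divO phi z + divO psi z.
  by rewrite /divO mulr_sumr -big_split /=; apply: eq_bigr => i _; rewrite dchi !mxE.
have g z : gradD chi z = a *: gradD phi z + gradD psi z.
  by apply/matrixP => b i; rewrite !mxE dchi !mxE.
split=> //; have [M [_ _ Mint]] := L2map_integral_measure cO cD O1 mubL.
have cdiv phi' := continuous_nice cO cD (@divO_continuous _ _ _ _ _ phi').
have I phi' : map_integral Omega D mub (divO phi') = \int[M]_(z in OD) divO phi' z.
  by have [mf bf] := cdiv phi'; exact: Mint.
rewrite /pairing !I (_ : divO chi = fun z => a * divO phi z + divO psi z); last exact/funext.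
rewrite Rintegral_linear//; try exact: divO_continuous.
rewrite (_ : gradD chi = fun z => a *: gradD phi z + gradD psi z); last exact/funext.
rewrite vmeasure_integral_linear//; try exact: gradD_continuous.
by ring.
Qed.

(** The last conclusion is the energy bound for the pair [(mu, E)], stated before it is known to
    satisfy the continuity equation; that equation will follow from equality of the pairings. *)
Lemma dual_extension (s : R) : 0 <= s ->
  (forall phi, (forall z, OD z -> divO phi z + sqnorm (gradD phi z) / 2 <= 0) ->
    pairing mub Eb phi <= s) ->
  exists mu E, [/\ L2map Omega D mu, vmeasure_on Omega D E,
    forall phi, pairing mu E phi = pairing mub Eb phi &
    forall (a : T -> R) (b : T -> 'M[R]_(p, q)),
      {within OD, continuous a} -> {within OD, continuous b} ->
      (forall z, OD z -> a z + sqnorm (b z) / 2 <= 0) ->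
      map_integral Omega D mu a + vmeasure_integral Omega D E b <= s].
Proof.
move=> s0 sup_le.
have [Mb [MbT MbX Mbint]] := L2map_integral_measure cO cD O1 mubL.
have mO : measurable Omega by exact: compact_measurable_rV.
have mD : measurable D by exact: compact_measurable_rV.
have mOD := measurable_OD cO cD.
have MbOD : Mb OD = 1%E.
  rewrite MbX// setIid (eq_integral (cst 1%E)); first by rewrite integral_cst// mul1e.
  by move=> x; rewrite inE => Ox; exact: mubL.1.
have [phi0 [div0 grad0]] := C1_divO_opp1.
have pairing0 : pairing mub Eb phi0 = -1.
  rewrite /pairing (_ : gradD phi0 = fun=> 0); last exact/funext.
  rewrite (vmeasure_integral0 cO cD) addr0 (_ : divO phi0 = fun=> -1); last exact/funext.
  rewrite Mbint; last 2 first.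
  - exact: measurable_cst.
  - by exists 1 => z _; rewrite normrN normr1.
  by rewrite Rintegral_cst// [X in fine X]MbOD mulr1.
pose l (u : @datum R p q T) : R := map_integral Omega D mub (u.1 : T -> R) +
  vmeasure_integral Omega D Eb u.2.
pose rep (u : @datum R p q T) phi := forall z, OD z ->
  (u.1 z : R) = divO phi z /\ u.2 z = gradD phi z.
have lE u phi : rep u phi -> l u = pairing mub Eb phi.
  move=> uphi; rewrite /l /pairing; congr (_ + _).
    by apply: eq_map_integral => z /uphi[].
  by apply: eq_vmeasure_integral => z /uphi[].
pose W : set (@datum R p q T) := [set u | exists phi, rep u phi].
have replin (a : R) u v phi psi chi : rep u phi -> rep v psi ->
    (forall z, divO chi z = a * divO phi z + divO psi z) ->
    (forall z, gradD chi z = a *: gradD phi z + gradD psi z) -> rep (a *: u + v) chi.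
  by move=> hu hv hd hg z Oz; have [u1 u2] := hu z Oz; have [v1 v2] := hv z Oz;
    rewrite hd hg -u1 -u2 -v1 -v2.
have WB : W `<=` bounded_datum OD.
  move=> u [phi uphi]; split=> [|a i].
    have [_ [M hM]] := continuous_nice cO cD (@divO_continuous _ _ _ _ _ phi).
    by exists M => z Oz; have [-> _] := uphi z Oz; exact: hM.
  have [_ [M hM]] := continuous_nice cO cD (@gradD_entry_continuous _ _ _ _ _ phi a i).
  by exists M => z Oz; have [_ ->] := uphi z Oz; exact: hM.
have W0 : W 0.
  have [psi [_ dpsi]] := @C1_cst R p q Omega D 0.
  exists psi => z _; split.
    by rewrite /divO big1// => i _; rewrite dpsi mxE.
  by apply/matrixP => b i; rewrite !mxE dpsi mxE.
have Wlin : linear_subspace W.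
  split=> // a u v [phi uphi] [psi vpsi].
  have [chi [hd hg _]] := pairing_lin phi psi a.
  by exists chi; exact: replin uphi vpsi hd hg.
have llin : linear_on W l.
  move=> a u v [phi uphi] [psi vpsi].
  have [chi [hd hg hp]] := pairing_lin phi psi a.
  by rewrite (lE _ _ (replin a u v phi psi chi uphi vpsi hd hg)) hp (lE u phi)// (lE v psi).
have s1 : 0 < s + 1 by rewrite ltr_wpDl.
have l_le u : W u -> l u <= (s + 1) * gauge OD u.
  move=> Wu; have [phi uphi] := Wu; rewrite -ler_pdivrMl//; apply: le_gauge; first exact: WB.
  move=> t [t0 ut]; rewrite ler_pdivrMl// (lE u phi)//.
  (* Feasibility at [t] says exactly that [phi / t + phi0] satisfies the dual constraint; its value
     is that of [phi / t] minus 1. *)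
  have [chi [hd hg hp]] := pairing_lin phi phi0 t^-1.
  suff : t^-1 * pairing mub Eb phi - 1 <= s by rewrite lerBlDr ler_pdivrMl// mulrC.
  rewrite -pairing0 -hp; apply: sup_le => z Oz; rewrite hd hg div0 grad0 addr0 sqnormZ.
  have [u1 u2] := uphi z Oz; have := ut z Oz; rewrite u1 u2.
  rewrite -(ler_pM2l (_ : 0 < t^-1)) ?invr_gt0// mulVf ?gt_eqF// mulrDr => h.
  rewrite (_ : _ / 2 = t^-1 * (sqnorm (gradD phi z) / (2 * t))); first by lra.
  by field; rewrite gt_eqF.
have [L [Llin LW Lc]] := hahn_banach (bounded_datum_subspace OD)
  (gauge_sublinear OD (ltW s1)) Wlin WB llin l_le.
have [M [E [M0 E0 LME]]] := functional_representation cO cD ODn0 (ltW s1) Llin Lc.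
have Lphi phi : L ((divO phi : T -> R^o), gradD phi) = pairing mub Eb phi.
  by rewrite LW; [exact: lE|exists phi].
have Mphi phi : \int[M]_(z in OD) divO phi z + vmeasure_integral Omega D E (gradD phi) =
    pairing mub Eb phi.
  by rewrite -Lphi LME//; [exact: divO_continuous|exact: gradD_continuous].
(* For a field with zero [gradD], equality of the pairings involves the two measures only, so [M]
   and [Mb] have the same first marginal. *)
have Mmarg A : measurable A -> M (A `*` setT) = lebesgue_rV p (A `&` Omega).
  move=> mA; transitivity (Mb (A `*` setT)).
    apply: (eq_first_marginal cO cD p0 M0) => // [B mB B0|phi gphi].
      apply/eqP; rewrite eq_le measure_ge0 andbT.
      have : (Mb B + Mb OD <= Mb setT)%E.
        by rewrite -[leLHS](measureU Mb mB mOD B0); apply: le_measure; rewrite ?inE//; exact: measurableU.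
      rewrite MbOD MbT -(fineK (fin_num_measure Mb _ mB)) -EFinD !lee_fin.
      by rewrite gerDr.
    have gE : gradD phi = fun=> 0 by apply/funext.
    have := Mphi phi; rewrite /pairing gE !(vmeasure_integral0 cO cD) !addr0 => ->.
    by have [mf bf] := continuous_nice cO cD (@divO_continuous _ _ _ _ _ phi); exact: Mbint.
  rewrite MbX// (eq_integral (cst 1%E)) => [|x _]; last by rewrite probability_setT.
  by rewrite integral_cst ?mul1e//; exact: measurableI.
have Dn0 : D !=set0 by case: ODn0 => z [_ Dz]; exists z.2.
have [mu [muL muint]] := disintegration cO cD O1 Dn0 M0 Mmarg.
have muE (a : T -> R) : {within OD, continuous a} ->
    map_integral Omega D mu a = \int[M]_(z in OD) a z.
  by move=> ca; have [ma ba] := continuous_nice cO cD ca; exact: muint.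
exists mu, E; split=> // [phi|a b ca cb ab].
  by rewrite -Mphi /pairing muE//; exact: divO_continuous.
rewrite muE// -LME//.
have Bab : bounded_datum OD ((a : T -> R^o), b).
  split=> [|i j]; first by have [] := continuous_nice cO cD ca.
  by have [] := continuous_nice cO cD (@entry_continuous R p q Omega D p q b i j cb).
pose u0 : @datum R p q T := ((divO phi0 : T -> R^o), gradD phi0).
have Wu0 : W u0 by exists phi0.
have Bu0 := WB _ Wu0.
(* [v] is the pair [(a + 1, b)], feasible for [t = 1]; since [L u0 = -1], the bound [s + 1] on [L v]
   is the bound [s] on [L (a, b)]. *)
pose v : @datum R p q T := (-1) *: u0 + ((a : T -> R^o), b).
have Bv : bounded_datum OD v by exact: bounded_datum_lin.
have fv : feasible OD v 1.
  split=> // z Oz; rewrite mulr1.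
  rewrite -[v.1 z]/(-1 * divO phi0 z + a z) -[v.2 z]/(-1 *: gradD phi0 z + b z).
  by rewrite div0 grad0 scaler0 add0r; have := ab z Oz; move: (_ / 2) => x; lra.
have := Lc v Bv; have := gauge_le fv; rewrite -(ler_pM2l s1) => g1 g2.
have := le_trans g2 g1; rewrite Llin// LW// (lE u0 phi0)// pairing0.
by move: (L _) => x; lra.
Qed.

End extension.
End duality.

Lemma Dir_witness {R : realType} {p q : nat} (Omega : set 'rV[R]_p) (D : set 'rV[R]_q)
    (mu : 'rV[R]_p -> probability 'rV[R]_q R) : (Dir Omega D mu < +oo)%E ->
  exists2 E, continuity_eq Omega D mu E & (Dir2 Omega D mu E < +oo)%E.
Proof. by move=> /ereal_inf_lt[_ [E cE <-] fE]; exists E. Qed.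

Theorem theorem4p7 (R : realType) (p q : nat)
    (Omega : set 'rV[R]_p) (D : set 'rV[R]_q)
    (mub : 'rV[R]_p -> probability 'rV[R]_q R)
    (hp : (0 < p)%N) (hq : (0 < q)%N)
    (cOmega : compact Omega) (connOmega : connected Omega)
    (iOmega : Omega° !=set0) (lOmega : lipschitz_boundary Omega)
    (mOmega : lebesgue_rV p Omega = 1%E)
    (cD : compact D) (convD : convex_set (D : set (convex_lmodType 'rV[R]_q)))
    (iD : D° !=set0)
    (hmub : H1 Omega D mub) :
  exists mu : 'rV[R]_p -> probability 'rV[R]_q R,
    [/\ H1 Omega D mu,
        same_boundary Omega D mu mub,
        forall nu : 'rV[R]_p -> probability 'rV[R]_q R,
          H1 Omega D nu -> same_boundary Omega D nu mub ->
          (Dir Omega D mu <= Dir Omega D nu)%E &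
        ereal_sup [set (BT mub phi)%:E | phi in
          [set phi : C1 Omega D | forall z, (Omega `*` D) z ->
             divO phi z + sqnorm (gradD phi z) / 2 <= 0]] =
        Dir Omega D mu].
Proof.
have [mubL mubfin] := hmub; have [Eb cEb fEb] := Dir_witness mubfin.
have ODn0 : (Omega `*` D) !=set0.
  have [x /interior_subset Ox] := iOmega; have [y /interior_subset Dy] := iD.
  by exists (x, y).
set adm := [set phi : C1 Omega D | _].
set S := ereal_sup _.
have BTb (phi : C1 Omega D) : BT mub phi = pairing mub Eb phi.
  exact: (BT_pairing cOmega cD mOmega lOmega mubL phi cEb fEb).
have weak nu : H1 Omega D nu -> same_boundary Omega D nu mub -> (S <= Dir Omega D nu)%E.
  move=> [nuL _] nub; apply: le_ereal_inf_tmp => _ [E cE <-].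
  (* The trace can be computed with [E] only when its energy is finite; the other case is trivial.
     For admissible [phi] the pair of its divergence and gradient competes in [Dir2]. *)
  have [fE|] := ltP (Dir2 Omega D nu E) +oo%E; last by rewrite leye_eq => /eqP ->; exact: leey.
  apply: ge_ereal_sup => _ [phi admphi <-]; rewrite -nub.
  have -> : BT nu phi = pairing nu E phi. by exact: (BT_pairing cOmega cD mOmega lOmega nuL phi cE fE).
  apply: ereal_sup_ubound; exists (divO phi), (gradD phi); split=> //.
  - exact: divO_continuous.
  - exact: gradD_continuous.
(* The zero field is admissible; together with weak duality at [mub] this makes [S] a real number,
   as the extension requires. *)
have S0 : (0 <= S)%E.
  have [phi [_ dphi]] := @C1_cst R p q Omega D 0.
  have dv z : divO phi z = 0 by rewrite /divO big1// => i _; rewrite dphi mxE.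
  have gd z : gradD phi z = 0 by apply/matrixP => b i; rewrite !mxE dphi mxE.
  apply: ereal_sup_ubound; exists phi.
    move=> z _; rewrite dv gd add0r /sqnorm big1 ?mul0r// => a _.
    by rewrite big1// => i _; rewrite mxE expr0n.
  rewrite BTb /pairing (_ : gradD phi = fun=> 0); last exact/funext.
  rewrite vmeasure_integral0// addr0 (_ : divO phi = fun=> 0); last exact/funext.
  transitivity (\int[lebesgue_rV p]_(xi in Omega) 0)%:E.
    by congr EFin; apply: eq_Rintegral => x _; rewrite /Rintegral integral0.
  by rewrite /Rintegral integral0.
have Sfin : (S < +oo)%E by exact: le_lt_trans (weak mub hmub (fun=> erefl)) mubfin.
have SE : S = (fine S)%:E by rewrite fineK// ge0_fin_numE.
have [|phi admphi|mu [E [muL vE muBT muD]]] :=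
    @dual_extension R p q Omega D hp cOmega cD ODn0 mOmega mub Eb mubL (fine S).
- exact: fine_ge0.
- by rewrite -lee_fin -SE -BTb; apply: ereal_sup_ubound; exists phi.
(* Both pairings agree on every field, in particular on those with interior support, where the one
   of [mub] vanishes. *)
have cE : continuity_eq Omega D mu E.
  by split=> // phi sphi; rewrite muBT; have [_] := cEb; exact.
have leS : (Dir2 Omega D mu E <= S)%E.
  apply: ge_ereal_sup => _ [a [b [ca cb ab ->]]].
  by rewrite SE lee_fin; exact: muD.
have Dir_le : (Dir Omega D mu <= S)%E.
  by apply: le_trans leS; apply: ereal_inf_lbound; exists E.
have fE : (Dir2 Omega D mu E < +oo)%E by exact: le_lt_trans leS Sfin.
have muH1 : H1 Omega D mu := conj muL (le_lt_trans Dir_le Sfin).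
have mub_mu : same_boundary Omega D mu mub.
  by move=> phi; rewrite BTb -muBT; exact: (BT_pairing cOmega cD mOmega lOmega muL phi cE fE).
exists mu; split; [exact: muH1|exact: mub_mu|move=> nu nuH1 nub|].
  exact: le_trans Dir_le (weak nu nuH1 nub).
by apply/eqP; rewrite eq_le Dir_le weak.
Qed.
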